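(* Let $\mu$ be a complex number with $\Re(\mu)>0$. For the Seeley-de Witt coefficients $\tilde a_0[p,q],\tilde a_2[p,q],\tilde a_4[p,q]$ of the two-parametric family of Bianchi IX gravitational instantons, $$\tilde a_0[p,q]\left(\tfrac i\mu\right)=-\mu^2\,\tilde a_0[-q,p](i\mu),$$ $$\tilde a_2[p,q]\left(\tfrac i\mu\right)=-\mu^2\,\tilde a_2[-q,p](i\mu),$$ $$\tilde a_4[p,q]\left(\tfrac i\mu\right)=-\mu^2\,\tilde a_4[-q,p](i\mu).$$
   Context: General coefficients. Let $\sigma_1,\sigma_2,\sigma_3$ be the left-invariant 1-forms on $SU(2)\cong\mathbb S^3$ with $d\sigma_1=\sigma_2\wedge\sigma_3$ and cyclic permutations ($\int_{\mathbb S^3}|\sigma_1\wedge\sigma_2\wedge\sigma_3|=16\pi^2$). For functions $w_1,w_2,w_3,F$ of $\mu$ let $\tilde D$ be the Dirac operator (rank 4 spinors) of $d\tilde s^2 = F\left(w_1w_2w_3\,d\mu^2+\frac{w_2w_3}{w_1}\sigma_1^2+\frac{w_3w_1}{w_2}\sigma_2^2+\frac{w_1w_2}{w_3}\sigma_3^2\right)$, and consider $\mathrm{Trace}(\exp(-t\tilde D^2))\sim t^{-2}\sum_{n\ge0}\tilde a_{2n}t^n$, $t\to0^+$. Each coefficient is $\int(\cdot)\,d\mu$ of a function of $\mu$, obtained by integrating the local heat kernel coefficient of $\tilde D^2$ (times the volume density) over $\mathbb S^3$; this function of $\mu$ is again denoted $\tilde a_{2n}$, and it is a rational expression with rational coefficients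 in $w_1,w_2,w_3,F$ and their $\mu$-derivatives. Explicitly $\tilde a_0=4F^2w_1w_2w_3$ and $$\tilde a_2=-\tfrac F3(w_1^2+w_2^2+w_3^2)+\tfrac F6\Big(\tfrac{w_1^2w_2^2-w_3'^2}{w_3^2}+\tfrac{w_1^2w_3^2-w_2'^2}{w_2^2}+\tfrac{w_2^2w_3^2-w_1'^2}{w_1^2}\Big)-\tfrac F3\Big(\tfrac{w_1'w_2'}{w_1w_2}+\tfrac{w_1'w_3'}{w_1w_3}+\tfrac{w_2'w_3'}{w_2w_3}\Big)+\tfrac F3\Big(\tfrac{w_1''}{w_1}+\tfrac{w_2''}{w_2}+\tfrac{w_3''}{w_3}\Big)-\tfrac{F'^2}{2F}+F''.$$ Two-parametric family. For $p,q\in\mathbb C$, $\Re(\mu)>0$, put $\vartheta[p,q](i\mu)=\sum_{m\in\mathbb Z}\exp(-\pi(m+p)^2\mu+2\pi i(m+p)q)$, $\vartheta_2=\vartheta[\frac12,0]$, $\vartheta_3=\vartheta[0,0]$, $\vartheta_4=\vartheta[0,\frac12]$, and let $\partial_q\vartheta[a,b]$ denote the derivative in the second characteristic evaluated at $[a,b]$. Set (all theta functions at $i\mu$, $\Lambda$ a nonzero constant) $$w_1[p,q]=-\tfrac i2\vartheta_3\vartheta_4\frac{\partial_q\vartheta[p,q+\frac12]}{e^{\pi ip}\vartheta[p,q]},\quad w_2[p,q]=\tfrac i2\vartheta_2\vartheta_4\frac{\partial_q\vartheta[p+\frac12,q+\frac12]}{e^{\pi ip}\vartheta[p,q]},$$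 $$w_3[p,q]=-\tfrac12\vartheta_2\vartheta_3\frac{\partial_q\vartheta[p+\frac12,q]}{\vartheta[p,q]},\quad F[p,q]=\frac{2}{\pi\Lambda}\left(\frac{\vartheta[p,q]}{\partial_q\vartheta[p,q]}\right)^2.$$ $\tilde a_{2n}[p,q](i\mu)$ is the function obtained by substituting $w_j=w_j[p,q]$, $F=F[p,q]$ in the expression for $\tilde a_{2n}$, continued to complex $\mu$ with $\Re(\mu)>0$; parameters and points where a denominator vanishes are excluded. All these are functions of the variable $i\mu$ in the upper half-plane; the value at $i/\mu$ is the value at time $1/\mu$ (derivatives being taken with respect to the time variable before evaluating). *)

(* Defs.v *)
From HB Require Import structures.
From mathcomp Require Import all_boot all_order all_algebra.
From mathcomp Require Import complex.
From mathcomp Require Import all_classical all_reals all_analysis.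
Import Order.TTheory GRing.Theory Num.Theory.
Import numFieldNormedType.Exports.

Set Implicit Arguments.
Unset Strict Implicit.
Unset Printing Implicit Defensive.

Local Open Scope complex_scope.
Local Open Scope classical_set_scope.
Local Open Scope ring_scope.

(* Naming R[i] as a numClosedFieldType gives it the normed module structure of
   a field over itself, so that [derive1], ['D_v f], [differentiable] and [lim]
   are the complex-analytic notions. *)
Definition Cplx (R : realType) : numClosedFieldType := R[i].

Definition piC (R : realType) : Cplx R := (pi : R)%:C.

Definition expC (R : realType) (z : Cplx R) : Cplx R :=
  (expR (complex.Re z))%:C *
  (cos (complex.Im z) +i* sin (complex.Im z) : R[i]).

(* The time [t] stands for mu, i.e. for the modular variable tau = i mu. *)
Definition theta_term (R : realType) (p q t : Cplx R) (m : int) : Cplx R :=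
  expC (- piC R * (m%:~R + p) ^+ 2 * t + 2 * piC R * 'i * (m%:~R + p) * q).

(* The series over Z converges absolutely for 0 < Re t, so its sum is the limit
   of the sums over -N <= m <= N. *)
Definition theta (R : realType) (p q t : Cplx R) : Cplx R :=
  limn (fun N : nat =>
    \sum_(k < N.*2.+1) theta_term p q t ((k : nat)%:Z - N%:Z)).

Definition dtheta (R : realType) (p q t : Cplx R) : Cplx R :=
  derive1 (fun b : Cplx R => theta p b t) q.

Definition theta2 (R : realType) (t : Cplx R) : Cplx R := theta 2^-1 0 t.
Definition theta3 (R : realType) (t : Cplx R) : Cplx R := theta 0 0 t.
Definition theta4 (R : realType) (t : Cplx R) : Cplx R := theta 0 2^-1 t.

Definition w1_inst (R : realType) (p q t : Cplx R) : Cplx R :=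
  - ('i / 2) * theta3 t * theta4 t *
  (dtheta p (q + 2^-1) t / (expC (piC R * 'i * p) * theta p q t)).

Definition w2_inst (R : realType) (p q t : Cplx R) : Cplx R :=
  ('i / 2) * theta2 t * theta4 t *
  (dtheta (p + 2^-1) (q + 2^-1) t / (expC (piC R * 'i * p) * theta p q t)).

Definition w3_inst (R : realType) (p q t : Cplx R) : Cplx R :=
  - (1 / 2) * theta2 t * theta3 t * (dtheta (p + 2^-1) q t / theta p q t).

Definition F_inst (R : realType) (Lambda p q t : Cplx R) : Cplx R :=
  2 / (piC R * Lambda) * (theta p q t / dtheta p q t) ^+ 2.

Definition sdw0 (R : realType) (w1 w2 w3 F : Cplx R -> Cplx R) (t : Cplx R)
    : Cplx R :=
  4 * F t ^+ 2 * w1 t * w2 t * w3 t.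

Definition sdw2 (R : realType) (w1 w2 w3 F : Cplx R -> Cplx R) (t : Cplx R)
    : Cplx R :=
  let: (a, b, c, f) := (w1 t, w2 t, w3 t, F t) in
  let: (a1, b1, c1, f1) :=
    (derive1 w1 t, derive1 w2 t, derive1 w3 t, derive1 F t) in
  let: (a2, b2, c2, f2) :=
    (derive1 (derive1 w1) t, derive1 (derive1 w2) t, derive1 (derive1 w3) t,
     derive1 (derive1 F) t) in
  - (f / 3) * (a ^+ 2 + b ^+ 2 + c ^+ 2)
  + (f / 6) * ((a ^+ 2 * b ^+ 2 - c1 ^+ 2) / c ^+ 2
             + (a ^+ 2 * c ^+ 2 - b1 ^+ 2) / b ^+ 2
             + (b ^+ 2 * c ^+ 2 - a1 ^+ 2) / a ^+ 2)
  - (f / 3) * (a1 * b1 / (a * b) + a1 * c1 / (a * c) + b1 * c1 / (b * c))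
  + (f / 3) * (a2 / a + b2 / b + c2 / c)
  - f1 ^+ 2 / (2 * f) + f2.

(* Points (t, g) of time x group.  Functions live on a neighbourhood in the
   ambient C x M_2(C); the fields below are tangent to the level sets of det,
   so everything restricts to the complexification SL_2(C) of SU(2). *)
Definition spacetime (R : realType) : normedModType (Cplx R) :=
  (Cplx R * 'M[Cplx R]_2)%type.

Definition base_point (R : realType) (mu : Cplx R) : spacetime R := (mu, 1%:M).

Definition mx2 (R : realType) (a b c d : Cplx R) : 'M[Cplx R]_2 :=
  block_mx (a%:M : 'M[Cplx R]_1) (b%:M : 'M[Cplx R]_1) (c%:M : 'M[Cplx R]_1) (d%:M : 'M[Cplx R]_1).

Definition pauli1 (R : realType) : 'M[Cplx R]_2 := mx2 0 1 1 0.
Definition pauli2 (R : realType) : 'M[Cplx R]_2 := mx2 0 (- 'i) 'i 0.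
Definition pauli3 (R : realType) : 'M[Cplx R]_2 := mx2 1 0 0 (- 1).

(* Clifford matrices, normalised by
   gamma_a gamma_b + gamma_b gamma_a = - 2 delta_ab. *)
Definition gamma0 (R : realType) : 'M[Cplx R]_4 :=
  block_mx (0 : 'M[Cplx R]_2) (1%:M : 'M[Cplx R]_2) (- 1%:M : 'M[Cplx R]_2) (0 : 'M[Cplx R]_2).
Definition gammaj (R : realType) (sigma : 'M[Cplx R]_2) : 'M[Cplx R]_4 :=
  block_mx (0 : 'M[Cplx R]_2) ('i *: sigma) ('i *: sigma) (0 : 'M[Cplx R]_2).
Definition gamma1 (R : realType) : 'M[Cplx R]_4 := gammaj (pauli1 R).
Definition gamma2 (R : realType) : 'M[Cplx R]_4 := gammaj (pauli2 R).
Definition gamma3 (R : realType) : 'M[Cplx R]_4 := gammaj (pauli3 R).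

Definition d_time (R : realType) (W : normedModType (Cplx R))
    (f : spacetime R -> W) (z : spacetime R) : W :=
  'D_((1, 0) : spacetime R) f z.

(* The left-invariant field g |-> g T with T = (i/2) sigma_j in su(2).  Since
   [T_2, T_3] = - T_1 and cyclically, the fields X_1, X_2, X_3 are dual to
   forms with d sigma_1 = sigma_2 /\ sigma_3 and cyclically. *)
Definition X_field (R : realType) (W : normedModType (Cplx R))
    (sigma : 'M[Cplx R]_2) (f : spacetime R -> W) (z : spacetime R) : W :=
  'D_((0, z.2 *m (('i / 2) *: sigma)) : spacetime R) f z.

(* Orthonormal coframe theta^0 = s0 dt, theta^j = sj sigma_j.  Cartan's
   equations d theta^a = - omega^a_b /\ theta^b give
     omega^i_0 = (si' / s0) sigma_i,
     omega^j_k = (sj^2 + sk^2 - si^2) / (2 sj sk) sigma_i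
   for (i, j, k) cyclic, and the spin connection is
   - 1/2 sum_(a < b) omega_ab gamma_a gamma_b for the above sign of the
   Clifford relations.  This is its value on X_i (it vanishes on d/dt). *)
Definition spin_connection (R : realType) (s0 si sj sk : Cplx R -> Cplx R)
    (gi gj gk : 'M[Cplx R]_4) (t : Cplx R) : 'M[Cplx R]_4 :=
  - 2^-1 *: ((derive1 si t / s0 t) *: (gi *m gamma0 R)
     + ((sj t ^+ 2 + sk t ^+ 2 - si t ^+ 2) / (2 * sj t * sk t))
         *: (gj *m gk)).

(* The Dirac operator sum_a gamma_a nabla_(E_a), E_a = s_a^-1 e_a, of the metric
   s0^2 dt^2 + s1^2 sigma_1^2 + s2^2 sigma_2^2 + s3^2 sigma_3^2, in the spinor
   frame of this coframe.  It acts on columns; matrix-valued arguments are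
   spinors tensored with the dual of the spinor space at a fixed point. *)
Definition dirac (R : realType) (s0 s1 s2 s3 : Cplx R -> Cplx R)
    (U : spacetime R -> 'M[Cplx R]_4) (z : spacetime R) : 'M[Cplx R]_4 :=
  let: t := z.1 in
  let: (g1, g2, g3) := (gamma1 R, gamma2 R, gamma3 R) in
  (s0 t)^-1 *: (gamma0 R *m d_time U z)
  + (s1 t)^-1 *: (g1 *m (X_field (pauli1 R) U z
                         + spin_connection s0 s1 s2 s3 g1 g2 g3 t *m U z))
  + (s2 t)^-1 *: (g2 *m (X_field (pauli2 R) U z
                         + spin_connection s0 s2 s3 s1 g2 g3 g1 t *m U z))
  + (s3 t)^-1 *: (g3 *m (X_field (pauli3 R) U z
                         + spin_connection s0 s3 s1 s2 g3 g1 g2 t *m U z)).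

(* Holomorphy near y.  Over the complex numbers the second clause is
   automatic. *)
Definition holo_near (R : realType) (V W : normedModType (Cplx R))
    (f : V -> W) (y : V) : Prop :=
  \forall z \near y,
    differentiable f z /\ forall v : V, differentiable ('D_v f) z.

Definition gaussian (R : realType) (rho : spacetime R -> Cplx R) (t : Cplx R)
    (z : spacetime R) : Cplx R :=
  expC (- rho z / (4 * t)) / (4 * piC R * t) ^+ 2.

Definition heat_approx (R : realType) (rho : spacetime R -> Cplx R)
    (U0 U1 U2 : spacetime R -> 'M[Cplx R]_4) (t : Cplx R) (z : spacetime R)
    : 'M[Cplx R]_4 :=
  gaussian rho t z *: (U0 z + t *: U1 z + t ^+ 2 *: U2 z).

(* Minakshisundaram-Pleijel expansion, at the point y = (mu, 1), of the kernel
   of exp (- t D^2), D the Dirac operator of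
   g0 dt^2 + g1 sigma_1^2 + g2 sigma_2^2 + g3 sigma_3^2:
   exp (- rho / 4t) (4 pi t)^-2 (U0 + t U1 + t^2 U2), with rho critical and zero
   and U0 the identity at y, solves the heat equation up to the term
   exp (- rho / 4t) (4 pi t)^-2 t^2 D^2 U2.  Expanding in powers of t, this is
   the eikonal equation |d rho|^2 = 4 rho of the squared distance to y and the
   transport equations of U0, U1, U2.  These determine rho, U0, U1, U2 on the
   SL_2(C) slice up to the signs of the square roots s_a of the g_a, which only
   conjugate U0, U1, U2.  All this makes sense for complex metrics, and U2(y)
   then depends on the jets of the metric at mu as it does for real ones. *)
Definition heat_expansion (R : realType) (g0 g1 g2 g3 : Cplx R -> Cplx R)
    (mu : Cplx R) (U0 U1 U2 : spacetime R -> 'M[Cplx R]_4) : Prop :=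
  let y := base_point mu in
  exists (s0 s1 s2 s3 : Cplx R -> Cplx R) (rho : spacetime R -> Cplx R),
  [/\ [/\ holo_near s0 mu, holo_near s1 mu, holo_near s2 mu & holo_near s3 mu],
      \forall t \near mu, [/\ s0 t ^+ 2 = g0 t, s1 t ^+ 2 = g1 t,
                              s2 t ^+ 2 = g2 t & s3 t ^+ 2 = g3 t],
      [/\ holo_near rho y, holo_near U0 y, holo_near U1 y & holo_near U2 y],
      [/\ rho y = 0, forall v : spacetime R, 'D_v rho y = 0 & U0 y = 1%:M] &
      \forall z \near y, forall t : Cplx R, t != 0 ->
        let D := dirac s0 s1 s2 s3 in
        derive1 (fun t' : Cplx R => heat_approx rho U0 U1 U2 t' z) t
        + D (D (heat_approx rho U0 U1 U2 t)) z
        = gaussian rho t z *: (t ^+ 2 *: D (D U2) z)].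

(* The coefficient of t^(-2+2) in the trace of the heat kernel on the diagonal
   at (mu, 1), hence, by left invariance, at all points of time mu. *)
Definition is_local_heat_coef4 (R : realType) (g0 g1 g2 g3 : Cplx R -> Cplx R)
    (mu A : Cplx R) : Prop :=
  exists U0 U1 U2 : spacetime R -> 'M[Cplx R]_4,
    heat_expansion g0 g1 g2 g3 mu U0 U1 U2 /\
    A = \tr (U2 (base_point mu)) / (4 * piC R) ^+ 2.

Definition local_heat_coef4 (R : realType) (g0 g1 g2 g3 : Cplx R -> Cplx R)
    (mu : Cplx R) : Cplx R :=
  get [set A : Cplx R | unique (is_local_heat_coef4 g0 g1 g2 g3 mu) A].

(* Integration over S^3: the local coefficient is constant on S^3, the volume
   density is F^2 w1 w2 w3 |sigma_1 /\ sigma_2 /\ sigma_3| dmu, and the total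
   mass of |sigma_1 /\ sigma_2 /\ sigma_3| is 16 pi^2. *)
Definition sdw4 (R : realType) (w1 w2 w3 F : Cplx R -> Cplx R) (mu : Cplx R)
    : Cplx R :=
  16 * piC R ^+ 2 * (F mu ^+ 2 * w1 mu * w2 mu * w3 mu) *
  local_heat_coef4
    (fun t => F t * (w1 t * w2 t * w3 t))
    (fun t => F t * (w2 t * w3 t / w1 t))
    (fun t => F t * (w3 t * w1 t / w2 t))
    (fun t => F t * (w1 t * w2 t / w3 t)) mu.

Definition sdw0_inst (R : realType) (Lambda p q : Cplx R) : Cplx R -> Cplx R :=
  sdw0 (w1_inst p q) (w2_inst p q) (w3_inst p q) (F_inst Lambda p q).
Definition sdw2_inst (R : realType) (Lambda p q : Cplx R) : Cplx R -> Cplx R :=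
  sdw2 (w1_inst p q) (w2_inst p q) (w3_inst p q) (F_inst Lambda p q).
Definition sdw4_inst (R : realType) (Lambda p q : Cplx R) : Cplx R -> Cplx R :=
  sdw4 (w1_inst p q) (w2_inst p q) (w3_inst p q) (F_inst Lambda p q).

(* Main.v *)
(* Jacobi inversion reads theta[p,q](1/t) = w e^(2 pi i p q) theta[-q,p](t) with
   w^2 = t.  Hence, with tildes for the parameters (-q, p),
     w1(1/t) = t^2 w3~(t),     w2(1/t) = t^2 w2~(t),
     w3(1/t) = - t^2 w1~(t),   F(1/t) = - t^-2 F~(t).
   For a0 and a2 the theorem is then an identity between jets.  For a4, the two
   metrics correspond to each other under the isometry (t, g) |-> (1/t, h g h^-1),
   where h in SU(2) is a rotation exchanging sigma_1 and sigma_3 up to sign; as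
   it can be lifted to spinors, it transports the heat kernel expansions.
   Jacobi inversion is proved by evaluating a sampled periodised Gaussian by the
   discrete Fourier transform: its coefficients are Riemann sums of the Fourier
   integral of the Gaussian, and refining the grid gives the theta series of the
   inverse parameter by dominated convergence. *)

Require Import Defs.
From HB Require Import structures.
From mathcomp Require Import all_boot all_order all_algebra.
From mathcomp Require Import complex.
From mathcomp Require Import all_classical all_reals all_analysis.
From mathcomp Require Import ring lra zify.
Import Order.TTheory GRing.Theory Num.Theory.
Import numFieldNormedType.Exports.
Set Implicit Arguments.
Unset Strict Implicit.
Unset Printing Implicit Defensive.
Local Open Scope classical_set_scope.
Local Open Scope ring_scope.

(** * Inversion of time as an isometry *)

(** The coefficient a4 is specified only by [get] from a uniqueness predicate, so there is no
    formula to compute with; what is proved is that the predicates at [mu] and at [mu^-1] coincide.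
    The Dirac operators are intertwined on arbitrary fields, without tracking regularity: the
    derivative rules also cover divergent quotients, where [lim] returns the default [point], equal
    to [0] in the spaces at hand.

    In Jacobi inversion the obstacle is that the square root w of t is complex, in the sector |Im w|
    < Re w: the limit of the Riemann sums of the Gaussian must not depend on w, which is usually
    shown by deforming a contour. Here the segment from (1, 0) to (w, z) is cut into as many steps
    as there are grid points per unit length; each step changes the summand by an exact discrete
    difference, up to an error that sums to O(1/N^2). The Gaussian integral is not computed: at w =
    1, z = 0 both sides of the limit identity contain the same nonzero series, which forces the
    Riemann sums to tend to 1. *)

Lemma divr_diff_inv (K : fieldType) (a h : K) :
  a != 0 -> h != 0 -> a + h != 0 ->
  - ((a + h)^-1 / a) / ((a + h)^-1 - a^-1) = h^-1.
Proof.
move=> a0 h0 ah0.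
have -> : (a + h)^-1 - a^-1 = h * - ((a + h)^-1 / a).
  by field; rewrite a0 ah0.
by rewrite invfM mulrCA mulfV ?mulr1// oppr_eq0 mulf_neq0 ?invr_eq0.
Qed.

(** Convergence passes back from [L (f x)] to [f x] by [L'], so the two limits exist together; if
    they do not, both are the default [point], which [L] fixes. *)
Lemma lim_homeo (K : numFieldType) (V W : normedModType K) (L : V -> W)
    (L' : W -> V) (U : Type) (F : set_system U) (f : U -> V) :
  ProperFilter F -> continuous L -> continuous L' -> cancel L L' ->
  L point = point -> lim (L (f x) @[x --> F]) = L (lim (f x @[x --> F])).
Proof.
move=> FF cL cL' LK Lp.
have [/cvg_ex[l fl]|nf] := pselect (cvg (f x @[x --> F])).
  rewrite (cvg_lim _ fl); last exact: norm_hausdorff.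
  apply: cvg_lim; first exact: norm_hausdorff.
  exact: continuous_cvg (cL _) fl.
rewrite (dvgP nf) Lp dvgP// => /cvg_ex[l Lfl]; apply: nf.
apply/cvg_ex; exists (L' l).
have e : f = (fun x => L' (L (f x))) by apply/funext => x; rewrite LK.
rewrite e; exact: (cvg_comp _ _ Lfl (cL' l)).
Qed.

Section DeriveInv.
Variables (K : numFieldType) (W : normedModType K).

Lemma cvg_addl_inv (a : K) : a != 0 ->
  (a + h)^-1 @[h --> (0 : K)^'] --> a^-1.
Proof.
move=> a0; apply: cvgV => //; rewrite -[X in _ --> X]addr0.
apply: cvgD; first exact: cvg_cst.
exact: nbhs_dnbhs.
Qed.

Lemma near_add_neq0 (a : K) : a != 0 -> \forall h \near (0 : K)^', a + h != 0.
Proof.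
move=> a0.
have : a + h @[h --> (0 : K)^'] --> a.
  rewrite -[X in _ --> X]addr0.
  by apply: cvgD; [exact: cvg_cst | exact: nbhs_dnbhs].
move=> /cvgr_neq0; exact.
Qed.

Lemma cvg_shift_inv (a : K) : a != 0 ->
  (a + h)^-1 - a^-1 @[h --> (0 : K)^'] --> (0 : K)^'.
Proof.
move=> a0 A; rewrite /dnbhs /within /= => A0.
have cv : (a + h)^-1 - a^-1 @[h --> (0 : K)^'] --> (0 : K).
  rewrite -[X in _ --> X](subrr a^-1).
  by apply: cvgB; [exact: cvg_addl_inv | exact: cvg_cst].
have := cv _ A0; rewrite !near_simpl /= => nA.
suff : \forall h \near (0 : K)^', A ((a + h)^-1 - a^-1) by [].
near=> h.
have : (a + h)^-1 - a^-1 != 0 -> A ((a + h)^-1 - a^-1) by near: h; exact: nA.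
apply.
rewrite subr_eq0 (inj_eq invr_inj) -[X in _ != X]addr0 (inj_eq (addrI _)).
near: h; exact: nbhs_dnbhs_neq.
Unshelve. all: by end_near. Qed.

(** The quotient of [t |-> f t^-1] at [a] with increment [h] is the quotient of [f] at [a^-1] with
    increment [(a + h)^-1 - a^-1], times a factor tending to [- a ^- 2]. *)
Lemma cvg_quotient_inv (f : K -> W) (a : K) (l : W) : a != 0 ->
  h^-1 *: (f (h + a^-1) - f a^-1) @[h --> (0 : K)^'] --> l ->
  h^-1 *: (f (h + a)^-1 - f a^-1) @[h --> (0 : K)^'] --> - a ^- 2 *: l.
Proof.
move=> a0 fl.
have := cvg_comp _ _ (cvg_shift_inv a0) fl => fl'.
have c : - ((a + h)^-1 * a^-1) @[h --> (0 : K)^'] --> - a ^- 2.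
  rewrite -exprVn expr2; apply: cvgN; apply: cvgM; last exact: cvg_cst.
  exact: cvg_addl_inv.
have H := cvgZ c fl'; refine (cvg_trans _ (H _)); apply: near_eq_cvg.
near=> h.
have h0 : h != 0 by near: h; exact: nbhs_dnbhs_neq.
have ah0 : a + h != 0 by near: h; exact: near_add_neq0.
rewrite /= subrK [h + a]addrC scalerA; congr (_ *: _).
exact: divr_diff_inv.
Unshelve. all: by end_near. Qed.

(* Substituting 1/t preserves divergence too, so no differentiability is needed:
   both sides are then the junk value of [lim]. *)
Lemma derive1_inv_comp (f : K -> W) (a : K) : a != 0 ->
  - a ^- 2 *: point = point :> W ->
  derive1 (fun t => f t^-1) a = - a ^- 2 *: derive1 f a^-1.
Proof.
move=> a0 ap; rewrite /derive1.
set q := fun h : K => h^-1 *: (f (h + a^-1) - f a^-1).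
have [/cvg_ex[l ql]|nq] := pselect (cvg (q h @[h --> (0 : K)^'])).
  rewrite (cvg_lim _ ql); last exact: norm_hausdorff.
  apply: cvg_lim; first exact: norm_hausdorff.
  exact: cvg_quotient_inv.
(* Inversion is an involution: if the quotient of [t |-> f t^-1] converged, [cvg_quotient_inv] at
   [a^-1] would make that of [f] converge. *)
rewrite (dvgP nq) ap dvgP// => /cvg_ex[l Lql]; apply: nq.
apply/cvg_ex; exists (- a^-1 ^- 2 *: l).
have := @cvg_quotient_inv (fun t => f t^-1) a^-1 l.
rewrite invr_eq0 /= invrK => /(_ a0 Lql).
by under eq_fun do rewrite invrK.
Qed.

Lemma is_derive1_inv_comp (f : K -> W) (a : K) (l : W) : a != 0 ->
  is_derive a^-1 1 f l -> is_derive a 1 (fun t => f t^-1) (- a ^- 2 *: l).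
Proof.
move=> a0 [df dl].
have fl : h^-1 *: (f (h + a^-1) - f a^-1) @[h --> (0 : K)^'] --> l.
  rewrite -dl; refine (cvg_trans _ df); apply: near_eq_cvg; near=> h.
  by rewrite /= scaler1.
have gl := cvg_quotient_inv a0 fl.
have e : (fun h : K => h^-1 *: (((fun t => f t^-1) \o shift a) (h *: 1) - f a^-1))
       = (fun h => h^-1 *: (f (h + a)^-1 - f a^-1)).
  by apply/funext => h /=; rewrite scaler1.
split; first by apply/cvg_ex; exists (- a ^- 2 *: l); rewrite e.
by rewrite /derive e; apply: cvg_lim gl; exact: norm_hausdorff.
Unshelve. all: by end_near. Qed.

End DeriveInv.

(** * The rotation exchanging axes 1 and 3, and its lift to spinors *)

Lemma sqr_sqrtC_half_num (F : numClosedFieldType) :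
  sqrtC 2^-1 * sqrtC 2^-1 + sqrtC 2^-1 * sqrtC 2^-1 = 1 :> F.
Proof. by rewrite -expr2 sqrtCK; field. Qed.

Section Isometry.
Variable R : realType.
Local Notation C := (Cplx R).

(** This is [(pauli1 R + pauli3 R) / sqrt 2]. Its determinant is -1, so it is ['i] times an element
    of SU(2), and conjugation by it is a rotation: the half turn about the bisector of axes 1 and 3.
    Being its own inverse, it stands on both sides of the conjugations. *)
Definition half_turn : 'M[C]_2 :=
  mx2 (sqrtC 2^-1) (sqrtC 2^-1) (sqrtC 2^-1) (- sqrtC 2^-1).

(** The same block on both chiralities, since the rotation fixes the time direction: it commutes
    with [gamma0]. *)
Definition spin_half_turn : 'M[C]_4 :=
  block_mx half_turn (0 : 'M[C]_2) (0 : 'M[C]_2) half_turn.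

Lemma mx2M (a b c d a' b' c' d' : C) :
  mx2 a b c d *m mx2 a' b' c' d' =
  mx2 (a * a' + b * c') (a * b' + b * d') (c * a' + d * c') (c * b' + d * d').
Proof.
by rewrite /mx2 (@mulmx_block _ 1 1 1 1 1 1) -!scalar_mxM -!raddfD.
Qed.

Lemma mx2_eq (a b c d a' b' c' d' : C) :
  a = a' -> b = b' -> c = c' -> d = d' -> mx2 a b c d = mx2 a' b' c' d'.
Proof. by move=> -> -> -> ->. Qed.

Lemma mx2_1 : mx2 1 0 0 1 = 1%:M :> 'M[C]_2.
Proof.
have e0 : (0 : 'M[C]_1) = 0%:M by rewrite raddf0.
by rewrite [RHS](@scalar_mx_block _ 1 1) e0.
Qed.

Lemma mx2N (a b c d : C) : - mx2 a b c d = mx2 (- a) (- b) (- c) (- d).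
Proof. by rewrite /mx2 (@opp_block_mx _ 1 1 1 1) -!raddfN. Qed.

Lemma sqr_sqrtC_half : sqrtC 2^-1 * sqrtC 2^-1 + sqrtC 2^-1 * sqrtC 2^-1 = 1 :> C.
Proof.
exact: sqr_sqrtC_half_num.
Qed.

Lemma half_turn_sqr : half_turn *m half_turn = 1%:M.
Proof.
have := sqr_sqrtC_half; rewrite /half_turn; move: (sqrtC _) => r rr.
rewrite mx2M -mx2_1; apply: mx2_eq; first exact: rr.
- by ring.
- by ring.
- by transitivity (r * r + r * r); [ring | exact: rr].
Qed.

Lemma half_turn_pauli1 : half_turn *m pauli1 R *m half_turn = pauli3 R.
Proof.
have := sqr_sqrtC_half; rewrite /half_turn /pauli1 /pauli3; move: (sqrtC _) => r rr.
rewrite mx2M mx2M; apply: mx2_eq.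
- by transitivity (r * r + r * r); [ring | exact: rr].
- by ring.
- by ring.
- by transitivity (- (r * r + r * r)); [ring | rewrite rr].
Qed.

Lemma half_turn_pauli3 : half_turn *m pauli3 R *m half_turn = pauli1 R.
Proof.
rewrite -half_turn_pauli1 !mulmxA half_turn_sqr mul1mx -mulmxA half_turn_sqr.
by rewrite mulmx1.
Qed.

Lemma half_turn_pauli2 : half_turn *m pauli2 R *m half_turn = - pauli2 R.
Proof.
have := sqr_sqrtC_half; rewrite /half_turn /pauli2; move: (sqrtC _) => r rr.
(* [mx2] and ['i] become variables with only the entrywise rules left, so that each entry is a
   polynomial identity in [r] and [i]. *)
have := mx2M; have := mx2N; have := mx2_eq; move: (@mx2 R) ('i : C) => m i me mN mM.
rewrite mM mM mN; apply: me.
- by ring.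
- by transitivity ((r * r + r * r) * i); [ring | rewrite rr; ring].
- by transitivity (- (r * r + r * r) * i); [ring | rewrite rr; ring].
- by ring.
Qed.

Lemma spin_half_turn_sqr : spin_half_turn *m spin_half_turn = 1%:M.
Proof.
rewrite /spin_half_turn (@mulmx_block _ 2 2 2 2 2 2) !mulmx0 !mul0mx !addr0.
by rewrite half_turn_sqr add0r (@scalar_mx_block _ 2 2).
Qed.

Definition spin_conj (A : 'M[C]_4) : 'M[C]_4 :=
  spin_half_turn *m A *m spin_half_turn.

Lemma spin_conj_gammaj (s : 'M[C]_2) :
  spin_conj (gammaj s) = gammaj (half_turn *m s *m half_turn).
Proof.
rewrite /spin_conj /spin_half_turn /gammaj.
rewrite !(@mulmx_block _ 2 2 2 2 2 2) !(mulmx0, mul0mx, addr0, add0r).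
by rewrite -!scalemxAr -!scalemxAl.
Qed.

Lemma spin_conj_gamma0 : spin_conj (gamma0 R) = gamma0 R.
Proof.
rewrite /spin_conj /spin_half_turn /gamma0.
rewrite !(@mulmx_block _ 2 2 2 2 2 2) !(mulmx0, mul0mx, addr0, add0r).
by rewrite mulmxN mulNmx !mulmx1 half_turn_sqr.
Qed.

Lemma spin_conj_gamma1 : spin_conj (gamma1 R) = gamma3 R.
Proof. by rewrite /gamma1 spin_conj_gammaj half_turn_pauli1. Qed.

Lemma spin_conj_gamma3 : spin_conj (gamma3 R) = gamma1 R.
Proof. by rewrite /gamma3 spin_conj_gammaj half_turn_pauli3. Qed.

Lemma spin_conj_gamma2 : spin_conj (gamma2 R) = - gamma2 R.
Proof.
rewrite /gamma2 spin_conj_gammaj half_turn_pauli2 /gammaj scalerN.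
by rewrite (@opp_block_mx _ 2 2 2 2) !oppr0.
Qed.

Lemma spin_conjM (A B : 'M[C]_4) :
  spin_conj (A *m B) = spin_conj A *m spin_conj B.
Proof.
rewrite /spin_conj !mulmxA -(mulmxA (spin_half_turn *m A) spin_half_turn spin_half_turn) spin_half_turn_sqr.
by rewrite mulmx1.
Qed.

Lemma spin_conj_is_linear : linear spin_conj.
Proof.
by move=> a A B; rewrite /spin_conj mulmxDr mulmxDl -scalemxAr -scalemxAl.
Qed.

HB.instance Definition _ := GRing.isLinear.Build C 'M[C]_4 'M[C]_4 _ spin_conj
  spin_conj_is_linear.

Lemma spin_conjK : involutive spin_conj.
Proof.
move=> A; rewrite /spin_conj !mulmxA spin_half_turn_sqr mul1mx -mulmxA.
by rewrite spin_half_turn_sqr mulmx1.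
Qed.

Lemma spin_conj1 : spin_conj 1%:M = 1%:M.
Proof. by rewrite /spin_conj mulmx1 spin_half_turn_sqr. Qed.

Lemma mxtrace_spin_conj (A : 'M[C]_4) : \tr (spin_conj A) = \tr A.
Proof. by rewrite /spin_conj mxtrace_mulC mulmxA spin_half_turn_sqr mul1mx. Qed.

Lemma gammaj_anticomm (s s' : 'M[C]_2) : s *m s' = - (s' *m s) ->
  gammaj s *m gammaj s' = - (gammaj s' *m gammaj s).
Proof.
move=> ss'; rewrite /gammaj !(@mulmx_block _ 2 2 2 2 2 2).
rewrite (@opp_block_mx _ 2 2 2 2) !(mulmx0, mul0mx, addr0, add0r, oppr0).
by rewrite -!scalemxAr -!scalemxAl ss' !scalerN.
Qed.

Lemma pauli_anticomm :
  [/\ pauli1 R *m pauli2 R = - (pauli2 R *m pauli1 R),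
      pauli2 R *m pauli3 R = - (pauli3 R *m pauli2 R) &
      pauli3 R *m pauli1 R = - (pauli1 R *m pauli3 R)].
Proof.
rewrite /pauli1 /pauli2 /pauli3.
have := mx2M; have := mx2N; have := mx2_eq; move: (@mx2 R) ('i : C) => m i me mN mM.
by split; rewrite !mM mN; apply: me; ring.
Qed.

End Isometry.

(** * Directional derivatives and differentiability under inversion of time *)

(** [differentiable g x] speaks of the chosen differential ['d g x]. The expansion of [f] is one of
    [g] with linear part ['d f x], and [diff_unique] identifies the two. *)
Lemma differentiable_near_eq (K : numFieldType) (V W : normedModType K)
    (f g : V -> W) (x : V) :
  (\near x, f x = g x) -> differentiable f x -> differentiable g x.
Proof.
move=> fg /diff_locallyP[cd fE].
have gx : g x = f x by have := nbhs_singleton fg.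
have fg0 : \forall h \near (0 : V), f (h + x) = g (h + x).
  by have /nbhs0P := fg; apply: filterS => h; rewrite addrC.
have gE : g \o shift x = cst (g x) + 'd f x +o_ (0 : V) id.
  apply/eqaddoP => e e0; move/eqaddoP : fE => /(_ e e0) fe.
  near=> h.
  have <- : (f \o shift x - (cst (f x) + 'd f x)) h =
            (g \o shift x - (cst (g x) + 'd f x)) h.
    have /= E : f (h + x) = g (h + x) by near: h.
    by rewrite !fctE /= E gx.
  by near: h.
have dE := diff_unique cd gE.
by apply/diff_locallyP; rewrite dE.
Unshelve. all: by end_near. Qed.

(** A directional derivative depends only on the restriction to a line, so functions on different
    spaces can be compared. *)
Lemma eq_derive_quotient (K : numFieldType) (V V' W : normedModType K)
    (f : V -> W) (g : V' -> W) (x v : V) (y w : V') :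
  (forall k, f (k *: v + x) = g (k *: w + y)) -> 'D_v f x = 'D_w g y.
Proof.
move=> fg; rewrite /derive.
have -> // : (fun k : K => k^-1 *: ((f \o shift x) (k *: v) - f x)) =
             (fun k : K => k^-1 *: ((g \o shift y) (k *: w) - g y)).
apply/funext => k /=; rewrite fg; congr (_ *: (_ - _)).
by have := fg 0; rewrite !scale0r !add0r.
Qed.

Lemma continuous_sum_fun (K : numFieldType) (V W : normedModType K) (I : Type)
    (r : seq I) (f : I -> V -> W) : (forall i, continuous (f i)) ->
  continuous (fun x => \sum_(i <- r) f i x).
Proof.
move=> cf; elim: r => [|i r IH] x.
  by under eq_fun do rewrite big_nil; exact: cvg_cst.
by under eq_fun do rewrite big_cons; apply: cvgD; [exact: cf | exact: IH].
Qed.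

Lemma mulmx_sandwich_continuous (K : numFieldType) (m n p q : nat)
    (A : 'M[K]_(m.+1, n.+1)) (B : 'M[K]_(p.+1, q.+1)) :
  continuous (fun X => A *m X *m B).
Proof.
(* In the basis of elementary matrices the map is a finite sum of coordinates times fixed
   matrices. *)
have -> : (fun X => A *m X *m B) = (fun X : 'M[K]_(n.+1, p.+1) =>
    \sum_(i <- index_enum 'I_n.+1) \sum_(j <- index_enum 'I_p.+1)
      X i j *: (A *m delta_mx i j *m B)).
  apply/funext => X; rewrite {1}[X]matrix_sum_delta mulmx_sumr mulmx_suml.
  apply: eq_bigr => i _; rewrite mulmx_sumr mulmx_suml.
  by apply: eq_bigr => j _; rewrite -scalemxAr -scalemxAl.
apply: continuous_sum_fun => i; apply: continuous_sum_fun => j X.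
have c := @coord_continuous K n.+1 p.+1 i j X.
exact: (cvgZ c (cvg_cst _)).
Qed.

Section DifferentiableScale.
Variables (K : numFieldType) (V W : normedModType K).

(** Scaling under a name of its own, so that it can be declared bilinear and [differentiable_bilin]
    applies. *)
Definition scale_pair (a : K) (w : W) : W := a *: w.

Lemma scale_pair_is_bilinear :
  bilinear_for
    (GRing.Scale.Law.clone _ _ *:%R _) (GRing.Scale.Law.clone _ _ *:%R _)
    scale_pair.
Proof.
split=> [u'|u] a x y; rewrite /scale_pair /=.
- by rewrite scalerDl scalerA.
- by rewrite scalerDr !scalerA mulrC.
Qed.

HB.instance Definition _ := bilinear_isBilinear.Build K K W W _ _ scale_pair
  scale_pair_is_bilinear.

Lemma differentiable_scale (k : V -> K) (f : V -> W) (z : V) :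
  differentiable k z -> differentiable f z ->
  differentiable (fun x => k x *: f x) z.
Proof.
move=> dk df.
have db : differentiable (fun p : K * W => scale_pair p.1 p.2) (k z, f z).
  apply: differentiable_bilin => p.
  by apply: cvgZ; [exact: cvg_fst | exact: cvg_snd].
exact: (differentiable_comp (differentiable_pair dk df) db).
Qed.

End DifferentiableScale.

Section InvFlip.
Variables (K : numFieldType) (V W : normedModType K) (L : {linear V -> V}).
Hypothesis cL : continuous L.
Implicit Types (z v : K * V) (f : K * V -> W).

(** The pattern of [flip], with an abstract linear map in place of the conjugation of the group
    variable. *)
Definition inv_flip (z : K * V) : K * V := (z.1^-1, L z.2).

Lemma inv_flip_continuous z : z.1 != 0 -> {for z, continuous inv_flip}.
Proof.
move=> z0.
have c1 : x.1^-1 @[x --> z] --> z.1^-1 by apply: cvgV => //; exact: cvg_fst.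
have c2 : L x.2 @[x --> z] --> L z.2.
  apply: (@cvg_comp _ _ _ snd L _ (nbhs z.2)); first exact: cvg_snd.
  exact: cL.
exact: cvg_pair c1 c2.
Qed.

Lemma near_fst_neq0 z : z.1 != 0 -> \forall x \near z, x.1 != 0.
Proof.
move=> z0; have c : x.1 @[x --> z] --> z.1 by exact: cvg_fst.
exact: (cvgr_neq0 _ c z0).
Qed.

Lemma derive_fst f z :
  'D_((1, 0) : K * V) f z = derive1 (fun s => f (s, z.2)) z.1.
Proof.
rewrite derive1E; apply: eq_derive_quotient => k; case: z => t g /=.
by congr f; congr (_, _); rewrite /= scaler0 add0r.
Qed.

Lemma derive_fst_inv_flip f z : point = 0 :> W -> z.1 != 0 ->
  'D_((1, 0) : K * V) (f \o inv_flip) z =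
  - z.1 ^- 2 *: 'D_((1, 0) : K * V) f (inv_flip z).
Proof.
move=> W0 z0; rewrite !derive_fst /=.
have := @derive1_inv_comp _ W (fun s => f (s, L z.2)) z.1 z0.
by rewrite W0 scaler0; apply.
Qed.

Lemma derive_snd_inv_flip f z (B : V) :
  'D_((0, B) : K * V) (f \o inv_flip) z =
  'D_((0, L B) : K * V) f (inv_flip z).
Proof.
apply: eq_derive_quotient => k; congr f; rewrite /inv_flip /=; congr (_, _).
  by rewrite /= !scaler0 !add0r.
by rewrite linearP.
Qed.

Lemma differentiable_fst z : differentiable (fst : K * V -> K) z.
Proof. by apply: linear_differentiable => x; exact: cvg_fst. Qed.

Lemma differentiable_snd z : differentiable (snd : K * V -> V) z.
Proof. by apply: linear_differentiable => x; exact: cvg_snd. Qed.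

Lemma differentiable_inv_flip z : z.1 != 0 -> differentiable inv_flip z.
Proof.
move=> z0; rewrite /inv_flip; apply: differentiable_pair.
  apply: (differentiable_comp (differentiable_fst z)).
  exact: differentiable_Rinv.
apply: (differentiable_comp (differentiable_snd z)).
exact: linear_differentiable.
Qed.

Lemma derive_pair f z v : differentiable f z ->
  'D_v f z = v.1 *: 'D_((1, 0) : K * V) f z + 'D_((0, v.2) : K * V) f z.
Proof.
move=> df; rewrite !deriveE //.
have {1}-> : v = v.1 *: ((1, 0) : K * V) + ((0, v.2) : K * V).
  case: v => t B; congr (_, _); rewrite /= ?scaler0 ?add0r ?addr0 //.
  by rewrite [RHS]mulr1.
by rewrite linearP.
Qed.

Lemma derive_inv_flip f z v : point = 0 :> W -> z.1 != 0 ->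
  differentiable f (inv_flip z) ->
  'D_v (f \o inv_flip) z =
    (v.1 * - z.1 ^- 2) *: 'D_((1, 0) : K * V) f (inv_flip z)
    + 'D_((0, L v.2) : K * V) f (inv_flip z).
Proof.
move=> W0 z0 df; rewrite derive_pair.
  by rewrite derive_fst_inv_flip // derive_snd_inv_flip scalerA.
exact: differentiable_comp (differentiable_inv_flip z0) df.
Qed.

(** [derive_inv_flip] expresses ['D_v (f \o inv_flip)] by derivatives of [f], which are
    differentiable by hypothesis. The formula must hold on a neighbourhood of each nearby [z], not
    only at [z]; this is what [nbhs_interior] provides. *)
Lemma inv_flip_near_differentiable f y : point = 0 :> W -> y.1 != 0 ->
  (\forall z \near inv_flip y, differentiable f z /\
     forall v, differentiable ('D_v f) z) ->
  \forall z \near y, differentiable (f \o inv_flip) z /\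
     forall v, differentiable ('D_v (f \o inv_flip)) z.
Proof.
move=> W0 y0 hf.
have hf' : \forall z \near y, differentiable f (inv_flip z) /\
    forall v, differentiable ('D_v f) (inv_flip z).
  exact: (inv_flip_continuous y0 hf).
have hf2 : nbhs y [set z | (differentiable f (inv_flip z) /\
    forall v, differentiable ('D_v f) (inv_flip z)) /\ z.1 != 0].
  by apply: filterI; [exact: hf' | exact: near_fst_neq0].
apply: filterS (nbhs_interior hf2) => z nz.
have [[df dDf] z0] := nbhs_singleton nz.
split; first exact: differentiable_comp (differentiable_inv_flip z0) df.
move=> v.
apply: (@differentiable_near_eq _ _ _ (fun z =>
    (v.1 * - z.1 ^- 2) *: 'D_((1, 0) : K * V) f (inv_flip z)
    + 'D_((0, L v.2) : K * V) f (inv_flip z))).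
  by apply: filterS nz => x [[dfx _] x0]; rewrite derive_inv_flip.
apply: differentiableD; last first.
  exact: (differentiable_comp (differentiable_inv_flip z0) (dDf _)).
apply: differentiable_scale; last first.
  exact: (differentiable_comp (differentiable_inv_flip z0) (dDf _)).
apply: differentiableM; first exact: differentiable_cst.
apply: differentiableN; apply: differentiableV.
  exact: (differentiableM (differentiable_fst z) (differentiable_fst z)).
by rewrite expf_neq0.
Qed.

End InvFlip.

Section ClosedHolo.
Variables (K : numFieldType) (V : normedModType K).

Lemma holo_mul_near (f g : V -> K) (y : V) :
  (\forall z \near y, differentiable f z /\ forall v, differentiable ('D_v f) z) ->
  (\forall z \near y, differentiable g z /\ forall v, differentiable ('D_v g) z) ->
  \forall z \near y, differentiable (f \* g) z /\
    forall v, differentiable ('D_v (f \* g)) z.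
Proof.
move=> hf hg.
have hfg : nbhs y [set z | (differentiable f z /\ forall v, differentiable ('D_v f) z)
    /\ (differentiable g z /\ forall v, differentiable ('D_v g) z)] by apply: filterI.
apply: filterS (nbhs_interior hfg) => z nz.
have [[df dDf] [dg dDg]] := nbhs_singleton nz.
split; first exact: (differentiableM df dg).
move=> v.
apply: (@differentiable_near_eq _ _ _ (fun z => f z *: 'D_v g z + g z *: 'D_v f z)).
  apply: filterS nz => x [[dfx _] [dgx _]].
  by rewrite -deriveM; [| exact: diff_derivable..].
by apply: differentiableD; apply: differentiable_scale.
Qed.

Lemma is_diff_inv_comp (s : K -> V) (z : K) : z != 0 ->
  differentiable s z^-1 -> differentiable (fun t : K => s t^-1) z.
Proof.
by move=> z0 ds; apply: (differentiable_comp (differentiable_Rinv z0)).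
Qed.

Lemma derive_dir1 (s : K -> V) (z v : K) : differentiable s z ->
  'D_v s z = v *: 'D_1 s z.
Proof.
by move=> ds; rewrite !deriveE // -linearZ /= [v *: 1]mulr1.
Qed.

Lemma holo_inv_near (s : K -> V) (y : K) : point = 0 :> V -> y != 0 ->
  (\forall z \near y^-1, differentiable s z /\ forall v, differentiable ('D_v s) z) ->
  \forall z \near y, differentiable (fun t : K => s t^-1) z /\
    forall v, differentiable ('D_v (fun t : K => s t^-1)) z.
Proof.
move=> V0 y0 hs.
have cv : ((fun t : K => t^-1) @ y --> y^-1) by exact: (differentiable_continuous (differentiable_Rinv y0)).
have id0 : \forall t \near y, (t : K) != 0 
  by apply: (@cvgr_neq0 K K K (nbhs y) _ id y) => //; exact: cvg_id.
have hs2 : nbhs y [set z : K | (differentiable s z^-1 /\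
    forall v, differentiable ('D_v s) z^-1) /\ z != 0].
  by apply: filterI; [exact: (cv _ hs) | exact: id0].
apply: filterS (nbhs_interior hs2) => z nz.
have [[ds dDs] z0] := nbhs_singleton nz.
split; first exact: is_diff_inv_comp.
move=> v.
apply: (@differentiable_near_eq _ _ _ (fun z : K => (v * - z ^- 2) *: 'D_1 s z^-1)).
  apply: filterS nz => x [[dsx _] x0].
  rewrite [RHS](@derive_dir1 _ _ v (is_diff_inv_comp x0 dsx)).
  by rewrite -!derive1E (@derive1_inv_comp K V s x x0) ?scalerA // V0 scaler0.
apply: differentiable_scale; last exact: (is_diff_inv_comp z0 (dDs _)).
apply: differentiableM; first exact: differentiable_cst.
apply: differentiableN; apply: differentiableV; last by rewrite expf_neq0.
by apply: differentiableM.
Qed.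

End ClosedHolo.

Lemma holo_inv2_near (K : numFieldType) (y : K) : point = 0 :> K -> y != 0 ->
  \forall z \near y, differentiable (fun t : K => - t ^- 2) z /\
    forall v, differentiable ('D_v (fun t : K => - t ^- 2)) z.
Proof.
move=> K0 y0.
(* The function is the polynomial [- x * x] at [x = t^-1], so closure under products and under
   inversion suffices. *)
have -> : (fun t : K => - t ^- 2) = (fun t : K => ((-%R : K -> K) \* id) t^-1).
  by apply/funext => t; rewrite /= mulNr -expr2 exprVn.
apply: (@holo_inv_near _ _ ((-%R : K -> K) \* id)) => //.
apply: holo_mul_near; apply: filterE => z; split => //.
- by move=> v; rewrite (_ : 'D_v _ = cst (- v)) //; apply/funext => x; rewrite derive_val.
- by move=> v; rewrite (_ : 'D_v _ = cst v) //; apply/funext => x; rewrite derive_id.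
Qed.

Lemma derive_linear_involution (K : numFieldType) (V W : normedModType K)
    (L : {linear W -> W}) (f : V -> W) (z v : V) :
  continuous L -> involutive L -> point = 0 :> W ->
  'D_v (fun x => L (f x)) z = L ('D_v f z).
Proof.
move=> cL LK W0; rewrite /derive.
set q := fun k : K => k^-1 *: ((f \o shift z) (k *: v) - f z).
have -> : (fun k : K => k^-1 *: (((fun x => L (f x)) \o shift z) (k *: v)
    - L (f z))) = (fun k : K => L (q k)).
  by apply/funext => k; rewrite /q [RHS]linearZ /= [L (_ - _)]linearB.
by apply: lim_homeo => //; rewrite W0 linear0.
Qed.

(** * The Dirac operator under the flip *)

Section DiracFlip.
Variable R : realType.
Local Notation C := (Cplx R).

(** Like [point_mx4], this makes the value of [lim] on divergent quotients compatible with linear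
    maps. *)
Lemma point_Cplx : point = 0 :> C.
Proof. by []. Qed.

Lemma point_mx4 : point = 0 :> 'M[C]_4.
Proof. by apply/matrixP => i j; rewrite [RHS]mxE /point /= mxE. Qed.

Lemma spin_conj_continuous : continuous (@spin_conj R).
Proof. exact: mulmx_sandwich_continuous. Qed.

Definition half_turn_conj (X : 'M[C]_2) : 'M[C]_2 :=
  half_turn R *m X *m half_turn R.

Lemma half_turn_conj_is_linear : linear half_turn_conj.
Proof.
by move=> a A B; rewrite /half_turn_conj mulmxDr mulmxDl -scalemxAr -scalemxAl.
Qed.

HB.instance Definition _ := GRing.isLinear.Build C 'M[C]_2 'M[C]_2 _
  half_turn_conj half_turn_conj_is_linear.

Lemma half_turn_conj_continuous : continuous half_turn_conj.
Proof. exact: mulmx_sandwich_continuous. Qed.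

Lemma half_turn_conjM (A B : 'M[C]_2) :
  half_turn_conj (A *m B) = half_turn_conj A *m half_turn_conj B.
Proof.
rewrite /half_turn_conj !mulmxA.
by rewrite -(mulmxA (half_turn R *m A) (half_turn R) (half_turn R)) half_turn_sqr mulmx1.
Qed.

Lemma half_turn_conj1 : half_turn_conj 1%:M = 1%:M.
Proof. by rewrite /half_turn_conj mulmx1 half_turn_sqr. Qed.

(* The isometry (t, g) |-> (1/t, h g h^-1). *)
Definition flip (z : spacetime R) : spacetime R :=
  (z.1^-1, half_turn_conj z.2).

Lemma flip_base_point (mu : C) : flip (base_point mu) = base_point mu^-1.
Proof. by rewrite /flip /base_point half_turn_conj1. Qed.

Lemma derive_spin_conj (V : normedModType C) (f : V -> 'M[C]_4) (z v : V) :
  'D_v (fun x => spin_conj (f x)) z = spin_conj ('D_v f z).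
Proof.
exact: (@derive_linear_involution C V _ (@spin_conj R) f z v
  spin_conj_continuous (@spin_conjK R) point_mx4).
Qed.

(** Pull-back by the spin lift of [flip]. The right-hand factor of [spin_conj] acts on the dual
    spinor space, so the value [1%:M] at the base point is kept. *)
Definition conj_flip (U : spacetime R -> 'M[C]_4) (z : spacetime R) : 'M[C]_4 :=
  spin_conj (U (flip z)).

Lemma d_time_conj_flip (U : spacetime R -> 'M[C]_4) (z : spacetime R) :
  z.1 != 0 ->
  d_time (conj_flip U) z = spin_conj (- z.1 ^- 2 *: d_time U (flip z)).
Proof.
move=> z0; rewrite /d_time /conj_flip.
transitivity (spin_conj ('D_((1, 0) : spacetime R) (fun x => U (flip x)) z)).
  exact: derive_spin_conj.
apply: (congr1 (@spin_conj R)).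
exact: (@derive_fst_inv_flip C _ _ half_turn_conj U z point_mx4 z0).
Qed.

Lemma half_turn_conj_field (s s' g : 'M[C]_2) : half_turn_conj s = s' ->
  half_turn_conj (g *m (('i / 2) *: s)) = half_turn_conj g *m (('i / 2) *: s').
Proof. by move=> <-; rewrite half_turn_conjM linearZ. Qed.

(** Conjugation is multiplicative, so it carries the left-invariant field of [s] to the
    left-invariant field of [s']. *)
Lemma X_field_conj_flip (s s' : 'M[C]_2) (U : spacetime R -> 'M[C]_4)
    (z : spacetime R) : half_turn_conj s = s' ->
  X_field s (conj_flip U) z = spin_conj (X_field s' U (flip z)).
Proof.
move=> ss'; rewrite /X_field /conj_flip.
set B := z.2 *m _.
transitivity (spin_conj ('D_((0, B) : spacetime R) (fun x => U (flip x)) z)).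
  exact: derive_spin_conj.
apply: (congr1 (@spin_conj R)).
have <- : half_turn_conj B = (flip z).2 *m (('i / 2) *: s').
  exact: half_turn_conj_field.
exact: (@derive_snd_inv_flip C _ _ half_turn_conj U z B).
Qed.

End DiracFlip.

Lemma addr_swap24 (V : zmodType) (a b c d : V) : a + b + c + d = a + d + c + b.
Proof. by rewrite addrAC [a + b + d]addrAC [a + d + b + c]addrAC. Qed.

Lemma cvg_opp_dnbhs (K : numFieldType) : (-%R : K -> K) @ (0 : K)^' --> (0 : K)^'.
Proof.
move=> A; rewrite /dnbhs /within /= => A0.
have cv : (-%R : K -> K) @ (0 : K)^' --> (0 : K).
  by rewrite -[X in _ --> X]oppr0; apply: cvgN; exact: nbhs_dnbhs.
have := cv _ A0; rewrite !near_simpl /= => nA.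
suff : \forall h \near (0 : K)^', A (- h) by [].
near=> h.
have : - h != 0 -> A (- h) by near: h; exact: nA.
by apply; rewrite oppr_eq0; near: h; exact: nbhs_dnbhs_neq.
Unshelve. all: by end_near. Qed.

(** The substitution [k |-> - k] preserves the punctured neighbourhoods of 0, so the identity covers
    divergent quotients as well. *)
Lemma derive_dirN (K : numFieldType) (V W : normedModType K) (f : V -> W)
    (z v : V) : point = 0 :> W -> 'D_(- v) f z = - 'D_v f z.
Proof.
move=> W0; rewrite /derive.
set q := fun k : K => k^-1 *: ((f \o shift z) (k *: v) - f z).
have -> : (fun k : K => k^-1 *: ((f \o shift z) (k *: - v) - f z)) =
          (fun k : K => - (q (- k))).
  by apply/funext => k; rewrite /q invrN scaleNr opprK scalerN scaleNr.
have lN : lim (q (- k) @[k --> (0 : K)^']) = lim (q k @[k --> (0 : K)^']).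
  congr (lim _); apply/seteqP; split.
    have c := cvg_comp _ q (@cvg_opp_dnbhs K) (fun A h => h).
    rewrite /= in c => A HA.
    have := @cvg_opp_dnbhs K _ HA => /=.
    by rewrite /nbhs /=; apply: filterS => k /=; rewrite opprK.
  by move=> A HA; exact: (@cvg_opp_dnbhs K _ HA).
rewrite -lN.
apply: (@lim_homeo K W W -%R -%R _ _ (fun k => q (- k))).
- by move=> x; exact: opp_continuous.
- by move=> x; exact: opp_continuous.
- exact: opprK.
- by rewrite W0 oppr0.
Qed.

Section HeatOperatorFlip.
Variable R : realType.
Local Notation C := (Cplx R).

Lemma X_fieldN (s : 'M[C]_2) (U : spacetime R -> 'M[C]_4) (z : spacetime R) :
  X_field (- s) U z = - X_field s U z.
Proof.
rewrite /X_field scalerN mulmxN.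
have <- := @derive_dirN C _ _ U z ((0, z.2 *m (('i / 2) *: s)) : spacetime R) (point_mx4 R).
congr ('D__ U z).
by congr (_, _); rewrite oppr0.
Qed.

Lemma spin_conjD (A B : 'M[C]_4) : spin_conj (A + B) = spin_conj A + spin_conj B.
Proof. exact: raddfD. Qed.

Lemma spin_conjZ (a : C) (A : 'M[C]_4) : spin_conj (a *: A) = a *: spin_conj A.
Proof. exact: linearZ. Qed.

Lemma spin_conjN (A : 'M[C]_4) : spin_conj (- A) = - spin_conj A.
Proof. exact: raddfN. Qed.

Lemma spin_conj_connection (s0 si sj sk : C -> C)
    (gi gj gk gi' gj' gk' : 'M[C]_4) (t : C) :
  spin_conj gi = gi' -> spin_conj gj = gj' -> spin_conj gk = gk' ->
  spin_conj (spin_connection s0 si sj sk gi gj gk t) =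
  spin_connection s0 si sj sk gi' gj' gk' t.
Proof.
move=> <- <- <-.
rewrite /spin_connection spin_conjZ spin_conjD !spin_conjZ !spin_conjM.
by rewrite spin_conj_gamma0.
Qed.

Lemma scale_ratio (F : fieldType) (c a b : F) : c != 0 -> (c * a) / (c * b) = a / b.
Proof. by move=> c0; rewrite -mulf_div divff // mul1r. Qed.

Lemma invf_scale (F : fieldType) (c a : F) : c != 0 -> (c * a)^-1 * c = a^-1.
Proof. by move=> c0; rewrite invfM mulrAC mulVf // mul1r. Qed.

Definition time_inv (s : C -> C) (t : C) : C := s t^-1.
(** The coefficient of the pull-back of [s dt], because d(1/t) = - t^-2 dt. The sign is kept, to
    match the sign of the derivatives of the other coefficients. *)
Definition lapse_inv (s : C -> C) (t : C) : C := - t ^- 2 * s t^-1.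

Lemma opp_invX2_neq0 (t : C) : t != 0 -> - t ^- 2 != 0.
Proof. by move=> t0; rewrite oppr_eq0 invr_eq0 expf_neq0. Qed.

(** The derivative of [si] and the lapse both acquire the factor [- t ^- 2], which cancels in their
    ratio; the other term contains no derivative. *)
Lemma spin_connection_inv (s0 si sj sk : C -> C) (gi gj gk : 'M[C]_4) (t : C) :
  t != 0 ->
  spin_connection (lapse_inv s0) (time_inv si) (time_inv sj) (time_inv sk)
    gi gj gk t = spin_connection s0 si sj sk gi gj gk t^-1.
Proof.
move=> t0; rewrite /spin_connection.
have -> : derive1 (time_inv si) t = - t ^- 2 * derive1 si t^-1.
  apply: (@derive1_inv_comp C C si t t0).
  by rewrite point_Cplx scaler0.
by rewrite /lapse_inv scale_ratio // opp_invX2_neq0.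
Qed.

(** Exchanging [j] and [k] keeps the scalar coefficient and reverses the sign of [gj *m gk]. The
    three variants place that sign on [gk], on [gj], or on [gi] and the whole, according to the
    position of [gamma2], whose sign is changed by [spin_conj]. *)
Lemma spin_connection_swapl (s0 si sj sk : C -> C) (gi gj gk : 'M[C]_4) (t : C) :
  gj *m gk = - (gk *m gj) ->
  spin_connection s0 si sj sk gi gj gk t =
  spin_connection s0 si sk sj gi (- gk) gj t.
Proof.
move=> g; rewrite /spin_connection mulNmx -g.
by rewrite [sk t ^+ 2 + _]addrC [2 * sk t * _]mulrAC.
Qed.

Lemma spin_connection_swapr (s0 si sj sk : C -> C) (gi gj gk : 'M[C]_4) (t : C) :
  gj *m gk = - (gk *m gj) ->
  spin_connection s0 si sj sk gi gj gk t =
  spin_connection s0 si sk sj gi gk (- gj) t.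
Proof.
move=> g; rewrite /spin_connection mulmxN -g.
by rewrite [sk t ^+ 2 + _]addrC [2 * sk t * _]mulrAC.
Qed.

Lemma spin_connection_swapN (s0 si sj sk : C -> C) (gi gj gk : 'M[C]_4) (t : C) :
  gj *m gk = - (gk *m gj) ->
  spin_connection s0 si sj sk gi gj gk t =
  - spin_connection s0 si sk sj (- gi) gk gj t.
Proof.
move=> g; rewrite /spin_connection g mulNmx -[RHS]scalerN opprD !scalerN opprK.
by rewrite [sk t ^+ 2 + _]addrC [2 * sk t * _]mulrAC.
Qed.

Lemma gamma_anticomm :
  [/\ gamma1 R *m gamma2 R = - (gamma2 R *m gamma1 R),
      gamma2 R *m gamma3 R = - (gamma3 R *m gamma2 R) &
      gamma3 R *m gamma1 R = - (gamma1 R *m gamma3 R)].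
Proof.
have [p12 p23 p31] := pauli_anticomm R.
by split; exact: gammaj_anticomm.
Qed.

Lemma dirac_near_eq (s0 s1 s2 s3 : C -> C) (U V : spacetime R -> 'M[C]_4)
    (z : spacetime R) : (\near z, U z = V z) ->
  Defs.dirac s0 s1 s2 s3 U z = Defs.dirac s0 s1 s2 s3 V z.
Proof.
move=> UV; rewrite /Defs.dirac /d_time /X_field.
have -> : U z = V z by exact: (nbhs_singleton UV).
by rewrite !(near_eq_derive _ UV).
Qed.

Lemma dirac_term (a : C) (g S S' X X' : 'M[C]_4) (V V' : 'M[C]_4) g' :
  X' = spin_conj X -> S' = spin_conj S -> V' = spin_conj V -> g' = spin_conj g ->
  a *: (g' *m (X' + S' *m V')) = spin_conj (a *: (g *m (X + S *m V))).
Proof.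
by move=> -> -> -> ->; rewrite spin_conjZ spin_conjM spin_conjD spin_conjM.
Qed.

(** On axis 2 the field and the connection both change sign; the common sign moves to the Clifford
    matrix, where it agrees with [spin_conj_gamma2]. *)
Lemma dirac_termN (a : C) (g S X V : 'M[C]_4) :
  a *: (g *m (- X + - S *m V)) = a *: (- g *m (X + S *m V)).
Proof. by rewrite !mulNmx -opprD mulmxN. Qed.

(** An isometry lifted to spinors intertwines the Dirac operators. Axes 1 and 3 trade places and
    axis 2 is reversed. *)
Lemma dirac_conj_flip (s0 s1 s2 s3 : C -> C) (U : spacetime R -> 'M[C]_4)
    (z : spacetime R) : z.1 != 0 ->
  Defs.dirac (lapse_inv s0) (time_inv s3) (time_inv s2) (time_inv s1) (conj_flip U) z
  = spin_conj (Defs.dirac s0 s1 s2 s3 U (flip z)).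
Proof.
move=> z0; have [g12 g23 g31] := gamma_anticomm.
have e1 := spin_conj_gamma1 R; have e2 := spin_conj_gamma2 R.
have e3 := spin_conj_gamma3 R; have e0 := spin_conj_gamma0 R.
have X1 := @X_field_conj_flip R _ _ U z (half_turn_pauli1 R).
have X3 := @X_field_conj_flip R _ _ U z (half_turn_pauli3 R).
have X2 : X_field (pauli2 R) (conj_flip U) z
          = - spin_conj (X_field (pauli2 R) U (flip z)).
  by rewrite (@X_field_conj_flip R _ _ U z (half_turn_pauli2 R)) X_fieldN spin_conjN.
rewrite /Defs.dirac !spin_conjD [RHS]addr_swap24.
rewrite !(spin_connection_inv _ _ _ _ _ _ _ z0).
(* Exchanging two axes reverses the cyclic order that [spin_connection] expects; the three swaps
   restore it. *)
rewrite (spin_connection_swapr s0 s3 s2 s1 (gamma1 R) _ g23).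
rewrite (spin_connection_swapl s0 s1 s3 s2 (gamma3 R) _ g12).
rewrite (spin_connection_swapN s0 s2 s1 s3 (gamma2 R) _ g31).
move: e0 e1 e2 e3 X1 X2 X3 {g12 g23 g31}.
move: (gamma0 R) (gamma1 R) (gamma2 R) (gamma3 R) => g0 g1 g2 g3.
move=> e0 e1 e2 e3 X1 X2 X3.
congr (_ + _ + _ + _).
- rewrite d_time_conj_flip // !spin_conjZ -scalemxAr scalerA /lapse_inv.
  by rewrite invf_scale ?opp_invX2_neq0 // spin_conjM e0.
- exact: (dirac_term _ X1 (esym (spin_conj_connection s0 s3 s1 s2 _ e3 e1 e2))
    erefl (esym e3)).
- rewrite X2 dirac_termN.
  exact: (dirac_term _ erefl
    (esym (spin_conj_connection s0 s2 s3 s1 _ e2 e3 e1)) erefl (esym e2)).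
- exact: (dirac_term _ X3 (esym (spin_conj_connection s0 s1 s2 s3 _ e1 e2 e3))
    erefl (esym e1)).
Qed.

End HeatOperatorFlip.

(** * Transport of heat kernel expansions *)

Lemma near_inv (K : numFieldType) (y : K) (P : set K) : y != 0 ->
  (\forall t \near y^-1, P t) -> \forall t \near y, P t^-1.
Proof. by move=> y0; exact: (differentiable_continuous (differentiable_Rinv y0)). Qed.

Section HeatFlip.
Variable R : realType.
Local Notation C := (Cplx R).
Implicit Types (s g : C -> C) (U : spacetime R -> 'M[C]_4).

Lemma near_flip (P : set (spacetime R)) (mu : C) : mu != 0 ->
  (\forall z \near base_point mu^-1, P z) ->
  \forall z \near base_point mu, P (flip z).
Proof.
move=> mu0; rewrite -flip_base_point.
have c := @inv_flip_continuous C _ (@half_turn_conj R)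
  (@half_turn_conj_continuous R) (base_point mu) mu0.
exact: (c P).
Qed.

Lemma near_base_time_neq0 (mu : C) : mu != 0 ->
  \forall z \near base_point mu, z.1 != 0.
Proof. by move=> mu0; exact: (@near_fst_neq0 C _ (base_point mu) mu0). Qed.

Lemma holo_near_flip (W : normedModType C) (f : spacetime R -> W) (mu : C) :
  point = 0 :> W -> mu != 0 ->
  holo_near f (base_point mu^-1) -> holo_near (fun z => f (flip z)) (base_point mu).
Proof.
move=> W0 mu0; rewrite -flip_base_point.
rewrite /holo_near.
have c := @inv_flip_near_differentiable C _ W (@half_turn_conj R)
  (@half_turn_conj_continuous R) f (base_point mu) W0 mu0.
exact: c.
Qed.

Lemma holo_near_conj_flip U (mu : C) : mu != 0 ->
  holo_near U (base_point mu^-1) -> holo_near (conj_flip U) (base_point mu).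
Proof.
move=> mu0 /(holo_near_flip (point_mx4 R) mu0); apply: filterS => z [dU dDU].
have dc (A : 'M[C]_4) : differentiable (@spin_conj R) A.
  exact: (@linear_differentiable C _ _ (@spin_conj R) A (@spin_conj_continuous R)).
split; first exact: (differentiable_comp dU (dc _)).
move=> v; have -> : 'D_v (conj_flip U) = fun x => spin_conj ('D_v (fun z => U (flip z)) x).
  by apply/funext => x; exact: derive_spin_conj.
exact: (differentiable_comp (dDU v) (dc _)).
Qed.

Lemma holo_near_time_inv s (mu : C) : mu != 0 ->
  holo_near s mu^-1 -> holo_near (time_inv s) mu.
Proof. by move=> mu0; exact: (@holo_inv_near C C s mu (point_Cplx R) mu0). Qed.

Lemma holo_near_lapse_inv s (mu : C) : mu != 0 ->
  holo_near s mu^-1 -> holo_near (lapse_inv s) mu.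
Proof.
move=> mu0 hs.
exact: (@holo_mul_near C C (fun t => - t ^- 2) (time_inv s) mu
  (@holo_inv2_near C mu (point_Cplx R) mu0) (holo_near_time_inv mu0 hs)).
Qed.

Lemma dirac_dirac_conj_flip (s0 s1 s2 s3 : C -> C) U (z : spacetime R) :
  z.1 != 0 ->
  Defs.dirac (lapse_inv s0) (time_inv s3) (time_inv s2) (time_inv s1)
    (Defs.dirac (lapse_inv s0) (time_inv s3) (time_inv s2) (time_inv s1)
      (conj_flip U)) z =
  spin_conj (Defs.dirac s0 s1 s2 s3 (Defs.dirac s0 s1 s2 s3 U) (flip z)).
Proof.
move=> z0.
(* The outer operator differentiates, so the inner identity is needed on a neighbourhood of [z]. *)
have e : \near z, Defs.dirac (lapse_inv s0) (time_inv s3) (time_inv s2)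
    (time_inv s1) (conj_flip U) z = conj_flip (Defs.dirac s0 s1 s2 s3 U) z.
  apply: filterS (@near_fst_neq0 C _ z z0) => x x0.
  exact: dirac_conj_flip.
by rewrite [LHS](dirac_near_eq _ _ _ _ e); exact: dirac_conj_flip.
Qed.

Lemma heat_approx_flip (rho : spacetime R -> C) U0 U1 U2 (t : C) :
  heat_approx (fun z => rho (flip z)) (conj_flip U0) (conj_flip U1)
    (conj_flip U2) t = conj_flip (heat_approx rho U0 U1 U2 t).
Proof.
apply/funext => z; rewrite /heat_approx /conj_flip.
by rewrite spin_conjZ !spin_conjD !spin_conjZ.
Qed.

Lemma derive1_spin_conj (f : C -> 'M[C]_4) (t : C) :
  derive1 (fun x => spin_conj (f x)) t = spin_conj (derive1 f t).
Proof. by rewrite !derive1E; exact: derive_spin_conj. Qed.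

Lemma exprN2_sqr (F : fieldType) (t a : F) : (- t ^- 2 * a) ^+ 2 = t ^- 4 * a ^+ 2.
Proof. by rewrite exprMn sqrrN -exprVn -exprM exprVn. Qed.

Lemma heat_expansion_flip (g0 g1 g2 g3 g0' g1' g2' g3' : C -> C) (mu : C)
    U0 U1 U2 : mu != 0 ->
  (\forall t \near mu, [/\ g0' t = t ^- 4 * g0 t^-1, g1' t = g3 t^-1,
     g2' t = g2 t^-1 & g3' t = g1 t^-1]) ->
  heat_expansion g0 g1 g2 g3 mu^-1 U0 U1 U2 ->
  heat_expansion g0' g1' g2' g3' mu (conj_flip U0) (conj_flip U1) (conj_flip U2).
Proof.
move=> mu0 gg [s0 [s1 [s2 [s3 [rho [[h0 h1 h2 h3] sg [hr hU0 hU1 hU2]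
  [rho0 drho U01] heat]]]]]].
exists (lapse_inv s0), (time_inv s3), (time_inv s2), (time_inv s1).
exists (fun z => rho (flip z)); split.
- by split; [exact: holo_near_lapse_inv | exact: holo_near_time_inv..].
- apply: (filterS2 _ _ gg (near_inv mu0 sg)) => t [-> -> -> ->] [e0 e1 e2 e3].
  by split; rewrite -?e0 -?e1 -?e2 -?e3 // /lapse_inv exprN2_sqr.
- split; [exact: (holo_near_flip (point_Cplx R) mu0 hr)|exact: holo_near_conj_flip..].
- split.
  + by rewrite flip_base_point.
  + move=> v; have dr : differentiable rho (flip (base_point mu)).
      by rewrite flip_base_point; case: (nbhs_singleton hr).
    rewrite (@derive_inv_flip C _ C (@half_turn_conj R)
      (@half_turn_conj_continuous R) rho (base_point mu) v (point_Cplx R) mu0 dr).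
    have fb : inv_flip (@half_turn_conj R) (base_point mu) = base_point mu^-1.
      exact: flip_base_point.
    by rewrite fb !drho scaler0 addr0.
  + by rewrite /conj_flip flip_base_point U01 spin_conj1.
- apply: (filterS2 _ _ (near_flip mu0 heat) (near_base_time_neq0 mu0)).
  move=> z hz z0 t t0.
  have E2 := dirac_dirac_conj_flip s0 s1 s2 s3 U2 z0.
  have E1 := dirac_dirac_conj_flip s0 s1 s2 s3 (heat_approx rho U0 U1 U2 t) z0.
  rewrite -(heat_approx_flip rho U0 U1 U2 t) in E1.
  have E3 : derive1 (fun t' => heat_approx (fun z => rho (flip z)) (conj_flip U0)
      (conj_flip U1) (conj_flip U2) t' z) t =
      spin_conj (derive1 (fun t' => heat_approx rho U0 U1 U2 t' (flip z)) t).
    rewrite -derive1_spin_conj; congr (derive1 _ t).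
    by apply/funext => t'; rewrite heat_approx_flip.
  (* All terms are now images under [spin_conj]: the heat equation at [z] is the image of the one at
     [flip z]. *)
  apply: (etrans (congr2 (fun A B => A + B) E3 E1)).
  apply: (etrans _ (congr1 (fun A => gaussian rho t (flip z) *: (t ^+ 2 *: A))
    (esym E2))).
  rewrite -spin_conjD (hz t t0).
  apply: (etrans (spin_conjZ _ _)); apply: (congr1 (GRing.scale _)).
  exact: spin_conjZ.
Qed.

(** The set from which [get] chooses is the same on both sides: [conj_flip] carries expansions over
    in either direction, and [spin_conj] preserves the trace. *)
Lemma local_heat_coef4_flip (g0 g1 g2 g3 g0' g1' g2' g3' : C -> C) (mu : C) :
  mu != 0 ->
  (\forall t \near mu, [/\ g0' t = t ^- 4 * g0 t^-1, g1' t = g3 t^-1,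
     g2' t = g2 t^-1 & g3' t = g1 t^-1]) ->
  local_heat_coef4 g0' g1' g2' g3' mu = local_heat_coef4 g0 g1 g2 g3 mu^-1.
Proof.
move=> mu0 gg.
(* The relation between the two metrics is symmetric, so [heat_expansion_flip] serves both
   inclusions. *)
have gg' : \forall t \near mu^-1, [/\ g0 t = t ^- 4 * g0' t^-1, g1 t = g3' t^-1,
     g2 t = g2' t^-1 & g3 t = g1' t^-1].
  have mV0 : mu^-1 != 0 by rewrite invr_eq0.
  have gV : \forall t \near mu^-1^-1, [/\ g0' t = t ^- 4 * g0 t^-1,
      g1' t = g3 t^-1, g2' t = g2 t^-1 & g3' t = g1 t^-1] by rewrite invrK.
  have id0 : \forall t \near mu^-1, (t : C) != 0.
    by apply: (@cvgr_neq0 C C C (nbhs mu^-1) _ id mu^-1) => //; exact: cvg_id.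
  apply: (filterS2 _ _ (near_inv mV0 gV) id0) => t [e0 e1 e2 e3] t0.
  rewrite e0 e1 e2 e3 invrK; split => //.
  by rewrite -[t^-1 ^- 4]exprVn invrK mulKf // expf_neq0.
have E : is_local_heat_coef4 g0' g1' g2' g3' mu =
         is_local_heat_coef4 g0 g1 g2 g3 mu^-1.
  apply/funext => A; apply/propext; split => -[U0 [U1 [U2 [hU ->]]]];
  exists (conj_flip U0), (conj_flip U1), (conj_flip U2); split.
  - by apply: heat_expansion_flip gg' _; rewrite ?invr_eq0 ?invrK.
  - by rewrite /conj_flip flip_base_point mxtrace_spin_conj invrK.
  - exact: heat_expansion_flip gg hU.
  - by rewrite /conj_flip flip_base_point mxtrace_spin_conj.
by rewrite /local_heat_coef4 E.
Qed.

End HeatFlip.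

(** * Complex numbers and the exponential *)

Section ComplexNorm.
Variable R : realType.
Local Notation C := (Cplx R).
Implicit Types (x y z : C) (a b : R).

(** The modulus with values in [R], not in the complex type of the ambient norm, so that estimates
    are within reach of [lra] and [nra]. *)
Definition nrm (z : C) : R := Normc.normc z.

Lemma Cplx_ext x y : complex.Re x = complex.Re y -> complex.Im x = complex.Im y ->
  x = y.
Proof. by case: x => a b; case: y => c d /= -> ->. Qed.

Lemma Re_add x y : complex.Re (x + y) = complex.Re x + complex.Re y.
Proof. by case: x => a b; case: y. Qed.

Lemma Im_add x y : complex.Im (x + y) = complex.Im x + complex.Im y.
Proof. by case: x => a b; case: y. Qed.

Lemma Re_opp x : complex.Re (- x) = - complex.Re x.
Proof. by case: x. Qed.

Lemma Im_opp x : complex.Im (- x) = - complex.Im x.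
Proof. by case: x. Qed.

Lemma Re_mul x y :
  complex.Re (x * y) = complex.Re x * complex.Re y - complex.Im x * complex.Im y.
Proof. by case: x => a b; case: y. Qed.

Lemma Im_mul x y :
  complex.Im (x * y) = complex.Re x * complex.Im y + complex.Im x * complex.Re y.
Proof. by case: x => a b; case: y. Qed.

Lemma normr_nrm z : `|z| = (nrm z)%:C%C.
Proof. by []. Qed.

Lemma nrm_ge0 z : 0 <= nrm z.
Proof. by case: z => a b; rewrite /nrm /= sqrtr_ge0. Qed.

Lemma nrm0 : nrm 0 = 0.
Proof. exact: Normc.normc0. Qed.

Lemma nrm1 : nrm 1 = 1.
Proof. exact: Normc.normc1. Qed.

Lemma nrmM x y : nrm (x * y) = nrm x * nrm y.
Proof. exact: Normc.normcM. Qed.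

Lemma nrmN x : nrm (- x) = nrm x.
Proof. exact: (@normcN R x). Qed.

Lemma nrmV x : nrm x^-1 = (nrm x)^-1.
Proof. exact: Normc.normcV. Qed.

Lemma nrmD x y : nrm (x + y) <= nrm x + nrm y.
Proof. exact: (@le_normcD R x y). Qed.

Lemma nrmB x y : nrm (x - y) <= nrm x + nrm y.
Proof. by rewrite -[nrm y]nrmN; exact: nrmD. Qed.

Lemma nrm_distC x y : nrm (x - y) = nrm (y - x).
Proof. by rewrite -nrmN opprB. Qed.

Lemma nrm_dist_trans z x y : nrm (x - y) <= nrm (x - z) + nrm (z - y).
Proof.
have -> : x - y = (x - z) + (z - y) by rewrite addrA subrK.
exact: nrmD.
Qed.

Lemma nrmX x n : nrm (x ^+ n) = nrm x ^+ n.
Proof. by elim: n => [|n IH]; rewrite ?expr0 ?nrm1 // !exprS nrmM IH. Qed.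

Lemma nrm_eq0 x : nrm x = 0 -> x = 0.
Proof. exact: Normc.eq0_normc. Qed.

Lemma nrm_gt0 x : x != 0 -> 0 < nrm x.
Proof.
move=> x0; rewrite lt_neqAle nrm_ge0 andbT eq_sym.
by apply: contra x0 => /eqP/nrm_eq0 ->.
Qed.

Lemma nrm_real a : nrm (a%:C)%C = `|a|.
Proof. by rewrite /nrm /= expr0n /= addr0 sqrtr_sqr. Qed.

Lemma natr_complex n : (n%:R : C) = ((n%:R : R)%:C)%C.
Proof. by elim: n => [|n IH] //; rewrite -!natr1 IH; apply: Cplx_ext; rewrite /= ?addr0. Qed.

Lemma intr_complex (m : int) : (m%:~R : C) = ((m%:~R : R)%:C)%C.
Proof.
case: m => n; first exact: natr_complex.
rewrite !NegzE !mulrNz; have := natr_complex n.+1.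
rewrite -!pmulrn => ->; by apply: Cplx_ext; rewrite /= ?oppr0.
Qed.

Lemma nrm_nat n : nrm n%:R = n%:R.
Proof. by rewrite natr_complex nrm_real ger0_norm. Qed.

Lemma nrm_int (m : int) : nrm m%:~R = `|m%:~R|.
Proof. by rewrite intr_complex nrm_real. Qed.

Lemma normr_Re_le z : `|complex.Re z| <= nrm z.
Proof.
case: z => a b; rewrite /nrm /= -sqrtr_sqr; apply: ler_wsqrtr.
by rewrite lerDl sqr_ge0.
Qed.

Lemma normr_Im_le z : `|complex.Im z| <= nrm z.
Proof.
case: z => a b; rewrite /nrm /= -sqrtr_sqr; apply: ler_wsqrtr.
by rewrite lerDr sqr_ge0.
Qed.

Lemma sqr_nrm z : nrm z ^+ 2 = complex.Re z ^+ 2 + complex.Im z ^+ 2.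
Proof. by case: z => a b; rewrite /nrm /= sqr_sqrtr // addr_ge0 ?sqr_ge0. Qed.

Lemma nrm_le_ReIm z : nrm z <= `|complex.Re z| + `|complex.Im z|.
Proof.
rewrite -(@ler_pXn2r _ 2) ?nnegrE ?nrm_ge0 ?addr_ge0 // sqr_nrm.
rewrite -[complex.Re z ^+ 2]real_normK ?num_real //.
rewrite -[complex.Im z ^+ 2]real_normK ?num_real // sqrrD.
by rewrite lerD2r lerDl mulrn_wge0 // mulr_ge0.
Qed.

Lemma nrm_sum (I : Type) (r : seq I) (P : pred I) (F : I -> C) :
  nrm (\sum_(i <- r | P i) F i) <= \sum_(i <- r | P i) nrm (F i).
Proof.
elim/big_rec2: _ => [|i u v _ h]; first by rewrite nrm0.
by apply: le_trans (nrmD _ _) _; rewrite lerD2l.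
Qed.

Lemma imC : ('i : C) = (0 +i* 1)%C.
Proof. by []. Qed.

Lemma nrm_i : nrm 'i = 1.
Proof. by rewrite /nrm imC /= expr0n /= add0r expr1n sqrtr1. Qed.

End ComplexNorm.

Section ComplexExp.
Variable R : realType.
Local Notation C := (Cplx R).
Implicit Types (x y z : C) (a b : R).

Lemma Re_expC z : complex.Re (expC z) = expR (complex.Re z) * cos (complex.Im z).
Proof. by rewrite /expC Re_mul /= mul0r subr0. Qed.

Lemma Im_expC z : complex.Im (expC z) = expR (complex.Re z) * sin (complex.Im z).
Proof. by rewrite /expC Im_mul /= mul0r addr0. Qed.

Lemma expCD x y : expC (x + y) = expC x * expC y.
Proof.
apply: Cplx_ext.
  by rewrite Re_mul !Re_expC !Im_expC Re_add Im_add expRD cosD; ring.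
by rewrite Im_mul !Re_expC !Im_expC Re_add Im_add expRD sinD; ring.
Qed.

Lemma expC0 : expC 0 = 1 :> C.
Proof.
by apply: Cplx_ext; rewrite ?Re_expC ?Im_expC /= expR0 ?cos0 ?sin0 mul1r.
Qed.

Lemma nrm_expC z : nrm (expC z) = expR (complex.Re z).
Proof.
apply/eqP; rewrite -(@eqrXn2 _ 2) ?nrm_ge0 ?expR_ge0 //.
by rewrite sqr_nrm Re_expC Im_expC !exprMn -mulrDr cos2Dsin2 mulr1.
Qed.

Lemma expC_neq0 z : expC z != 0.
Proof.
apply/eqP => e; have := expR_gt0 (complex.Re z).
by rewrite -nrm_expC e nrm0 ltxx.
Qed.

Lemma expCN z : expC (- z) = (expC z)^-1.
Proof.
apply: (mulfI (expC_neq0 z)); rewrite -expCD subrr expC0 divff //.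
exact: expC_neq0.
Qed.

Lemma expC_nat z n : expC (z *+ n) = expC z ^+ n.
Proof.
by elim: n => [|n IH]; rewrite ?mulr0n ?expC0 ?expr0 // mulrS expCD IH exprS.
Qed.

Lemma normr_sin_le a : `|sin a| <= `|a|.
Proof.
wlog a0 : a / 0 <= a => [H|].
  have [/H//|/ltW a0] := leP 0 a.
  by rewrite -normrN -sinN -[X in _ <= X]normrN; apply: H; rewrite oppr_ge0.
have [->|an0] := eqVneq a 0; first by rewrite sin0.
have a_gt0 : 0 < a by rewrite lt_neqAle eq_sym an0.
have [c _] := @MVT R sin cos 0 a a_gt0 (fun (x : R) _ => is_derive_sin x)
  (continuous_subspaceT (@continuous_sin R)).
rewrite sin0 !subr0 => ->; rewrite normrM [`|a|]ger0_norm //.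
by rewrite ler_piMl // cos_max.
Qed.

Lemma normr_cosB1_le a : `|cos a - 1| <= `|a|.
Proof.
have [->|an0] := eqVneq a 0; first by rewrite cos0 subrr.
wlog a0 : a an0 / 0 < a => [H|].
  have [|a0] := ltP 0 a; first exact: H.
  rewrite -cosN -[X in _ <= X]normrN; apply: H; rewrite ?oppr_eq0 // oppr_gt0.
  by rewrite lt_neqAle an0.
have [c _] := @MVT R cos (fun x : R => - sin x) 0 a a0 (fun (x : R) _ => is_derive_cos x)
  (continuous_subspaceT (@continuous_cos R)).
rewrite cos0 !subr0 => ->; rewrite normrM normrN [`|a|]gtr0_norm //.
by rewrite ler_piMl ?sin_max // ltW.
Qed.

Lemma normr_cosB1_le2 a : `|cos a - 1| <= a ^+ 2.
Proof.
have -> : cos a - 1 = - (2 * sin (a / 2) ^+ 2).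
  have -> : cos a = cos (a / 2 + a / 2) by rewrite -splitr.
  by rewrite cosD -!expr2 (cos2sin2 (a / 2)); ring.
rewrite normrN normrM normrX ger0_norm //.
have := normr_sin_le (a / 2); rewrite normrM [`|2^-1|]ger0_norm ?invr_ge0 //.
have := normr_ge0 (sin (a / 2)); rewrite -[a ^+ 2]real_normK ?num_real //.
by nra.
Qed.

Lemma normr_sinB_le2 a : `|sin a - a| <= a ^+ 2.
Proof.
wlog a0 : a / 0 <= a => [H|].
  have [/H//|/ltW a0] := leP 0 a.
  have -> : sin a - a = - (sin (- a) - - a) by rewrite sinN; ring.
  by rewrite normrN -sqrrN; apply: H; rewrite oppr_ge0.
have [->|an0] := eqVneq a 0; first by rewrite sin0 subrr normr0 expr2 mul0r.
have a_gt0 : 0 < a by rewrite lt_neqAle eq_sym an0.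
have [c /andP[c0 ca]] := @MVT R sin cos 0 a a_gt0 (fun (x : R) _ => is_derive_sin x)
  (continuous_subspaceT (@continuous_sin R)).
rewrite sin0 !subr0 => ->; have -> : cos c * a - a = (cos c - 1) * a by ring.
rewrite normrM [`|a|]ger0_norm // expr2 ler_wpM2r //.
apply: le_trans (normr_cosB1_le c) _; move: c0 ca; rewrite !bnd_simp => c0 ca.
by rewrite ger0_norm ltW.
Qed.

(** Both signs follow from [1 + x <= expR x] at [a] and at [- a], combined through
    [expR (- a) * expR a = 1]. *)
Lemma normr_expRB1_le a : `|expR a - 1| <= `|a| * expR `|a|.
Proof.
have h1 := expR_ge1Dx a; have h2 := expR_ge1Dx (- a).
have p := expR_gt0 a; have h3 : expR (- a) * expR a = 1.
  by rewrite -expRD addNr expR0.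
have [a0|a0] := leP 0 a.
  rewrite ger0_norm ?(ger0_norm a0); last by rewrite subr_ge0 -expR0 ler_expR.
  by nra.
rewrite ltr0_norm ?(ltr0_norm a0); last by rewrite subr_lt0 -expR0 ltr_expR.
have : 1 <= expR (- a) by rewrite -expR0 ler_expR oppr_ge0 ltW.
by nra.
Qed.

Lemma normr_expRB1B_le a : `|expR a - 1 - a| <= a ^+ 2 * expR `|a|.
Proof.
have h1 := expR_ge1Dx a; have h2 := expR_ge1Dx (- a).
have p := expR_gt0 a; have h3 : expR (- a) * expR a = 1.
  by rewrite -expRD addNr expR0.
have h4 := normr_expRB1_le a; rewrite ger0_norm; last by lra.
have h5 : expR a - 1 - a <= a * (expR a - 1) by nra.
have h6 : a * (expR a - 1) <= `|a| * `|expR a - 1| by rewrite -normrM ler_norm.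
apply: le_trans h5 (le_trans h6 _).
by rewrite -[a ^+ 2]real_normK ?num_real // expr2 -mulrA ler_wpM2l.
Qed.

(** The second-order Taylor bound from which complex derivatives of exponential series are obtained.
    Of the factor 4, the real part takes at most 1 and the imaginary part at most 2. *)
Lemma nrm_expC_sub_le z : nrm (expC z - 1 - z) <= 4 * nrm z ^+ 2 * expR (nrm z).
Proof.
apply: le_trans (nrm_le_ReIm _) _.
rewrite !Re_add !Im_add !Re_opp !Im_opp Re_expC Im_expC /= subr0.
set a := complex.Re z; set b := complex.Im z.
have a1 : expR `|a| <= expR (nrm z) by rewrite ler_expR normr_Re_le.
have e1 : 1 <= expR (nrm z) by rewrite -expR0 ler_expR nrm_ge0.
have ea : expR a <= expR (nrm z) by rewrite ler_expR (le_trans (ler_norm _)) // normr_Re_le.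
have p := expR_gt0 a.
have sq := sqr_nrm z; rewrite -/a -/b in sq.
have a2 : 0 <= a ^+ 2 by exact: sqr_ge0.
have b2 : 0 <= b ^+ 2 by exact: sqr_ge0.
have R1 : `|expR a * cos b - 1 - a| <= nrm z ^+ 2 * expR (nrm z).
  have -> : expR a * cos b - 1 - a = (expR a - 1 - a) + expR a * (cos b - 1) by ring.
  apply: le_trans (ler_normD _ _) _; rewrite sq mulrDl; apply: lerD.
    apply: le_trans (normr_expRB1B_le a) _; exact: ler_wpM2l.
  rewrite normrM ger0_norm ?expR_ge0 // mulrC; apply: ler_pM; rewrite ?expR_ge0 //.
  exact: normr_cosB1_le2.
have R2 : `|expR a * sin b - b| <= 2 * nrm z ^+ 2 * expR (nrm z).
  have -> : expR a * sin b - b = (expR a - 1) * sin b + (sin b - b) by ring.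
  apply: le_trans (ler_normD _ _) _.
  have -> : 2 * nrm z ^+ 2 * expR (nrm z) =
    nrm z ^+ 2 * expR (nrm z) + nrm z ^+ 2 * expR (nrm z) by ring.
  apply: lerD.
    rewrite normrM; apply: (@le_trans _ _ ((`|a| * expR `|a|) * `|b|)).
      by apply: ler_pM => //; [exact: normr_expRB1_le | exact: normr_sin_le].
    rewrite mulrAC; apply: ler_pM; rewrite ?mulr_ge0 ?expR_ge0 // expr2.
    by apply: ler_pM => //; [exact: normr_Re_le | exact: normr_Im_le].
  apply: le_trans (normr_sinB_le2 b) _; rewrite sq.
  apply: (@le_trans _ _ ((a ^+ 2 + b ^+ 2) * 1)); first by rewrite mulr1 lerDr.
  by apply: ler_wpM2l; rewrite ?addr_ge0.
by move: R1 R2 (mulr_ge0 (sqr_ge0 (nrm z)) (expR_ge0 (nrm z))); lra.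
Qed.

End ComplexExp.

(** * Bilateral series *)

(** The index is written as in [theta], which is thus by conversion the limit of the [psum] of its
    terms. *)
Definition psum (V : zmodType) (f : int -> V) (N : nat) : V :=
  \sum_(k < N.*2.+1) f ((k : nat)%:Z - N%:Z).

Lemma psum0 (V : zmodType) (f : int -> V) : psum f 0 = f 0.
Proof. by rewrite /psum big_ord1. Qed.

Lemma psumS (V : zmodType) (f : int -> V) (N : nat) :
  psum f N.+1 = psum f N + (f (N.+1%:Z) + f (- N.+1%:Z)).
Proof.
rewrite /psum doubleS big_ord_recr big_ord_recl /= addrC [in RHS]addrC -addrA.
congr (f _ + _); first by lia.
rewrite addrC -[in RHS]addrC; congr (_ + _); last by congr f; lia.
by apply: eq_bigr => i _; congr f; rewrite /bump /=; lia.
Qed.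

Section Psum.
Variable R : realType.
Local Notation C := (Cplx R).
Implicit Types (f g : int -> C) (K : R).

Lemma psumD (V : zmodType) (u v : int -> V) N :
  psum (fun m => u m + v m) N = psum u N + psum v N.
Proof. by rewrite /psum big_split. Qed.

Lemma psumN (V : zmodType) (u : int -> V) N :
  psum (fun m => - u m) N = - psum u N.
Proof. by rewrite /psum sumrN. Qed.

Lemma psumZ f (c : C) N : psum (fun m => c * f m) N = c * psum f N.
Proof. by rewrite /psum mulr_sumr. Qed.

Lemma nrm_psum f N : nrm (psum f N) <= psum (fun m => nrm (f m)) N.
Proof. exact: nrm_sum. Qed.

Lemma ler_psum (u v : int -> R) N :
  (forall m, (`|m| <= N)%N -> u m <= v m) -> psum u N <= psum v N.
Proof.
move=> uv; apply: ler_sum => k _; apply: uv.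
by case: k => k /=; lia.
Qed.

(** The summable majorant to which the estimates of bilateral series are reduced. *)
Definition bd (m : int) : R := ((1 + `|m|%:R)^-1) ^+ 2.

Lemma bd_ge0 m : 0 <= bd m.
Proof. by rewrite sqr_ge0. Qed.

Lemma bd0 : bd 0 = 1.
Proof. by rewrite /bd addr0 invr1 expr1n. Qed.

(** Enlarging one factor of the square to [(1 + y)^-1] turns the term into a telescoping
    difference. *)
Lemma sqr_inv_le (y d : R) : 0 <= y -> 0 <= d ->
  d * ((1 + (y + d))^-1) ^+ 2 <= (1 + y)^-1 - (1 + (y + d))^-1.
Proof.
move=> y0 d0; have p : 0 < 1 + y by lra.
have q : 0 < 1 + (y + d) by lra.
have -> : (1 + y)^-1 - (1 + (y + d))^-1 = d * ((1 + y)^-1 * (1 + (y + d))^-1).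
  by field; rewrite !gt_eqF.
rewrite ler_wpM2l // expr2; apply: ler_wpM2r; first by rewrite invr_ge0 ltW.
by rewrite lef_pV2 ?posrE //; lra.
Qed.

(** A Riemann sum of [(1 + |y|)^-2] with mesh [d], bounded uniformly in [d]: the central term is at
    most 1, and each half telescopes to at most 1. *)
Lemma psum_sqr_inv_le (d : R) N : 0 < d <= 1 ->
  psum (fun m => d * ((1 + d * `|m|%:R)^-1) ^+ 2) N <=
    3 - 2 * (1 + d * N%:R)^-1.
Proof.
move=> /andP[d0 d1]; elim: N => [|N IH].
  by rewrite psum0 absz0 mulr0 addr0 invr1 expr1n; lra.
rewrite psumS abszN !absz_nat.
have := @sqr_inv_le (d * N%:R) d (mulr_ge0 (ltW d0) (ler0n _ _)) (ltW d0).
have -> : d * N%:R + d = d * N.+1%:R by rewrite -natr1; ring.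
move: IH; lra.
Qed.

Lemma psum_bd_tail P M : (P <= M)%N ->
  psum bd M - psum bd P <= 2 * ((P.+1%:R)^-1 - (M.+1%:R)^-1).
Proof.
elim: M => [|M IH].
  by rewrite leqn0 => /eqP ->; rewrite !subrr mulr0.
rewrite leq_eqVlt => /orP[/eqP ->|]; first by rewrite !subrr mulr0.
rewrite ltnS => PM; rewrite psumS.
have -> : bd (- M.+1%:Z) = bd M.+1%:Z by rewrite /bd abszN.
have -> : bd M.+1%:Z = (M.+2%:R)^-1 ^+ 2 by rewrite /bd absz_nat nat1r.
have := @sqr_inv_le M%:R 1 (ler0n _ _) ler01.
rewrite nat1r natr1 nat1r mul1r.
move: (IH PM); move: (M.+2%:R^-1) (M.+1%:R^-1) (P.+1%:R^-1) => a b c.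
by move: (psum bd M) (psum bd P) => u v; lra.
Qed.

Lemma nrm_psum_sub f K P M : (P <= M)%N ->
  (forall m, (`|m| <= M)%N -> nrm (f m) <= K * bd m) ->
  nrm (psum f M - psum f P) <= K * (psum bd M - psum bd P).
Proof.
elim: M => [|M IH].
  by rewrite leqn0 => /eqP -> _; rewrite !subrr nrm0 mulr0.
rewrite leq_eqVlt => /orP[/eqP -> _|]; first by rewrite !subrr nrm0 mulr0.
rewrite ltnS => PM fK; rewrite !psumS.
have -> : psum f M + (f M.+1%:Z + f (- M.+1%:Z)) - psum f P
  = (psum f M - psum f P) + (f M.+1%:Z + f (- M.+1%:Z)) by rewrite addrAC.
apply: le_trans (nrmD _ _) _.
have h1 := IH PM (fun m hm => fK m (leqW hm)).
have h2 := nrmD (f M.+1%:Z) (f (- M.+1%:Z)).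
have h3 : nrm (f M.+1%:Z) <= K * bd M.+1%:Z by apply: fK; lia.
have h4 : nrm (f (- M.+1%:Z)) <= K * bd (- M.+1%:Z) by apply: fK; lia.
by lra.
Qed.

Lemma nrm_psum_tail f K P M : (P <= M)%N -> 0 <= K ->
  (forall m, (`|m| <= M)%N -> nrm (f m) <= K * bd m) ->
  nrm (psum f M - psum f P) <= 2 * K / P.+1%:R.
Proof.
move=> PM K0 fK; apply: le_trans (nrm_psum_sub PM fK) _.
rewrite [2 * K]mulrC -mulrA ler_wpM2l //.
apply: le_trans (psum_bd_tail PM) _; rewrite ler_wpM2l //.
by rewrite gerBl invr_ge0.
Qed.

(** Convergence with a real tolerance; in the topology of [Cplx R] the tolerance is itself a complex
    number. *)
Definition tends (u : nat -> C) (l : C) : Prop :=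
  forall e : R, 0 < e -> exists N0, forall N, (N0 <= N)%N -> nrm (u N - l) < e.

Lemma tends_cvg (u : nat -> C) (l : C) : tends u l -> u @ \oo --> l.
Proof.
move=> ul; apply/cvgrPdist_lt => e e0.
(* In the order of the complex numbers a positive element is real. *)
have eE : e = ((complex.Re e)%:C)%C.
  by move: e0; case: (e : C) => a b; rewrite ltcE /= => /andP[/eqP -> _].
move: e0; rewrite eE -[0]/((0 : R)%:C)%C ltcR => e0.
have [N0 N0P] := ul _ e0.
exists N0 => // N /= NN; rewrite distrC normr_nrm ltcR.
exact: N0P.
Qed.

Lemma tends_lim (u : nat -> C) (l : C) : tends u l -> limn u = l.
Proof. by move=> /tends_cvg ul; apply: cvg_lim ul; exact: norm_hausdorff. Qed.

Lemma tends_unique (u : nat -> C) (l l' : C) : tends u l -> tends u l' -> l = l'.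
Proof. by move=> /tends_lim <- /tends_lim. Qed.

Lemma div_natS_lt (c e : R) : 0 < e ->
  exists n, forall N, (n <= N)%N -> c / N.+1%:R < e.
Proof.
move=> e0; exists (Num.bound `|c / e|) => N nN.
rewrite ltr_pdivrMr ?ltr0n // mulrC -ltr_pdivrMr //.
apply: le_lt_trans (ler_norm _) _.
apply: lt_le_trans (archi_boundP (normr_ge0 (c / e))) _.
by rewrite ler_nat leqW.
Qed.

Lemma tends_rate (u : nat -> C) (l : C) (c : R) :
  (forall N, nrm (u N - l) <= c / N.+1%:R) -> tends u l.
Proof.
move=> h e e0; have [n nP] := div_natS_lt c e0.
by exists n => N nN; apply: le_lt_trans (h N) (nP _ nN).
Qed.

Lemma real_cauchy_rate (u : nat -> R) (c : R) : 0 <= c ->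
  (forall N M, (N <= M)%N -> `|u M - u N| <= c / N.+1%:R) ->
  exists l, forall N, `|u N - l| <= c / N.+1%:R.
Proof.
move=> c0 h.
have cu : cvg (u @ \oo).
  apply: cauchy_cvg; apply: cauchy_exP => e e0.
  have [n nP] := div_natS_lt c e0.
  exists (u n); exists n => // N /= nN; rewrite /ball /= distrC.
  exact: le_lt_trans (h _ _ nN) (nP _ (leqnn n)).
exists (limn u) => N.
have c1 : `|u N - u M| @[M --> \oo] --> `|u N - limn u|.
  by apply: cvg_norm; apply: cvgB => //; exact: cvg_cst.
rewrite -(cvg_lim _ c1) //; apply: limr_le; first by apply/cvg_ex; exists (`|u N - limn u|).
by exists N => // M /= NM; rewrite distrC; exact: h.
Qed.

(** Completeness of [R] is applied to real and imaginary parts separately, whence the factor 2. *)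
Lemma complex_cauchy_rate (u : nat -> C) (c : R) : 0 <= c ->
  (forall N M, (N <= M)%N -> nrm (u M - u N) <= c / N.+1%:R) ->
  exists l, forall N, nrm (u N - l) <= 2 * c / N.+1%:R.
Proof.
move=> c0 h.
have [|a aP] := @real_cauchy_rate (fun N => complex.Re (u N)) c c0.
  move=> N M NM; apply: le_trans (h _ _ NM); rewrite -Re_opp -Re_add.
  exact: normr_Re_le.
have [|b bP] := @real_cauchy_rate (fun N => complex.Im (u N)) c c0.
  move=> N M NM; apply: le_trans (h _ _ NM); rewrite -Im_opp -Im_add.
  exact: normr_Im_le.
exists (a +i* b)%C => N; apply: le_trans (nrm_le_ReIm _) _.
rewrite Re_add Im_add Re_opp Im_opp /=.
have -> : 2 * c / N.+1%:R = c / N.+1%:R + c / N.+1%:R by ring.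
exact: lerD.
Qed.

Definition zsum f : C := limn (psum f).

Definition zdom f K : Prop := forall m, nrm (f m) <= K * bd m.

Lemma zdom_ge0 f K : zdom f K -> 0 <= K.
Proof. by move=> /(_ 0); rewrite bd0 mulr1; apply: le_trans; exact: nrm_ge0. Qed.

Lemma zsum_rate f K N : zdom f K -> nrm (psum f N - zsum f) <= 4 * K / N.+1%:R.
Proof.
move=> fK; have K0 := zdom_ge0 fK.
have [|l lP] := @complex_cauchy_rate (psum f) (2 * K) (mulr_ge0 (ler0n _ 2) K0).
  by move=> P M PM; apply: nrm_psum_tail.
have -> : zsum f = l by apply: tends_lim; exact: tends_rate lP.
by have := lP N; rewrite mulrA -natrM.
Qed.

Lemma zsum_tends f K : zdom f K -> tends (psum f) (zsum f).
Proof. by move=> fK; apply: tends_rate => N; exact: zsum_rate fK. Qed.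

Lemma tends_nrm_le (u : nat -> C) l (B : R) :
  tends u l -> (forall N, nrm (u N) <= B) -> nrm l <= B.
Proof.
move=> ul uB; rewrite leNgt; apply/negP => lB.
have [|N0 /(_ N0 (leqnn _))] := ul (nrm l - B); first by rewrite subr_gt0.
have := nrmD (u N0) (- (u N0 - l)); rewrite nrmN opprB addrC subrK.
by have := uB N0; lra.
Qed.

Lemma tendsD (u v : nat -> C) l l' : tends u l -> tends v l' ->
  tends (fun N => u N + v N) (l + l').
Proof.
move=> ul vl e e0; have e2 : 0 < e / 2 by lra.
have [N0 h0] := ul _ e2; have [N1 h1] := vl _ e2.
exists (maxn N0 N1) => N; rewrite geq_max => /andP[n0 n1].
have -> : u N + v N - (l + l') = (u N - l) + (v N - l') by ring.
apply: le_lt_trans (nrmD _ _) _; rewrite [e]splitr.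
by apply: ltrD; [exact: h0 | exact: h1].
Qed.

Lemma tendsZ (u : nat -> C) l (c : C) : tends u l -> tends (fun N => c * u N) (c * l).
Proof.
move=> ul e e0; have c1 : 0 < nrm c + 1 by have := nrm_ge0 c; lra.
have [N0 h0] := ul _ (divr_gt0 e0 c1); exists N0 => N /h0.
rewrite -mulrBr nrmM ltr_pdivlMr // => h; apply: le_lt_trans h.
by rewrite mulrC ler_wpM2l ?nrm_ge0 //; lra.
Qed.

Lemma tends_cst (c : C) : tends (fun=> c) c.
Proof. by move=> e e0; exists 0 => N _; rewrite subrr nrm0. Qed.

Lemma eq_tends (u v : nat -> C) l : u =1 v -> tends u l -> tends v l.
Proof. by move=> /funext ->. Qed.

Lemma tends_subseq (u : nat -> C) l (s : nat -> nat) :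
  (forall N, (N <= s N)%N) -> tends u l -> tends (fun N => u (s N)) l.
Proof.
move=> sN ul e /ul[N0 h0]; exists N0 => N NN; apply: h0.
exact: leq_trans NN (sN N).
Qed.

Lemma eq_zsum f g : f =1 g -> zsum f = zsum g.
Proof. by move=> /funext ->. Qed.

Lemma zdomD f g K K' : zdom f K -> zdom g K' -> zdom (fun m => f m + g m) (K + K').
Proof.
by move=> fK gK m; apply: le_trans (nrmD _ _) _; rewrite mulrDl lerD.
Qed.

Lemma zdomZ f (c : C) K : zdom f K -> zdom (fun m => c * f m) (nrm c * K).
Proof. by move=> fK m; rewrite nrmM -mulrA ler_wpM2l ?nrm_ge0. Qed.

Lemma zsumD f g K K' : zdom f K -> zdom g K' ->
  zsum (fun m => f m + g m) = zsum f + zsum g.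
Proof.
move=> fK gK; apply: (tends_unique (zsum_tends (zdomD fK gK))).
apply: eq_tends (tendsD (zsum_tends fK) (zsum_tends gK)) => N.
by rewrite psumD.
Qed.

Lemma zsumZ f (c : C) K : zdom f K -> zsum (fun m => c * f m) = c * zsum f.
Proof.
move=> fK; apply: (tends_unique (zsum_tends (zdomZ c fK))).
apply: eq_tends (tendsZ c (zsum_tends fK)) => N.
by rewrite psumZ.
Qed.

Lemma zsumB f g K K' : zdom f K -> zdom g K' ->
  zsum (fun m => f m - g m) = zsum f - zsum g.
Proof.
move=> fK gK; have hN : (fun m => f m - g m) =1 (fun m => f m + (-1) * g m).
  by move=> m; rewrite mulN1r.
by rewrite (eq_zsum hN) (zsumD fK (zdomZ (-1) gK)) (zsumZ _ gK) mulN1r.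
Qed.

Lemma nrm_zsum_le f K : zdom f K -> nrm (zsum f) <= 3 * K.
Proof.
move=> fK; have K0 := zdom_ge0 fK.
apply: (tends_nrm_le (zsum_tends fK)) => N.
apply: le_trans (nrm_psum _ _) _.
apply: (@le_trans _ _ (psum (fun m => K * bd m) N)); first exact: ler_psum.
have -> : psum (fun m => K * bd m) N = K * psum bd N by rewrite /psum mulr_sumr.
rewrite mulrC ler_wpM2r //.
have := @psum_sqr_inv_le 1 N; rewrite ltr01 lexx => /(_ isT).
have -> : psum (fun m : int => 1 * ((1 + 1 * `|m|%:R)^-1) ^+ 2) N = psum bd N.
  by apply: eq_bigr => i _; rewrite !mul1r.
have : 0 <= (1 + 1 * N%:R : R)^-1 by rewrite invr_ge0 mul1r addr_ge0.
by lra.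
Qed.

Lemma tends_psum (F : nat -> int -> C) (P : nat) :
  (forall m, tends (fun M => F M m) 0) -> tends (fun M => psum (F M) P) 0.
Proof.
move=> h; elim: P => [|P IH].
  by apply: eq_tends (h 0) => M; rewrite psum0.
have := tendsD IH (tendsD (h P.+1%:Z) (h (- P.+1%:Z))); rewrite !addr0.
by apply: eq_tends => M; rewrite psumS.
Qed.

(** Dominated convergence for sums whose range grows with [M]: beyond a fixed [P] the majorant is
    uniformly small, and the finitely many terms before it tend to 0. The bound is asked only for
    [|m| <= M], the window in which the Fourier amplitudes decay. *)
Lemma tannery (F : nat -> int -> C) K N1 : 0 <= K ->
  (forall M m, (N1 <= M)%N -> (`|m| <= M)%N -> nrm (F M m) <= K * bd m) ->
  (forall m, tends (fun M => F M m) 0) -> tends (fun M => psum (F M) M) 0.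
Proof.
move=> K0 FK F0 e e0; have e2 : 0 < e / 2 by lra.
have [P PP] := div_natS_lt (2 * K) e2; have KP := PP P (leqnn P).
have [N0 h0] := tends_psum P F0 e2.
exists (maxn N1 (maxn N0 P)) => N; rewrite !geq_max => /and3P[nN1 n0 n1].
rewrite subr0; have := h0 N n0; rewrite subr0 => h.
have h2 := nrm_psum_tail n1 K0 (fun m => FK N m nN1).
have := nrmD (psum (F N) N - psum (F N) P) (psum (F N) P); rewrite subrK.
by move: h2 KP; move: (2 * K / _) => a; lra.
Qed.

Lemma zdom_sum (F : int -> int -> C) (K : R) M : (forall k, zdom (F k) K) ->
  exists2 K', zdom (fun n => psum (fun k => F k n) M) K' &
  psum (fun k => zsum (F k)) M = zsum (fun n => psum (fun k => F k n) M).
Proof.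
move=> FK; elim: M => [|M [K' zM eM]].
  exists K; first by move=> n; rewrite psum0; exact: FK.
  by rewrite psum0; apply: eq_zsum => n; rewrite psum0.
have z1 := zdomD (FK M.+1%:Z) (FK (- M.+1%:Z)).
have eS : (fun n => psum (fun k => F k n) M.+1) =
    (fun n => psum (fun k => F k n) M + (F M.+1%:Z n + F (- M.+1%:Z) n)).
  by apply/funext => n; rewrite psumS.
exists (K' + (K + K)); first by rewrite eS; exact: zdomD zM z1.
by rewrite psumS eM eS (zsumD zM z1) (zsumD (FK _) (FK _)).
Qed.

(** The constant is the square of 2 in [1 + |m| <= 2 (1 + |m + 1|)]. *)
Lemma bd_shift m : bd (m + 1) <= 4 * bd m.
Proof.
rewrite /bd; have -> : 4 * ((1 + `|m|%:R)^-1) ^+ 2 =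
    ((2^-1 * (1 + `|m|%:R))^-1) ^+ 2 :> R by rewrite invfM invrK; ring.
have p : 0 < 2^-1 * (1 + `|m|%:R) :> R.
  by rewrite mulr_gt0 ?invr_gt0 // ltr_pwDl.
have q : 2^-1 * (1 + `|m|%:R) <= 1 + (absz (m + 1))%:R :> R.
  have : (1 + absz m <= 2 * (1 + absz (m + 1)%R))%N by lia.
  by rewrite -(ler_nat R) natrM !natrD; lra.
have i : (1 + (absz (m + 1))%:R)^-1 <= (2^-1 * (1 + `|m|%:R))^-1 :> R.
  by rewrite lef_pV2 ?posrE // (lt_le_trans p).
by apply: lerXn2r => //; rewrite nnegrE invr_ge0 ?addr_ge0 // ltW.
Qed.

Lemma zdom_shift f K : zdom f K -> zdom (fun m => f (m + 1)) (4 * K).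
Proof.
move=> fK m; apply: le_trans (fK _) _; rewrite [4 * K]mulrC -mulrA.
by apply: ler_wpM2l (bd_shift m); exact: zdom_ge0 fK.
Qed.

(** The symmetric partial sums of the two series differ by two boundary terms, each at most
    [K / N.+1%:R]. *)
Lemma zsum_shift f K : zdom f K -> zsum (fun m => f (m + 1)) = zsum f.
Proof.
move=> fK; have K0 := zdom_ge0 fK; have gK := zdom_shift fK.
apply: (tends_unique (zsum_tends gK)).
have E N : psum (fun m => f (m + 1)) N = psum f N + (f N.+1%:Z - f (- N%:Z)).
  elim: N => [|N IH]; first by rewrite !psum0 oppr0 add0r [RHS]addrC subrK.
  have e1 : N.+1%:Z + 1 = N.+2%:Z by lia.
  have e2 : - N.+1%:Z + 1 = - N%:Z by lia.
  rewrite !psumS IH e1 e2; move: (f _) (f _) (f _) (f _) (psum _ _).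
  by move=> a b c d u; ring.
apply: (@eq_tends (fun N => psum f N + (f N.+1%:Z - f (- N%:Z)))) => //.
rewrite -[zsum f]addr0; apply: tendsD; first exact: zsum_tends fK.
apply: (@tends_rate _ _ (2 * K)) => N; rewrite subr0.
have bN (m : int) : (N <= `|m|)%N -> nrm (f m) <= K / N.+1%:R.
  move=> Nm; apply: le_trans (fK m) _; rewrite ler_wpM2l // /bd expr2.
  have p : 1 <= 1 + `|m|%:R :> R by rewrite lerDl.
  have i1 : (1 + `|m|%:R)^-1 <= (1 : R) by rewrite invf_le1 // (lt_le_trans ltr01).
  have i2 : (1 + `|m|%:R)^-1 <= (N.+1%:R)^-1 :> R.
    rewrite lef_pV2 ?posrE ?ltr0n // ?(lt_le_trans ltr01) //.
    by rewrite nat1r ler_nat.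
  apply: le_trans i2; rewrite -[X in _ <= X]mulr1 ler_wpM2l // invr_ge0.
apply: le_trans (nrmB _ _) _.
have -> : 2 * K / N.+1%:R = K / N.+1%:R + K / N.+1%:R by ring.
by apply: lerD; apply: bN; lia.
Qed.

Lemma zsum_multiples f K (n : nat) : (0 < n)%N -> zdom f K ->
  (forall m, ~~ (n %| `|m|)%N -> f m = 0) ->
  tends (psum (fun m => f (n%:Z * m))) (zsum f).
Proof.
move=> n0 fK f0.
have E N : psum (fun m => f (n%:Z * m)) N = psum f (n * N).
  elim: N => [|N IH]; first by rewrite muln0 !psum0 mulr0.
  rewrite psumS IH.
  (* Between consecutive multiples of [n] only zeros are added. *)
  have H j : (j < n)%N -> psum f (n * N + j) = psum f (n * N).
    elim: j => [|j IHj] jn; first by rewrite addn0.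
    rewrite addnS psumS IHj; last exact: ltnW.
    rewrite !f0 ?addr0 // ?abszN absz_nat -addnS dvdn_addr ?dvdn_mulr //;
    by apply/negP => /dvdn_leq; lia.
  have -> : (n * N.+1)%N = (n * N + n.-1).+1 by lia.
  rewrite psumS H; last by lia.
  by congr (_ + (f _ + f _)); lia.
apply: (@eq_tends (fun N => psum f (n * N))) => [N|]; first by rewrite E.
by apply: (tends_subseq _ (zsum_tends fK)) => N; rewrite leq_pmull.
Qed.

End Psum.

(** * Riemann sums of Gaussians *)

Section GaussianStep.
Variable R : realType.
Local Notation C := (Cplx R).
Implicit Types (A c d y : R) (a b u v : C).
Local Notation cst_ x := ((x : R)%:C)%C.

Definition gaussE (u : C) : C := expC (- piC R * u ^+ 2).

Lemma gaussE_add u v :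
  gaussE (u + v) = gaussE u * expC (- (2 * piC R * u * v + piC R * v ^+ 2)).
Proof. by rewrite /gaussE -expCD; congr expC; ring. Qed.

Lemma Re_realM (x : R) (z : C) : complex.Re (cst_ x * z) = x * complex.Re z.
Proof. by rewrite Re_mul /= mul0r subr0. Qed.

Lemma nrm_gaussE u : nrm (gaussE u) = expR (- (pi * complex.Re (u ^+ 2))).
Proof. by rewrite /gaussE nrm_expC mulNr Re_opp Re_realM. Qed.

Lemma nrm_pi : nrm (piC R) = pi.
Proof. by rewrite nrm_real ger0_norm // pi_ge0. Qed.

Lemma affine_nrm_le A a b y : nrm a <= A -> nrm b <= A ->
  nrm (a * cst_ y + b) <= A * (1 + `|y|).
Proof.
move=> aA bA; apply: le_trans (nrmD _ _) _.
rewrite nrmM nrm_real mulrDr mulr1 addrC lerD // ler_wpM2r //.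
Qed.

(** The quadratic term grows at least like [c |y| ^ 2]; completing the square spends half of this on
    the linear term, whence [c / 2]. *)
Lemma Re_sqr_affine_ge A c a b y : 0 < c -> nrm a <= A -> nrm b <= A ->
  c <= complex.Re (a ^+ 2) ->
  c / 2 * (1 + `|y|) ^+ 2 - ((2 * A ^+ 2 + c) ^+ 2 / (2 * c) + A ^+ 2 + c / 2)
    <= complex.Re ((a * cst_ y + b) ^+ 2).
Proof.
move=> c0 aA bA ac; have A0 : 0 <= A := le_trans (nrm_ge0 a) aA.
have -> : (a * cst_ y + b) ^+ 2
    = cst_ (y ^+ 2) * a ^+ 2 + cst_ (2 * y) * (a * b) + b ^+ 2.
  rewrite (_ : cst_ (y ^+ 2) = cst_ y ^+ 2); last by apply: Cplx_ext; rewrite expr2 ?Re_mul ?Im_mul /=; ring.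
  rewrite (_ : cst_ (2 * y) = 2 * cst_ y); last by rewrite natr_complex; apply: Cplx_ext; rewrite ?Re_mul ?Im_mul /=; ring.
  by ring.
rewrite !Re_add !Re_realM.
have h1 : `|complex.Re (a * b)| <= A ^+ 2.
  apply: le_trans (normr_Re_le _) _; rewrite nrmM expr2; apply: ler_pM; rewrite ?nrm_ge0 //.
have h2 : `|complex.Re (b ^+ 2)| <= A ^+ 2.
  apply: le_trans (normr_Re_le _) _; rewrite nrmX.
  by rewrite ler_pXn2r ?nnegrE ?nrm_ge0.
have h3 : - (2 * `|y| * A ^+ 2) <= 2 * y * complex.Re (a * b).
  rewrite lerNl; apply: le_trans (ler_norm _) _.
  rewrite normrN !normrM ger0_norm // ler_wpM2l // mulr_ge0 //.
have h4 : c * `|y| ^+ 2 <= y ^+ 2 * complex.Re (a ^+ 2).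
  by rewrite real_normK ?num_real // mulrC ler_wpM2l ?sqr_ge0.
have h5 : - A ^+ 2 <= complex.Re (b ^+ 2) by move: h2; rewrite ler_norml => /andP[].
set B := A ^+ 2 in h3 h5 *; set Y := `|y| in h3 h4 *.
have h6 : 0 <= (c * Y - (2 * B + c)) ^+ 2 / (2 * c).
  by rewrite divr_ge0 ?sqr_ge0 // mulr_ge0 // ltW.
have h7 : (c * Y - (2 * B + c)) ^+ 2 / (2 * c) =
    c / 2 * Y ^+ 2 - Y * (2 * B + c) + (2 * B + c) ^+ 2 / (2 * c).
  by field; rewrite gt_eqF.
move: h6; rewrite h7; move: (_ / (2 * c)) => Z h6.
have h8 : c / 2 * (1 + Y) ^+ 2 = c / 2 + c * Y + c / 2 * Y ^+ 2 by field.
by rewrite h8; lra.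
Qed.

Lemma nrm_gaussE_affine A c : 0 < c -> exists2 K, 0 < K &
  forall a b y, nrm a <= A -> nrm b <= A -> c <= complex.Re (a ^+ 2) ->
  nrm (gaussE (a * cst_ y + b)) <= K * expR (- (pi * c / 2 * (1 + `|y|) ^+ 2)).
Proof.
move=> c0; set K := (2 * A ^+ 2 + c) ^+ 2 / (2 * c) + A ^+ 2 + c / 2.
exists (expR (pi * K)); first exact: expR_gt0.
move=> a b y aA bA ac; rewrite nrm_gaussE -expRD ler_expR.
have := Re_sqr_affine_ge y c0 aA bA ac; rewrite -/K => h.
have := ler_wpM2l (pi_ge0 R) h; lra.
Qed.

(** From [x ^ 4 / 4! <= expR x] at [x = k * Y ^+ 2]. The power 6 is the one that arises in
    [gauss_step_le]; the remaining two powers of [Y] give the majorant. *)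
Lemma expRN_sqr_le (k Y : R) : 0 < k -> 0 < Y ->
  Y ^+ 6 * expR (- (k * Y ^+ 2)) <= 24 / k ^+ 4 * (Y^-1) ^+ 2.
Proof.
move=> k0 Y0; have x0 : 0 < k * Y ^+ 2 by rewrite mulr_gt0 // exprn_gt0.
have h := @expR_ge1Dxn R (k * Y ^+ 2) 3 (ltW x0).
have h1 : (k * Y ^+ 2) ^+ 4 <= 24 * expR (k * Y ^+ 2).
  have : (k * Y ^+ 2) ^+ 4 / 24 <= expR (k * Y ^+ 2).
    by apply: le_trans h; rewrite lerDr.
  by rewrite ler_pdivrMr // [24 * _]mulrC.
have e : expR (k * Y ^+ 2) * expR (- (k * Y ^+ 2)) = 1 by rewrite -expRD subrr expR0.
have p := expR_gt0 (- (k * Y ^+ 2)).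
have h2 : (k * Y ^+ 2) ^+ 4 * expR (- (k * Y ^+ 2)) <= 24.
  have := ler_wpM2r (ltW p) h1.
  by rewrite -[24 * _ * _]mulrA e mulr1.
have k4 : 0 < k ^+ 4 by rewrite exprn_gt0.
have Y2 : 0 < Y ^+ 2 by rewrite exprn_gt0.
have -> : 24 / k ^+ 4 * Y^-1 ^+ 2 = 24 / (k ^+ 4 * Y ^+ 2).
  by rewrite exprVn -mulrA -invfM.
rewrite ler_pdivlMr ?mulr_gt0 //; apply: le_trans h2.
by rewrite le_eqVlt; apply/orP; left; apply/eqP; ring.
Qed.

(** The exponential is the ratio of Gaussians in [gaussE_add]. Once 1 and the linear part
    [- 2 pi u v] are removed, what is left is of order [d ^ 2]. *)
Lemma gauss_remainder_le (Q d Y : R) u v : 1 <= Q -> 0 <= d -> 1 <= Y ->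
  nrm (2 * piC R * u * v + piC R * v ^+ 2) <= Q * d * Y ^+ 2 ->
  nrm (piC R * v ^+ 2) <= Q ^+ 2 * d ^+ 2 * Y ^+ 4 ->
  nrm (expC (- (2 * piC R * u * v + piC R * v ^+ 2)) - 1 + 2 * piC R * u * v)
    <= 5 * Q ^+ 2 * d ^+ 2 * Y ^+ 4 * expR (Q * d * Y ^+ 2).
Proof.
move=> Q1 d0 Y1; set x := 2 * _ * _ * _ + _ => hx hv.
have -> : expC (- x) - 1 + 2 * piC R * u * v
   = (expC (- x) - 1 - (- x)) + - (piC R * v ^+ 2) by rewrite /x; ring.
apply: le_trans (nrmD _ _) _; rewrite nrmN.
have h1 := nrm_expC_sub_le (- x); rewrite nrmN in h1.
have h2 : expR (nrm x) <= expR (Q * d * Y ^+ 2) by rewrite ler_expR.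
have h3 : nrm x ^+ 2 <= (Q * d * Y ^+ 2) ^+ 2.
  by rewrite ler_pXn2r ?nnegrE ?nrm_ge0 // (le_trans _ hx) // nrm_ge0.
have h4 : nrm x ^+ 2 * expR (nrm x) <= (Q * d * Y ^+ 2) ^+ 2 * expR (Q * d * Y ^+ 2).
  by apply: ler_pM; rewrite ?sqr_ge0 ?expR_ge0.
have h5 : 1 <= expR (Q * d * Y ^+ 2) by rewrite -expR0 ler_expR (le_trans _ hx) // nrm_ge0.
have h6 : Q ^+ 2 * d ^+ 2 * Y ^+ 4 <= Q ^+ 2 * d ^+ 2 * Y ^+ 4 * expR (Q * d * Y ^+ 2).
  rewrite -[X in X <= _]mulr1; apply: ler_wpM2l h5.
  have Q0 : 0 <= Q by lra.
  have Y0 : 0 <= Y by lra.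
  by rewrite !mulr_ge0 ?exprn_ge0.
have e : (Q * d * Y ^+ 2) ^+ 2 = Q ^+ 2 * d ^+ 2 * Y ^+ 4 by ring.
rewrite e in h4.
have -> : 5 * Q ^+ 2 * d ^+ 2 * Y ^+ 4 * expR (Q * d * Y ^+ 2) =
  5 * (Q ^+ 2 * d ^+ 2 * Y ^+ 4 * expR (Q * d * Y ^+ 2)) by ring.
move: h1 h4 h6 hv; move: (expR (nrm x)) (expR _) (nrm x ^+ 2) => E1 E2 X.
by move: (Q ^+ 2 * d ^+ 2 * Y ^+ 4) => W; lra.
Qed.

(** The Gaussian form pulled back along [y |-> a y + b], Jacobian included, so that its integral
    ought not to depend on [a] and [b]. Its variation in the direction [(al, be)] is the
    [y]-derivative of [gaussH a b al be]. *)
Definition gaussG a b y : C := a * gaussE (a * cst_ y + b).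
Definition gaussH a b (al be : C) y : C :=
  (al * cst_ y + be) * gaussE (a * cst_ y + b).

(** Parameters and [y] are moved by the same step [d]. The derivative of [gaussG] along [(al, be)]
    equals that of [gaussH] in [y], so the first-order terms cancel; [P] collects the second-order
    remainders of the exponentials. *)
Lemma gauss_step_identity a b al be y d :
  let u := a * cst_ y + b in let us := al * cst_ y + be in
  let P v := expC (- (2 * piC R * u * v + piC R * v ^+ 2)) - 1 + 2 * piC R * u * v in
  gaussG (a + cst_ d * al) (b + cst_ d * be) y - gaussG a b y
  - (gaussH a b al be (y + d) - gaussH a b al be y) =
  gaussE u * (cst_ d ^+ 2 * (2 * piC R * u * al * (a - us))
    + (a + cst_ d * al) * P (cst_ d * us) - (us + cst_ d * al) * P (cst_ d * a)).
Proof.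
move=> u us P; rewrite /gaussG /gaussH -/u -/us.
have eD : cst_ (y + d) = cst_ y + cst_ d by apply: Cplx_ext; rewrite /= ?addr0.
have -> : (a + cst_ d * al) * cst_ y + (b + cst_ d * be) = u + cst_ d * us.
  by rewrite /u /us; ring.
have -> : a * cst_ (y + d) + b = u + cst_ d * a by rewrite eD /u; ring.
have -> : al * cst_ (y + d) + be = us + cst_ d * al by rewrite eD /us; ring.
rewrite (gaussE_add u (cst_ d * us)) (gaussE_add u (cst_ d * a)) /P.
set e1 := expC (- (_ + piC R * (cst_ d * us) ^+ 2)).
set e2 := expC (- (_ + piC R * (cst_ d * a) ^+ 2)).
by move: e1 e2 (gaussE u) (cst_ d) (piC R) => e1 e2 g D p; ring.
Qed.

End GaussianStep.
Section GaussianStepBound.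
Variable R : realType.
Local Notation C := (Cplx R).
Local Notation cst_ x := ((x : R)%:C)%C.

Lemma gauss_step_le (A c : R) : 1 <= A -> 0 < c ->
  exists K d0 : R, [/\ 0 < K, 0 < d0 &
  forall (a b al be : C) (y d : R), nrm a <= A -> nrm b <= A -> nrm al <= A ->
    nrm be <= A -> c <= complex.Re (a ^+ 2) -> 0 <= d -> d <= d0 -> d <= 1 ->
  nrm (gaussG (a + cst_ d * al) (b + cst_ d * be) y - gaussG a b y
     - (gaussH a b al be (y + d) - gaussH a b al be y))
  <= K * d ^+ 2 * ((1 + `|y|)^-1) ^+ 2].
Proof.
move=> A1 c0; have A0 : 0 <= A by lra.
have [KE KE0 EP] := @nrm_gaussE_affine R A c c0.
(* [Q] controls the exponents of the remainders, while the Gaussian decays at rate [2 * k]. For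
   [d <= k / Q] the factor [expR (Q * d * Y ^+ 2)] costs at most half of this decay. *)
pose Q := 3 * pi * A ^+ 2 : R; pose k := pi * c / 4 : R.
have pi1 : 1 <= pi :> R by have := pi_ge2 R; lra.
have AA : 1 <= A ^+ 2 by rewrite exprn_ege1.
have Q1 : 1 <= Q by rewrite /Q; nra.
have Q0 : 0 <= Q by lra.
have k0 : 0 < k by rewrite /k divr_gt0 // mulr_gt0 // pi_gt0.
exists (KE * (21 * A * Q ^+ 2) * (24 / k ^+ 4)), (k / Q); split.
- by rewrite !mulr_gt0 ?exprn_gt0 ?invr_gt0 ?exprn_gt0 //; lra.
- by rewrite divr_gt0 //; lra.
move=> a b al be y d aA bA alA beA ac d0 dk d1.
rewrite gauss_step_identity.
set u := a * cst_ y + b; set us := al * cst_ y + be.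
have uY : nrm u <= A * (1 + `|y|) := affine_nrm_le y aA bA.
have usY : nrm us <= A * (1 + `|y|) := affine_nrm_le y alA beA.
have EY := EP a b y aA bA ac; rewrite -/u in EY.
have Y1 : 1 <= 1 + `|y| by rewrite lerDl.
move: (1 + `|y|) uY usY EY Y1 => Y uY usY EY Y1.
have Y0 : 0 <= Y by lra.
have dQ : d * Q <= k by rewrite -ler_pdivlMr //; lra.
have rem v : nrm v <= d * (A * Y) ->
    nrm (expC (- (2 * piC R * u * v + piC R * v ^+ 2)) - 1 + 2 * piC R * u * v)
    <= 5 * Q ^+ 2 * d ^+ 2 * Y ^+ 4 * expR (Q * d * Y ^+ 2).
  move=> vd; have v2 : nrm v ^+ 2 <= (d * (A * Y)) ^+ 2.
    by apply: lerXn2r => //; rewrite nnegrE ?nrm_ge0 // (le_trans _ vd) // nrm_ge0.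
  have uv : nrm u * nrm v <= A * Y * (d * (A * Y)).
    by apply: ler_pM; rewrite ?nrm_ge0.
  have dAY : (d * (A * Y)) ^+ 2 <= d * (A ^+ 2 * Y ^+ 2).
    have -> : (d * (A * Y)) ^+ 2 = d * (d * (A ^+ 2 * Y ^+ 2)) by ring.
    apply: ler_wpM2l => //; rewrite -[X in _ <= X]mul1r ler_wpM2r //.
    by rewrite mulr_ge0 ?sqr_ge0.
  apply: gauss_remainder_le => //.
    apply: le_trans (nrmD _ _) _; rewrite !nrmM nrm_pi nrm_nat.
    have -> : Q * d * Y ^+ 2 = 2 * pi * (A * Y * (d * (A * Y)))
       + pi * (d * (A ^+ 2 * Y ^+ 2)) by rewrite /Q; ring.
    apply: lerD; last by rewrite ler_wpM2l ?(le_trans v2) // pi_ge0.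
    by rewrite -mulrA ler_wpM2l // mulr_ge0 // pi_ge0.
  rewrite nrmM nrmX nrm_pi.
  apply: (@le_trans _ _ (pi * (d * (A * Y)) ^+ 2)); first by rewrite ler_wpM2l // pi_ge0.
  have -> : pi * (d * (A * Y)) ^+ 2 = d ^+ 2 * (pi * A ^+ 2 * Y ^+ 2) by ring.
  have -> : Q ^+ 2 * d ^+ 2 * Y ^+ 4 = d ^+ 2 * (Q ^+ 2 * Y ^+ 2 * Y ^+ 2) by ring.
  apply: ler_wpM2l; first exact: sqr_ge0.
  apply: ler_wpM2r; first exact: sqr_ge0.
  have q0 : 0 <= pi * A ^+ 2 by rewrite mulr_ge0 ?sqr_ge0 ?pi_ge0.
  have q1 : pi * A ^+ 2 <= Q by rewrite /Q; lra.
  have q2 : Q <= Q ^+ 2 by rewrite expr2 ler_peMl //; lra.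
  have y2 : 1 <= Y ^+ 2 by rewrite exprn_ege1.
  apply: le_trans q1 (le_trans q2 _).
  by rewrite ler_peMr // sqr_ge0.
have dAY1 : d * A <= d * (A * Y) by rewrite ler_wpM2l // ler_peMr.
have r1 := rem (cst_ d * us); have r2 := rem (cst_ d * a).
rewrite !nrmM !nrm_real (ger0_norm d0) in r1 r2.
have {}r1 := r1 (ler_wpM2l d0 usY).
have {}r2 := r2 (le_trans (ler_wpM2l d0 aA) dAY1).
set X := 5 * Q ^+ 2 * _ * _ * _ in r1 r2.
have X0 : 0 <= X by apply: le_trans r1; exact: nrm_ge0.
have D1 : nrm (cst_ d * al) <= A.
  rewrite nrmM nrm_real ger0_norm // -[A]mul1r; apply: ler_pM; rewrite ?nrm_ge0 //.
have AY : A <= A * Y by rewrite ler_peMr.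
have inner : nrm (cst_ d ^+ 2 * (2 * piC R * u * al * (a - us))
    + (a + cst_ d * al) * (expC (- (2 * piC R * u * (cst_ d * us) + piC R * (cst_ d * us) ^+ 2)) - 1 + 2 * piC R * u * (cst_ d * us))
    - (us + cst_ d * al) * (expC (- (2 * piC R * u * (cst_ d * a) + piC R * (cst_ d * a) ^+ 2)) - 1 + 2 * piC R * u * (cst_ d * a)))
   <= 21 * A * Q ^+ 2 * d ^+ 2 * Y ^+ 6 * expR (Q * d * Y ^+ 2).
  apply: le_trans (nrmB _ _) _; apply: le_trans (lerD (nrmD _ _) (lexx _)) _.
  have t2 : nrm (a + cst_ d * al) <= 2 * A * Y.
    by apply: le_trans (nrmD _ _) _; lra.
  have t3 : nrm (us + cst_ d * al) <= 2 * A * Y.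
    by apply: le_trans (nrmD _ _) _; lra.
  have t1 : nrm (a - us) <= 2 * A * Y.
    by apply: le_trans (nrmB _ _) _; lra.
  rewrite [nrm (cst_ d ^+ 2 * _)]nrmM [nrm ((a + _) * _)]nrmM [nrm ((us + _) * _)]nrmM.
  have T2 := ler_pM (nrm_ge0 _) (nrm_ge0 _) t2 r1.
  have T3 := ler_pM (nrm_ge0 _) (nrm_ge0 _) t3 r2.
  have T1 : nrm (cst_ d ^+ 2) * nrm (2 * piC R * u * al * (a - us))
      <= d ^+ 2 * (2 * pi * (A * Y) * A * (2 * A * Y)).
    rewrite nrmX nrm_real ger0_norm // ler_wpM2l ?sqr_ge0 //.
    rewrite !nrmM nrm_nat nrm_pi.
    apply: ler_pM; rewrite ?mulr_ge0 ?nrm_ge0 ?pi_ge0 //.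
    apply: ler_pM; rewrite ?mulr_ge0 ?nrm_ge0 ?pi_ge0 //.
    by apply: ler_wpM2l; rewrite ?mulr_ge0 ?pi_ge0.
  apply: le_trans (lerD (lerD T1 T2) T3) _.
  have e1 : 1 <= expR (Q * d * Y ^+ 2).
    by rewrite -expR0 ler_expR !mulr_ge0 ?sqr_ge0 ?pi_ge0 //; lra.
  rewrite /X; move: (expR _) e1 => e e1.
  have Y46 : Y ^+ 5 <= Y ^+ 6 by rewrite ler_weXn2l.
  have Y26 : Y ^+ 2 <= Y ^+ 6 by rewrite ler_weXn2l.
  have P1 : 0 <= A * Q ^+ 2 * d ^+ 2 by rewrite !mulr_ge0 ?sqr_ge0 ?pi_ge0.
  have S2 : 2 * A * Y * (5 * Q ^+ 2 * d ^+ 2 * Y ^+ 4 * e)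
      <= 10 * (A * Q ^+ 2 * d ^+ 2 * Y ^+ 6 * e).
    have -> : 2 * A * Y * (5 * Q ^+ 2 * d ^+ 2 * Y ^+ 4 * e)
      = 10 * (A * Q ^+ 2 * d ^+ 2 * Y ^+ 5 * e) by ring.
    apply: ler_wpM2l => //; apply: ler_wpM2r; first by lra.
    exact: ler_wpM2l.
  have S1 : d ^+ 2 * (2 * pi * (A * Y) * A * (2 * A * Y))
      <= A * Q ^+ 2 * d ^+ 2 * Y ^+ 6 * e.
    apply: (@le_trans _ _ (A * Q ^+ 2 * d ^+ 2 * Y ^+ 2 * 1)).
      have -> : d ^+ 2 * (2 * pi * (A * Y) * A * (2 * A * Y))
        = A * (4 * (pi * A ^+ 2)) * (d ^+ 2 * Y ^+ 2) by ring.
      have -> : A * Q ^+ 2 * d ^+ 2 * Y ^+ 2 * 1 = A * Q ^+ 2 * (d ^+ 2 * Y ^+ 2) by ring.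
      apply: ler_wpM2r; first by rewrite mulr_ge0 ?sqr_ge0.
      apply: ler_wpM2l => //.
      have pA : 1 <= pi * A ^+ 2 by rewrite mulr_ege1.
      have -> : Q = 3 * (pi * A ^+ 2) by rewrite /Q mulrA.
      by nra.
    have W0 : 0 <= A * Q ^+ 2 * d ^+ 2 * Y ^+ 2 by apply: mulr_ge0 => //; exact: sqr_ge0.
    apply: ler_pM => //; exact: ler_wpM2l.
  (* One unit comes from [S1], ten from each use of [S2]. *)
  have -> : 21 * A * Q ^+ 2 * d ^+ 2 * Y ^+ 6 * e
    = A * Q ^+ 2 * d ^+ 2 * Y ^+ 6 * e + 10 * (A * Q ^+ 2 * d ^+ 2 * Y ^+ 6 * e)
      + 10 * (A * Q ^+ 2 * d ^+ 2 * Y ^+ 6 * e) by ring.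
  exact: lerD (lerD S1 S2) S2.
rewrite nrmM.
have k2 : pi * c / 2 = 2 * k by rewrite /k; field.
rewrite k2 in EY.
apply: le_trans (ler_pM (nrm_ge0 _) (nrm_ge0 _) EY inner) _.
have x1 : expR (Q * d * Y ^+ 2) <= expR (k * Y ^+ 2).
  by rewrite ler_expR ler_wpM2r ?sqr_ge0 // mulrC.
have x2 : expR (- (2 * k * Y ^+ 2)) * expR (k * Y ^+ 2) = expR (- (k * Y ^+ 2)).
  by rewrite -expRD; congr expR; ring.
have fin := @expRN_sqr_le R k Y k0 (lt_le_trans ltr01 Y1).
have W : 0 <= KE * (21 * A * Q ^+ 2 * d ^+ 2).
  by rewrite !mulr_ge0 ?sqr_ge0 ?pi_ge0 // ltW.
have -> : KE * (21 * A * Q ^+ 2) * (24 / k ^+ 4) * d ^+ 2 * Y^-1 ^+ 2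
  = KE * (21 * A * Q ^+ 2 * d ^+ 2) * (24 / k ^+ 4 * Y^-1 ^+ 2) by ring.
apply: le_trans (ler_wpM2l W fin); rewrite -x2.
have -> : KE * expR (- (2 * k * Y ^+ 2)) *
    (21 * A * Q ^+ 2 * d ^+ 2 * Y ^+ 6 * expR (Q * d * Y ^+ 2))
  = KE * (21 * A * Q ^+ 2 * d ^+ 2) *
    (Y ^+ 6 * (expR (- (2 * k * Y ^+ 2)) * expR (Q * d * Y ^+ 2))) by ring.
apply: ler_wpM2l => //; apply: ler_wpM2l; first by rewrite exprn_ge0.
by apply: ler_wpM2l x1; rewrite expR_ge0.
Qed.

End GaussianStepBound.

(** * Riemann sums and their asymptotic independence of the affine path *)

Section RiemannGauss.
Variable R : realType.
Local Notation C := (Cplx R).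
Local Notation cst_ x := ((x : R)%:C)%C.
Implicit Types (K : R) (N : nat) (n : int).

Lemma node_complex n N : cst_ (n%:~R / N%:R) = n%:~R / N%:R.
Proof. by rewrite intr_complex natr_complex -fmorphV -rmorphM. Qed.

Lemma node_absE n N : `|n%:~R / N.+1%:R| = N.+1%:R^-1 * `|n|%:R :> R.
Proof.
rewrite normrM normfV [`|N.+1%:R|]ger0_norm // mulrC; congr (_ * _).
by rewrite -intr_norm -abszE.
Qed.

Lemma node_bd_le n N :
  ((1 + `|n%:~R / N.+1%:R : R|)^-1) ^+ 2 <= N.+1%:R ^+ 2 * bd R n.
Proof.
rewrite node_absE /bd -exprMn.
have p : 0 < 1 + N.+1%:R^-1 * `|n|%:R :> R by rewrite ltr_pwDl // mulr_ge0.
have q : 0 < 1 + `|n|%:R :> R by rewrite ltr_pwDl.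
have N0 : 0 < N.+1%:R :> R by rewrite ltr0n.
apply: lerXn2r; rewrite ?nnegrE ?mulr_ge0 ?invr_ge0 ?(ltW p) ?(ltW q) //.
rewrite ler_pdivlMr // ler_pdivrMl // mulrDl mul1r mulrAC mulVf ?gt_eqF //.
rewrite mul1r lerD2r.
by rewrite ler1n.
Qed.

Lemma zdom_grid (F : int -> C) K N : 0 <= K ->
  (forall n, nrm (F n) <= K * ((1 + `|n%:~R / N.+1%:R|)^-1) ^+ 2) ->
  zdom F (K * N.+1%:R ^+ 2).
Proof.
move=> K0 fK n; apply: le_trans (fK _) _; rewrite -mulrA.
exact: ler_wpM2l (node_bd_le n N).
Qed.

(** There are [N.+1] nodes per unit length, which accounts for the growth; the factor 3 is that of
    [psum_sqr_inv_le]. *)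
Lemma zsum_grid_le (F : int -> C) K N : 0 <= K ->
  (forall n, nrm (F n) <= K * ((1 + `|n%:~R / N.+1%:R|)^-1) ^+ 2) ->
  nrm (zsum F) <= 3 * K * N.+1%:R.
Proof.
move=> K0 fK.
apply: (tends_nrm_le (zsum_tends (zdom_grid K0 fK))) => M.
apply: le_trans (nrm_psum _ _) _.
have N0 : 0 < N.+1%:R :> R by rewrite ltr0n.
pose d := N.+1%:R^-1 : R.
have d01 : 0 < d <= 1 by rewrite invr_gt0 ltr0n /= invf_le1 // ler1n.
apply: (@le_trans _ _ (K * N.+1%:R *
    psum (fun m : int => d * ((1 + d * `|m|%:R)^-1) ^+ 2) M)).
  rewrite /psum mulr_sumr; apply: ler_sum => i _.
  apply: le_trans (fK _) _; rewrite node_absE -/d -mulrA ler_wpM2l //.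
  by rewrite mulrA mulfV ?mul1r // gt_eqF.
have -> : 3 * K * N.+1%:R = K * N.+1%:R * 3 by ring.
apply: ler_wpM2l; first by rewrite mulr_ge0.
apply: le_trans (psum_sqr_inv_le M d01) _.
by rewrite gerBl mulr_ge0 // invr_ge0 addr_ge0 // mulr_ge0 // ltW //; case/andP: d01.
Qed.

Lemma decay_ge0 (f : R -> C) K :
  (forall y, nrm (f y) <= K * ((1 + `|y|)^-1) ^+ 2) -> 0 <= K.
Proof.
move=> fK; have := fK 0; rewrite normr0 addr0 invr1 expr1n mulr1.
by apply: le_trans; exact: nrm_ge0.
Qed.

Lemma zdom_node (f : R -> C) K N :
  (forall y, nrm (f y) <= K * ((1 + `|y|)^-1) ^+ 2) ->
  zdom (fun n => f (n%:~R / N.+1%:R)) (K * N.+1%:R ^+ 2).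
Proof. by move=> fK; apply: zdom_grid => //; exact: decay_ge0 fK. Qed.

Lemma zsum_node_le (f : R -> C) K N :
  (forall y, nrm (f y) <= K * ((1 + `|y|)^-1) ^+ 2) ->
  nrm (zsum (fun n => f (n%:~R / N.+1%:R))) <= 3 * K * N.+1%:R.
Proof. by move=> fK; apply: zsum_grid_le => //; exact: decay_ge0 fK. Qed.

Lemma gaussGH_le (A c : R) : 0 < c -> 0 <= A -> exists2 K, 0 <= K &
  forall (a b al be : C) (y : R), nrm a <= A -> nrm b <= A -> nrm al <= A ->
    nrm be <= A -> c <= complex.Re (a ^+ 2) ->
    nrm (gaussG a b y) <= K * ((1 + `|y|)^-1) ^+ 2 /\
    nrm (gaussH a b al be y) <= K * ((1 + `|y|)^-1) ^+ 2.
Proof.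
move=> c0 A0; have [KE KE0 EP] := @nrm_gaussE_affine R A c c0.
pose k := pi * c / 2 : R; have k0 : 0 < k by rewrite divr_gt0 // mulr_gt0 // pi_gt0.
exists (A * KE * (24 / k ^+ 4)).
  by rewrite !mulr_ge0 // ?invr_ge0 ?exprn_ge0 // ltW.
move=> a b al be y aA bA alA beA ac.
have EY := EP a b y aA bA ac.
have hY := affine_nrm_le y alA beA.
have Y1 : 1 <= 1 + `|y| by rewrite lerDl.
rewrite /gaussG /gaussH (nrmM a) (nrmM (_ + be)).
have core (x : R) : 0 <= x -> x <= A * (1 + `|y|) ->
    x * nrm (gaussE (a * cst_ y + b))
    <= A * KE * (24 / k ^+ 4) * ((1 + `|y|)^-1) ^+ 2.
  move=> x0 xA; apply: le_trans (ler_pM x0 (nrm_ge0 _) xA EY) _.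
  rewrite -/k; move: (1 + `|y|) Y1 => Y Y1.
  have fin := @expRN_sqr_le R k Y k0 (lt_le_trans ltr01 Y1).
  have -> : A * KE * (24 / k ^+ 4) * Y^-1 ^+ 2 = A * KE * (24 / k ^+ 4 * Y^-1 ^+ 2).
    by rewrite -mulrA.
  have -> : A * Y * (KE * expR (- (k * Y ^+ 2))) = A * KE * (Y * expR (- (k * Y ^+ 2))).
    by ring.
  apply: ler_wpM2l; first by rewrite mulr_ge0 // ltW.
  apply: le_trans fin; apply: ler_wpM2r; first exact: expR_ge0.
  by rewrite -[X in X <= _]expr1 ler_weXn2l.
split; apply: core; rewrite ?nrm_ge0 //.
by apply: le_trans aA _; rewrite ler_peMr.
Qed.

Definition riemann_gauss (a b : C) N : C :=
  N.+1%:R^-1 * zsum (fun n => gaussG a b (n%:~R / N.+1%:R)).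

(** The step in the parameters equals the mesh, so the [gaussH] difference in [gauss_step_le] is a
    shift by one node and sums to 0. The errors, of order [d ^ 2] at each node, are summed over the
    grid and multiplied by the mesh. *)
Lemma riemann_gauss_step (A c : R) : 1 <= A -> 0 < c ->
  exists K : R, exists N0 : nat, 0 <= K /\
  forall N (a b al be : C), (N0 <= N)%N -> nrm a <= A -> nrm b <= A ->
    nrm al <= A -> nrm be <= A -> c <= complex.Re (a ^+ 2) ->
    nrm (a + N.+1%:R^-1 * al) <= A -> nrm (b + N.+1%:R^-1 * be) <= A ->
    c <= complex.Re ((a + N.+1%:R^-1 * al) ^+ 2) ->
    nrm (riemann_gauss (a + N.+1%:R^-1 * al) (b + N.+1%:R^-1 * be) N
         - riemann_gauss a b N) <= K * (N.+1%:R^-1) ^+ 2.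
Proof.
move=> A1 c0; have [K [d0 [K0 d00 step]]] := gauss_step_le A1 c0.
have [KG KG0 GH] := @gaussGH_le A c c0 (le_trans ler01 A1).
have [N0 N0P] := @div_natS_lt R 1 d0 d00.
exists (3 * K), N0; split; first by rewrite mulr_ge0 // ltW.
move=> N a b al be NN aA bA alA beA ac aA' bA' ac'.
pose d := N.+1%:R^-1 : R.
have dC : N.+1%:R^-1 = cst_ d by rewrite natr_complex -fmorphV.
have d0' : 0 <= d by rewrite invr_ge0.
have d1 : d <= 1 by rewrite invf_le1 ?ltr0n // ler1n.
have dd0 : d <= d0 by have := N0P N NN; rewrite mul1r => /ltW.
rewrite dC in aA' bA' ac' *.
set a' := a + _ in aA' ac' *; set b' := b + _ in bA' *.
have zG := zdom_node N (fun y => (GH a b al be y aA bA alA beA ac).1).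
have zG' := zdom_node N (fun y => (GH a' b' al be y aA' bA' alA beA ac').1).
have zH := zdom_node N (fun y => (GH a b al be y aA bA alA beA ac).2).
have st y := step a b al be y d aA bA alA beA ac d0' dd0 d1.
rewrite -/a' -/b' in st.
have zs := zsum_node_le N st.
rewrite /riemann_gauss dC -mulrBr nrmM nrm_real ger0_norm //.
have E : zsum (fun n => gaussG a' b' (n%:~R / N.+1%:R) - gaussG a b (n%:~R / N.+1%:R)
   - (gaussH a b al be (n%:~R / N.+1%:R + d) - gaussH a b al be (n%:~R / N.+1%:R)))
  = zsum (fun n => gaussG a' b' (n%:~R / N.+1%:R))
    - zsum (fun n => gaussG a b (n%:~R / N.+1%:R)).
  have sh n : gaussH a b al be (n%:~R / N.+1%:R + d)
      = gaussH a b al be ((n + 1)%:~R / N.+1%:R).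
    by rewrite intrD mulrDl mul1r.
  have zHs := zdom_shift zH.
  rewrite (@eq_zsum _ _ (fun n => gaussG a' b' (n%:~R / N.+1%:R) - gaussG a b (n%:~R / N.+1%:R)
    - (gaussH a b al be ((n + 1)%:~R / N.+1%:R) - gaussH a b al be (n%:~R / N.+1%:R)))); last first.
    by move=> n; rewrite sh.
  have zdomN (f g : int -> C) K1 K2 : zdom f K1 -> zdom g K2 -> zdom (fun m => f m - g m) (K1 + K2).
    by move=> h1 h2 m; apply: le_trans (nrmB _ _) _; rewrite mulrDl lerD.
  rewrite (zsumB (zdomN _ _ _ _ zG' zG) (zdomN _ _ _ _ zHs zH)).
  by rewrite (zsumB zG' zG) (zsumB zHs zH) (zsum_shift zH) subrr subr0.
rewrite -E; apply: le_trans (ler_wpM2l d0' zs) _.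
have -> : d * (3 * (K * d ^+ 2) * N.+1%:R) = 3 * K * d ^+ 2 * (d * N.+1%:R) by ring.
by rewrite mulVf ?mulr1 // pnatr_eq0.
Qed.

(** A discrete contour deformation: [N.+1] steps lead from [(1, 0)] to [(w, z)], each costing
    [K * d ^+ 2] with [d] the inverse of [N.+1]. *)
Lemma riemann_gauss_rate (w z : C) : `|complex.Im w| < complex.Re w ->
  exists K : R, exists N0 : nat, forall N, (N0 <= N)%N ->
    nrm (riemann_gauss w z N - riemann_gauss 1 0 N) <= K / N.+1%:R.
Proof.
move=> hw; pose A := 1 + nrm w + nrm (w - 1) + nrm z.
have A1 : 1 <= A by rewrite /A; have := nrm_ge0 w; have := nrm_ge0 z;
  have := nrm_ge0 (w - 1); lra.
(* [m] bounds [Re - |Im|] from below at 1 and at [w], hence on the segment between them. Since the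
   real part of [a ^ 2] is [(Re a - |Im a|) (Re a + |Im a|)], it stays at least [m ^+ 2]. *)
have [m [m0 m1 mw]] : exists m : R, [/\ 0 < m, m <= 1 & m <= complex.Re w - `|complex.Im w|].
  exists (Num.min 1 (complex.Re w - `|complex.Im w|)).
  by rewrite lt_min ltr01 subr_gt0 hw ge_min lexx ge_min lexx orbT.
have c0 : 0 < m ^+ 2 by rewrite exprn_gt0.
have [K [N0 [K0 step]]] := riemann_gauss_step A1 c0.
exists K, N0 => N NN; pose d := N.+1%:R^-1 : R.
have dC : N.+1%:R^-1 = cst_ d by rewrite natr_complex -fmorphV.
have d0 : 0 <= d by rewrite invr_ge0.
have dN : N.+1%:R * d = 1 by rewrite mulfV // pnatr_eq0.
pose a (j : nat) : C := 1 + cst_ (j%:R * d) * (w - 1).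
pose b (j : nat) : C := cst_ (j%:R * d) * z.
have jd (j : nat) : (j <= N.+1)%N -> 0 <= j%:R * d <= 1.
  move=> jN; rewrite mulr_ge0 //= -[X in _ <= X]dN.
  by apply: ler_wpM2r => //; rewrite ler_nat.
have aA j : (j <= N.+1)%N -> nrm (a j) <= A.
  move=> /jd /andP[s0 s1]; apply: le_trans (nrmD _ _) _.
  rewrite nrm1 nrmM nrm_real ger0_norm //.
  have := ler_wpM2r (nrm_ge0 (w - 1)) s1; rewrite mul1r /A.
  have := nrm_ge0 w; have := nrm_ge0 z; lra.
have bA j : (j <= N.+1)%N -> nrm (b j) <= A.
  move=> /jd /andP[s0 s1]; rewrite nrmM nrm_real ger0_norm //.
  have := ler_wpM2r (nrm_ge0 z) s1; rewrite mul1r /A.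
  have := nrm_ge0 w; have := nrm_ge0 (w - 1); lra.
have ac j : (j <= N.+1)%N -> m ^+ 2 <= complex.Re (a j ^+ 2).
  move=> /jd; rewrite /a; move: (j%:R * d) => s /andP[s0 s1].
  rewrite expr2 Re_mul Re_add Im_add !Re_realM Im_mul /= !mul0r !addr0 add0r.
  rewrite Re_add Im_add /= oppr0 addr0.
  move: mw (ler_norm (complex.Im w)) (ler_norm (- complex.Im w)); rewrite normrN.
  move: (complex.Re w) (complex.Im w) (`|complex.Im w|) => x y Y mw y1 y2.
  have h1 : m <= 1 + s * (x - 1) - s * Y by nra.
  have h2 : s * y <= s * Y by rewrite ler_wpM2l.
  have h3 : - (s * Y) <= s * y by nra.
  by nra.
have ind j : (j <= N.+1)%N ->
    nrm (riemann_gauss (a j) (b j) N - riemann_gauss 1 0 N) <= j%:R * (K * d ^+ 2).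
  elim: j => [|j IH] jN.
    have -> : a 0 = 1 by rewrite /a mul0r mul0r addr0.
    have -> : b 0 = 0 by rewrite /b mul0r mul0r.
    by rewrite subrr nrm0 mul0r.
  have jN' := ltnW jN.
  have aS : a j.+1 = a j + N.+1%:R^-1 * (w - 1).
    by rewrite /a dC -natr1 mulrDl mul1r rmorphD mulrDl addrA.
  have bS : b j.+1 = b j + N.+1%:R^-1 * z.
    by rewrite /b dC -natr1 mulrDl mul1r rmorphD mulrDl.
  apply: le_trans (nrm_dist_trans (riemann_gauss (a j) (b j) N) _ _) _.
  rewrite -natr1 mulrDl mul1r addrC; apply: lerD; first exact: IH.
  rewrite aS bS; apply: step => //; rewrite -?aS -?bS.
  - exact: aA.
  - exact: bA.
  - by rewrite /A; have := nrm_ge0 w; have := nrm_ge0 z; lra.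
  - by rewrite /A; have := nrm_ge0 w; have := nrm_ge0 (w - 1); lra.
  - exact: ac.
  - exact: aA.
  - exact: bA.
  - exact: ac.
have := ind N.+1 (leqnn _).
have -> : a N.+1 = w by rewrite /a dN mul1r addrC subrK.
have -> : b N.+1 = z by rewrite /b dN mul1r.
have -> // : N.+1%:R * (K * d ^+ 2) = K / N.+1%:R.
by transitivity (K * d * (N.+1%:R * d)); [ring | rewrite dN mulr1].
Qed.

End RiemannGauss.

(** * Jacobi inversion *)

Section Waves.
Variable R : realType.
Local Notation C := (Cplx R).
Local Notation cst_ x := ((x : R)%:C)%C.

Lemma cos_halfE (x : R) : cos x = 2 * cos (x / 2) ^+ 2 - 1.
Proof.
have -> : cos x = cos (x / 2 + x / 2) by rewrite -splitr.
by rewrite cosD -!expr2 sin2cos2; ring.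
Qed.

Lemma sin_halfE (x : R) : sin x = 2 * sin (x / 2) * cos (x / 2).
Proof.
have -> : sin x = sin (x / 2 + x / 2) by rewrite -splitr.
by rewrite sinD; ring.
Qed.

(** By the mean value theorem [sin (x / 2) = (x / 2) cos c] with [cos c >= cos (x / 2)]. Hence [sin
    x = x cos c cos (x / 2) >= x cos (x / 2) ^ 2 >= x / 2]. *)
Lemma sin_ge_half (x : R) : 0 <= x <= pi / 2 -> x / 2 <= sin x.
Proof.
move=> /andP[x0 x1]; have [->|xn0] := eqVneq x 0; first by rewrite mul0r sin0.
have pi0 := pi_ge0 R.
have h0 : 0 < x / 2 by rewrite divr_gt0 // lt_neqAle eq_sym xn0.
have [c /andP[]] := @MVT R sin cos 0 (x / 2) h0 (fun (y : R) _ => is_derive_sin y)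
  (continuous_subspaceT (@continuous_sin R)).
rewrite !bnd_simp sin0 !subr0 => c0 cx e.
have cc : cos (x / 2) <= cos c.
  by apply: ltW; rewrite ltr_cos // in_itv /=; apply/andP; split; lra.
have c1 : 0 <= cos x by apply: cos_ge0_pihalf; apply/andP; split; lra.
have c2 : 0 <= cos (x / 2) by apply: cos_ge0_pihalf; apply/andP; split; lra.
have := cos_halfE x; rewrite sin_halfE e => E.
have h1 := ler_wpM2r c2 cc; rewrite -expr2 in h1.
have h2 : 2^-1 <= cos c * cos (x / 2) by lra.
have := ler_wpM2l x0 h2; lra.
Qed.

Lemma realM (x y : R) : cst_ (x * y) = cst_ x * cst_ y.
Proof. by apply: Cplx_ext; rewrite ?Re_mul ?Im_mul /=; ring. Qed.

Lemma realN (x : R) : cst_ (- x) = - cst_ x.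
Proof. by apply: Cplx_ext; rewrite ?Re_opp ?Im_opp /= ?oppr0. Qed.

Lemma expC_2piI : expC (2 * piC R * 'i) = 1.
Proof.
have e : 2 * piC R * 'i = (0 +i* (pi *+ 2))%C :> C.
  by apply: Cplx_ext; rewrite natr_complex imC ?Re_mul ?Im_mul /= ?Im_mul ?Re_mul /=; ring.
by rewrite e; apply: Cplx_ext; rewrite ?Re_expC ?Im_expC /= expR0 mul1r ?cos2pi ?sin2pi.
Qed.

Lemma expC_2piI_int (m : int) : expC (2 * piC R * 'i * m%:~R) = 1.
Proof.
case: m => n.
  by rewrite -pmulrn mulr_natr expC_nat expC_2piI expr1n.
rewrite NegzE mulrNz mulrN expCN -pmulrn mulr_natr expC_nat expC_2piI.
by rewrite expr1n invr1.
Qed.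

Lemma Re_expC_imag (x : R) : expC ('i * cst_ x) = (cos x +i* sin x)%C.
Proof.
by apply: Cplx_ext; rewrite ?Re_expC ?Im_expC ?Re_mul ?Im_mul imC /=
  !(mul0r, mulr0, mul1r, subrr, add0r, addr0, subr0) ?expR0 ?mul1r.
Qed.

(** The characters of the cyclic group of order [N.+1], lifted to the integers in both variables. *)
Definition wave (N : nat) (k n : int) : C :=
  expC (- (2 * piC R * 'i * (k%:~R * n%:~R / N.+1%:R))).

Lemma wave_real N k n :
  wave N k n = expC ('i * cst_ (- (2 * (pi * ((k * n)%:~R / N.+1%:R))))).
Proof.
rewrite /wave -intrM -node_complex realN realM realM -(natr_complex R 2) -/(piC R).
by congr expC; ring.
Qed.

Lemma nrm_wave N k n : nrm (wave N k n) = 1.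
Proof.
by rewrite wave_real nrm_expC Re_mul imC /= mul0r mulr0 subrr expR0.
Qed.

Lemma wave_add N k n m : wave N k (n + m) = wave N k n * wave N k m.
Proof. by rewrite /wave -expCD intrD; congr expC; ring. Qed.

Lemma waveSk N k n : wave N (k + 1) n = wave N 1 n * wave N k n.
Proof. by rewrite /wave -expCD intrD; congr expC; ring. Qed.

Lemma waveC N k n : wave N k n = wave N n k.
Proof. by rewrite /wave [k%:~R * _]mulrC. Qed.

Lemma wave0 N n : wave N 0 n = 1.
Proof. by rewrite /wave mul0r mul0r mulr0 oppr0 expC0. Qed.

Lemma wave_period N (k n : int) : wave N k (N.+1%:Z * n) = 1.
Proof.
rewrite /wave; have -> : - (2 * piC R * 'i * (k%:~R * (N.+1%:Z * n)%:~R / N.+1%:R))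
   = 2 * piC R * 'i * (- (k * n))%:~R.
  rewrite mulrNz mulrN !intrM; congr (- (_ * _)).
  rewrite -[N.+1%:Z%:~R]/(N.+1%:R : C) [k%:~R * _]mulrCA [N.+1%:R * _]mulrC mulfK //.
exact: expC_2piI_int.
Qed.

(** The eigenvalue of the second difference operator on the character of frequency [k]. *)
Lemma wave_freq N k : wave N k 1 + (wave N k 1)^-1 - 2
  = cst_ (- (4 * sin (pi * k%:~R / N.+1%:R) ^+ 2)).
Proof.
set x := pi * k%:~R / N.+1%:R.
have xx : 2 * (pi * ((k * 1)%:~R / N.+1%:R)) = x + x by rewrite /x mulr1; ring.
have e1 : wave N k 1 = (cos (x + x) +i* - sin (x + x))%C.
  by rewrite wave_real xx Re_expC_imag cosN sinN.
have e2 : (wave N k 1)^-1 = (cos (x + x) +i* sin (x + x))%C.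
  by rewrite wave_real xx -expCN -mulrN -realN opprK Re_expC_imag.
rewrite e2 e1; apply: Cplx_ext; rewrite ?Re_add ?Im_add natr_complex /=.
  by rewrite cosD -!expr2 cos2sin2; ring.
by ring.
Qed.

(** With the odd number [M.*2.+1] of nodes, [|k| <= M] keeps the absolute value of the angle within
    [[0, pi / 2]], where [sin_ge_half] applies. *)
Lemma nrm_wave_freq_ge M (k : int) : (`|k| <= M)%N ->
  (`|k|%:R / M.*2.+1%:R) ^+ 2 <=
  nrm (wave M.*2 k 1 + (wave M.*2 k 1)^-1 - 2).
Proof.
move=> kM; rewrite wave_freq nrm_real normrN.
set x := pi * k%:~R / _.
have pi2 := pi_ge2 R.
have q : 0 <= `|k|%:R / M.*2.+1%:R :> R by rewrite divr_ge0.
have ax : `|x| = pi * (`|k|%:R / M.*2.+1%:R).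
  rewrite /x !normrM normfV (ger0_norm (pi_ge0 R)) [`|M.*2.+1%:R|]ger0_norm //.
  by rewrite -mulrA; congr (_ * (_ * _)); rewrite -intr_norm -abszE.
have k2 : `|k|%:R / M.*2.+1%:R <= 2^-1 :> R.
  rewrite ler_pdivrMr ?ltr0n // ler_pdivlMl // -natrM ler_nat; lia.
have xp : 0 <= `|x| <= pi / 2.
  by rewrite normr_ge0 ax /= ler_wpM2l // pi_ge0.
have sx : sin x ^+ 2 = sin `|x| ^+ 2.
  by case: (ler0P x) => // _; rewrite sinN sqrrN.
have s0 := sin_ge_half xp.
rewrite sx ger0_norm; last by rewrite mulr_ge0 ?sqr_ge0.
have a1 : `|k|%:R / M.*2.+1%:R <= `|x|.
  by rewrite ax ler_peMl //; lra.
move: s0 a1 q; move: (`|k|%:R / _) (sin `|x|) (`|x|) (normr_ge0 x) => u s y y0 *.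
by nra.
Qed.

(** Orthogonality of characters: the geometric sum telescopes, and its end values agree because
    [M.+1] and [- M] are congruent modulo [M.*2.+1]. *)
Lemma psum_wave M (n : int) :
  psum (fun k => wave M.*2 k n) M =
    (if (M.*2.+1 %| `|n|)%N then M.*2.+1%:R else 0).
Proof.
have tel P : (wave M.*2 1 n - 1) * psum (fun k => wave M.*2 k n) P
    = wave M.*2 (P.+1%:Z) n - wave M.*2 (- P%:Z) n.
  elim: P => [|P IH].
    by rewrite psum0 oppr0 wave0 mulr1 -[1%:Z]/(1 : int).
  rewrite psumS mulrDr IH mulrDr.
  have -> : (wave M.*2 1 n - 1) * wave M.*2 P.+1%:Z n
      = wave M.*2 P.+2%:Z n - wave M.*2 P.+1%:Z n.
    have -> : P.+2%:Z = P.+1%:Z + 1 by lia.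
    by rewrite waveSk mulrBl mul1r.
  have -> : (wave M.*2 1 n - 1) * wave M.*2 (- P.+1%:Z) n
      = wave M.*2 (- P%:Z) n - wave M.*2 (- P.+1%:Z) n.
    have -> : - P%:Z = - P.+1%:Z + 1 by lia.
    by rewrite waveSk mulrBl mul1r.
  by ring.
case: ifPn => [/dvdnP[q qE]|nd].
  have [n' nE] : exists n', n = M.*2.+1%:Z * n'.
    exists (Num.sg n * q%:Z); rewrite mulrCA -PoszM mulnC -qE.
    by rewrite {1}[n]intEsg.
  rewrite /psum (eq_bigr (fun=> 1)) => [|i _]; last by rewrite nE wave_period.
  by rewrite sumr_const card_ord.
have := tel M.
have -> : wave M.*2 M.+1%:Z n = wave M.*2 (- M%:Z) n.
  have -> : M.+1%:Z = - M%:Z + M.*2.+1%:Z * 1 by lia.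
  by rewrite waveC wave_add wave_period mulr1 waveC.
rewrite subrr => /eqP; rewrite mulf_eq0 => /orP[|/eqP //].
rewrite subr_eq0 => /eqP w1.
(* With the residue taken in [[-M, M]], [nrm_wave_freq_ge] excludes that a nontrivial character
   equals 1 at 1. *)
have [q [r [nE rM r0]]] : exists q r : int, [/\ n = r + M.*2.+1%:Z * q, (`|r| <= M)%N & r != 0].
  pose m := (n %% M.*2.+1)%Z; pose q := (n %/ M.*2.+1)%Z.
  have e := divz_eq n M.*2.+1; rewrite -/m -/q in e.
  have m0 : 0 <= m by rewrite modz_ge0.
  have m1 : m < M.*2.+1%:Z by have := @ltz_mod n M.*2.+1%:Z; rewrite /m; lia.
  have mn : m != 0.
    apply/eqP => m0'; move: nd; rewrite e m0' addr0 abszM mulnC dvdn_mulr //.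
  have [mM|mM] := leP m M%:Z.
    by exists q, m; split => //; [rewrite {1}e; ring | lia].
  exists (q + 1), (m - M.*2.+1%:Z); split; [by rewrite {1}e; ring | lia | lia].
have wr : wave M.*2 r 1 = 1.
  rewrite waveC -w1 nE.
  by rewrite wave_add wave_period mulr1.
have := nrm_wave_freq_ge rM; rewrite wr invr1.
have -> : 1 + 1 - 2 = 0 :> C by ring.
rewrite nrm0 => h.
have : 0 < (`|r|%:R / M.*2.+1%:R) ^+ 2 :> R.
  by rewrite exprn_gt0 // divr_gt0 ?ltr0n // absz_gt0.
by rewrite ltNge h.
Qed.

End Waves.

(** * Poisson summation for Gaussians *)

Section Jacobi.
Variable R : realType.
Local Notation C := (Cplx R).
Local Notation cst_ x := ((x : R)%:C)%C.

Lemma zdom_unit_mul (e f : int -> C) (K : R) :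
  (forall n, nrm (e n) = 1) -> zdom f K -> zdom (fun n => e n * f n) K.
Proof. by move=> e1 fK n; rewrite nrmM e1 mul1r. Qed.

(** The hypothesis describes the sector |arg w| < pi/4, formed by the principal square roots of the
    right half-plane. *)
Lemma cone_sqr_gt0 (w : C) : `|complex.Im w| < complex.Re w ->
  0 < complex.Re (w ^+ 2).
Proof.
move=> hw; rewrite expr2 Re_mul -!expr2 subr_gt0 -[X in X < _]real_normK ?num_real //.
by rewrite ltrXn2r // (lt_le_trans hw) // ltW // (le_lt_trans _ hw).
Qed.

Lemma cone_neq0 (w : C) : `|complex.Im w| < complex.Re w -> w != 0.
Proof.
move=> hw; apply/eqP => w0; move: hw; rewrite w0 /= normr0 ltxx.
by [].
Qed.

Lemma Re_invX2_gt0 (w : C) : `|complex.Im w| < complex.Re w ->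
  0 < complex.Re (w^-1 ^+ 2).
Proof.
move=> hw; rewrite exprVn; have := cone_sqr_gt0 hw; move: (w ^+ 2) => z.
case: z => a b /= a0; rewrite divr_gt0 //.
by rewrite ltr_pwDl ?exprn_gt0 ?sqr_ge0.
Qed.

(* Discrete Fourier coefficient, on a grid of N.+1 points per unit length, of
   the sum of the integer translates of the Gaussian. *)
Definition fourier_amp (w b : C) (N : nat) (k : int) : C :=
  N.+1%:R^-1 * zsum (fun n => wave R N k n * gaussG w b (n%:~R / N.+1%:R)).

Section PoissonLimit.
Variables (w z : C).
Hypothesis hw : `|complex.Im w| < complex.Re w.

(** The Fourier coefficient that the integral over the line would give; its sum over [k] is the dual
    side of Poisson summation. *)
Definition poisson_term (k : int) : C :=
  expC (2 * piC R * 'i * k%:~R * z - piC R * (k%:~R / w) ^+ 2).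

Lemma gaussG_bounded (a b : C) : 0 < complex.Re (a ^+ 2) ->
  exists2 K, 0 <= K & forall y, nrm (gaussG a b y) <= K * ((1 + `|y|)^-1) ^+ 2.
Proof.
move=> a0; have A0 := addr_ge0 (nrm_ge0 a) (nrm_ge0 b).
have [K K0 KP] := gaussGH_le a0 A0; exists K => // y.
have aA : nrm a <= nrm a + nrm b by rewrite lerDl nrm_ge0.
have bA : nrm b <= nrm a + nrm b by rewrite lerDr nrm_ge0.
by have [] := KP a b a b y aA bA aA bA (lexx _).
Qed.

(** After completing the square this is a constant times the Gaussian of parameter [w^-1], sampled
    on the grid of mesh 1. *)
Lemma zdom_poisson_term : exists2 K, 0 <= K & zdom poisson_term K.
Proof.
have [K K0 KP] := gaussG_bounded (- ('i * z * w)) (Re_invX2_gt0 hw).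
have w0 := cone_neq0 hw.
have E k : poisson_term k = expC (- (piC R * (z * w) ^+ 2)) * w
    * gaussG w^-1 (- ('i * z * w)) (k%:~R / 1%:R).
  rewrite /gaussG mulrA -[_ * w * w^-1]mulrA divff // mulr1 /gaussE -expCD.
  congr expC; rewrite node_complex divr1.
  have i2 : 'i * 'i = -1 :> C by rewrite -expr2 sqrCi.
  have -> : (w^-1 * k%:~R + - ('i * z * w)) ^+ 2
    = (k%:~R / w) ^+ 2 - 2 * 'i * k%:~R * z * (w * w^-1) + 'i * 'i * (z * w) ^+ 2 by ring.
  by rewrite i2 divff //; ring.
exists (nrm (expC (- (piC R * (z * w) ^+ 2)) * w) * (K * 1%:R ^+ 2)).
  by rewrite mulr_ge0 ?nrm_ge0 // mulr_ge0.
move=> k; rewrite E nrmM -[_ * _ * bd R k]mulrA; apply: ler_wpM2l; first exact: nrm_ge0.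
exact: (zdom_node 0 KP).
Qed.

(** Completing the square absorbs the character into the Gaussian: the offset moves by
    ['i * k%:~R / w] and the constant left over is [poisson_term k]. By [riemann_gauss_rate] the
    offset is forgotten in the limit. *)
Lemma fourier_ampE N k :
  fourier_amp w (w * z) N k =
  poisson_term k * riemann_gauss w (w * z + 'i * k%:~R / w) N.
Proof.
have w0 := cone_neq0 hw.
have [K K0 KP] := gaussG_bounded (w * z + 'i * k%:~R / w) (cone_sqr_gt0 hw).
rewrite /fourier_amp /riemann_gauss mulrCA; congr (_ * _).
rewrite -(zsumZ _ (zdom_node N KP)); apply: eq_zsum => n.
rewrite /gaussG mulrCA [RHS]mulrCA; congr (_ * _).
rewrite /gaussE /wave /poisson_term -!expCD; congr expC; rewrite node_complex.
have i2 : 'i * 'i = -1 :> C by rewrite -expr2 sqrCi.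
have -> : k%:~R * n%:~R / N.+1%:R = k%:~R * (n%:~R / N.+1%:R) :> C by rewrite mulrA.
move: (n%:~R / N.+1%:R) => y.
have -> : (w * y + (w * z + 'i * k%:~R / w)) ^+ 2 =
   (w * y + w * z) ^+ 2 + 2 * 'i * k%:~R * (y + z) * (w * w^-1)
   + ('i * 'i) * (k%:~R / w) ^+ 2 by ring.
by rewrite i2 divff //; ring.
Qed.

Lemma fourier_amp_lim k : tends (fun M =>
  fourier_amp w (w * z) M.*2 k - poisson_term k * riemann_gauss 1 0 M.*2) 0.
Proof.
have [K [N0 KP]] := riemann_gauss_rate (w * z + 'i * k%:~R / w) hw.
rewrite -[X in tends _ X](mulr0 (poisson_term k)).
apply: (@eq_tends R (fun M => poisson_term k *
   (riemann_gauss w (w * z + 'i * k%:~R / w) M.*2 - riemann_gauss 1 0 M.*2))).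
  by move=> M; rewrite fourier_ampE mulrBr.
apply: tendsZ => e e0; have [N1 N1P] := div_natS_lt K e0.
exists (maxn N0 N1) => N; rewrite geq_max => /andP[n0 n1]; rewrite subr0.
apply: le_lt_trans (KP _ _) (N1P _ _); lia.
Qed.

Lemma gaussG_shift (a b : C) y d : gaussG a (b + cst_ d * a) y = gaussG a b (y + d).
Proof.
rewrite /gaussG; congr (_ * gaussE _).
have -> : cst_ (y + d) = cst_ y + cst_ d by apply: Cplx_ext; rewrite /= ?addr0.
by ring.
Qed.

(** Summation by parts, twice: the eigenvalue of [wave_freq] is traded for a second difference of
    the Gaussian. *)
Lemma fourier_amp_second_difference N k :
  (wave R N k 1 + (wave R N k 1)^-1 - 2) * fourier_amp w (w * z) N k =
  N.+1%:R^-1 * zsum (fun n => wave R N k n *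
    (gaussG w (w * z) (n%:~R / N.+1%:R - N.+1%:R^-1)
     - gaussG w (w * z) (n%:~R / N.+1%:R)
     - (gaussG w (w * z) (n%:~R / N.+1%:R)
        - gaussG w (w * z) (n%:~R / N.+1%:R + N.+1%:R^-1)))).
Proof.
pose d := N.+1%:R^-1 : R; set b := w * z.
have [K0 _ KP0] := gaussG_bounded b (cone_sqr_gt0 hw).
have [K1 _ KP1] := gaussG_bounded (b + cst_ d * w) (cone_sqr_gt0 hw).
have [K2 _ KP2] := gaussG_bounded (b + cst_ (- d) * w) (cone_sqr_gt0 hw).
have z0 := zdom_unit_mul (nrm_wave R N k) (zdom_node N KP0).
have z1 := zdom_unit_mul (nrm_wave R N k) (zdom_node N KP1).
have z2 := zdom_unit_mul (nrm_wave R N k) (zdom_node N KP2).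
set S0 := (fun n => _) in z0; set S1 := (fun n => _) in z1; set S2 := (fun n => _) in z2.
have W0 : wave R N k 1 != 0.
  by apply/eqP => e; have := nrm_wave R N k 1; rewrite e nrm0 => /eqP; rewrite eq_sym oner_eq0.
have nodeS n : (n + 1)%:~R / N.+1%:R = n%:~R / N.+1%:R + d :> R.
  by rewrite intrD mulrDl mul1r.
have e1 : wave R N k 1 * zsum S1 = zsum S0.
  rewrite -(zsumZ _ z1) -(zsum_shift z0); apply: eq_zsum => n.
  by rewrite /S1 /S0 wave_add mulrC nodeS gaussG_shift [wave R N k n * wave _ _ _ _]mulrC; ring.
have e2 : wave R N k 1 * zsum S0 = zsum S2.
  rewrite -(zsumZ _ z0) -(zsum_shift z2); apply: eq_zsum => n.
  by rewrite /S2 /S0 wave_add nodeS gaussG_shift addrK [wave R N k n * wave _ _ _ _]mulrC mulrA.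
have e1' : zsum S1 = (wave R N k 1)^-1 * zsum S0 by rewrite -e1 mulKf.
rewrite /fourier_amp -/b mulrCA; congr (_ * _).
have zB (f g : int -> C) Kf Kg : zdom f Kf -> zdom g Kg -> zdom (fun m => f m - g m) (Kf + Kg).
  by move=> h1 h2 m; apply: le_trans (nrmB _ _) _; rewrite mulrDl lerD.
transitivity (zsum (fun n => S2 n - S0 n - (S0 n - S1 n))).
  rewrite (zsumB (zB _ _ _ _ z2 z0) (zB _ _ _ _ z0 z1)).
  rewrite (zsumB z2 z0) (zsumB z0 z1) -e2 e1' -/S0.
  by move: (zsum S0) (wave R N k 1)^-1 (wave R N k 1) => s x y; ring.
apply: eq_zsum => n; rewrite /S0 /S1 /S2 !gaussG_shift -/d.
by rewrite !mulrBr.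
Qed.

(** The second difference of the samples is of order [d ^ 2]; dividing by the eigenvalue, at least
    [(|k| d) ^ 2], leaves a bound uniform in [M]. *)
Lemma fourier_amp_decay : exists K : R, exists N1 : nat, 0 <= K /\
  forall M k, (N1 <= M)%N -> (`|k| <= M)%N ->
  nrm (fourier_amp w (w * z) M.*2 k) <= K * bd R k.
Proof.
set b := w * z; have c0 := cone_sqr_gt0 hw.
have [KG KG0 KGP] := gaussG_bounded b c0.
pose A := 1 + nrm w + nrm b.
have A1 : 1 <= A by rewrite /A; have := nrm_ge0 w; have := nrm_ge0 b; lra.
have wA : nrm w <= A by rewrite /A; have := nrm_ge0 b; lra.
have bA : nrm b <= A by rewrite /A; have := nrm_ge0 w; lra.
have [K [d0 [K0 d00 step]]] := gauss_step_le A1 c0.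
have [N1 N1P] := @div_natS_lt R 1 d0 d00.
(* [3 * KG] serves [k = 0]. In 12, the 3 comes from the sum over the grid and the 4 from
   [(1 + |k|) ^ 2 <= 4 |k| ^ 2]. *)
exists (Num.max (3 * KG) (12 * K)), N1; split; first by rewrite le_max mulr_ge0.
move=> M k NM kM; have Nn0 : M.*2.+1%:R != 0 :> R by rewrite pnatr_eq0.
have NC : nrm (M.*2.+1%:R^-1 : C) = M.*2.+1%:R^-1 by rewrite nrmV nrm_nat.
have N0 : 0 < M.*2.+1%:R^-1 :> R by rewrite invr_gt0 ltr0n.
have [->|k0] := eqVneq k 0.
  rewrite bd0 mulr1 le_max; apply/orP; left; rewrite /fourier_amp nrmM NC.
  have z0 := zsum_node_le M.*2 KGP.
  under eq_zsum do rewrite wave0 mul1r.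
  apply: le_trans (ler_wpM2l (ltW N0) z0) _.
  by rewrite mulrC mulfK.
pose d := M.*2.+1%:R^-1 : R.
have d0' : 0 <= d := ltW N0.
have d1 : d <= 1 by rewrite invf_le1 ?ltr0n // ler1n.
have dd0 : d <= d0.
  have MM : (N1 <= M.*2)%N by rewrite -addnn (leq_trans NM) ?leq_addr.
  by have := N1P M.*2 MM; rewrite mul1r => /ltW.
have D2 y : nrm (gaussG w b (y - d) - gaussG w b y - (gaussG w b y - gaussG w b (y + d)))
    <= K * d ^+ 2 * ((1 + `|y|)^-1) ^+ 2.
  have n0A : nrm (0 : C) <= A by rewrite nrm0 (le_trans ler01).
  have nwA : nrm (- w) <= A by rewrite nrmN.
  (* In the direction [(0, - w)] a step translates [gaussG] by [- d], and [gaussH] is [- gaussG]: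
     the step bound becomes a bound on the second difference. *)
  have := step w b 0 (- w) y d wA bA n0A nwA (lexx _) d0' dd0 d1.
  have -> : gaussG (w + cst_ d * 0) (b + cst_ d * - w) y = gaussG w b (y - d).
    by rewrite mulr0 addr0 mulrN -mulNr -realN gaussG_shift.
  have gH x : gaussH w b 0 (- w) x = - gaussG w b x.
    by rewrite /gaussH /gaussG mul0r add0r mulNr.
  by rewrite !gH opprK [- gaussG w b (y + d) + _]addrC.
have D2n n : nrm (wave R M.*2 k n *
    (gaussG w b (n%:~R / M.*2.+1%:R - d) - gaussG w b (n%:~R / M.*2.+1%:R)
     - (gaussG w b (n%:~R / M.*2.+1%:R) - gaussG w b (n%:~R / M.*2.+1%:R + d))))
    <= K * d ^+ 2 * ((1 + `|n%:~R / M.*2.+1%:R|)^-1) ^+ 2.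
  by rewrite nrmM nrm_wave mul1r; exact: D2.
have Kd0 : 0 <= K * d ^+ 2 by rewrite mulr_ge0 ?sqr_ge0 // ltW.
have z2 := zsum_grid_le Kd0 D2n.
have sd := fourier_amp_second_difference M.*2 k.
have fl := nrm_wave_freq_ge R kM.
have main : (`|k|%:R * d) ^+ 2 * nrm (fourier_amp w b M.*2 k) <= 3 * K * d ^+ 2.
  apply: le_trans (ler_wpM2r (nrm_ge0 _) fl) _.
  rewrite -nrmM sd nrmM NC -/b.
  apply: le_trans (ler_wpM2l d0' z2) _.
  have -> : d * (3 * (K * d ^+ 2) * M.*2.+1%:R) = 3 * K * d ^+ 2 * (d * M.*2.+1%:R) by ring.
  by rewrite mulVf ?mulr1.
have dd : 0 < d ^+ 2 by rewrite exprn_gt0.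
have {}main : `|k|%:R ^+ 2 * nrm (fourier_amp w b M.*2 k) <= 3 * K.
  rewrite -(ler_pM2r dd); apply: le_trans main.
  by rewrite exprMn mulrAC.
have k1 : 1 <= `|k|%:R :> R by rewrite ler1n absz_gt0.
apply: (@le_trans _ _ (12 * K * bd R k)); last first.
  by apply: ler_wpM2r; rewrite ?bd_ge0 // le_max lexx orbT.
have kp : 0 < (1 + `|k|%:R) ^+ 2 :> R by rewrite exprn_gt0 //; lra.
rewrite /bd exprVn ler_pdivlMr //.
apply: (@le_trans _ _ (4 * (`|k|%:R ^+ 2 * nrm (fourier_amp w b M.*2 k)))); last by lra.
rewrite mulrC mulrA; apply: ler_wpM2r; first exact: nrm_ge0.
by nra.
Qed.

(** Summed over a full period, the amplitudes give the samples at the integers for every [M]. By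
    [tannery] they may be replaced by their Poisson terms times a Riemann sum, which is evaluated
    only afterwards. *)
Lemma gauss_sum_poisson : tends (fun M =>
  zsum (fun m => gaussG w (w * z) m%:~R) - zsum poisson_term * riemann_gauss 1 0 M.*2) 0.
Proof.
set b := w * z.
have [KG KG0 KGP] := gaussG_bounded b (cone_sqr_gt0 hw).
have [KD [N1 [KD0 KDP]]] := fourier_amp_decay; rewrite -/b in KDP.
have [KP KP0 KPP] := zdom_poisson_term.
have one_cone : 0 < complex.Re ((1 : C) ^+ 2) by rewrite expr1n.
have [K1 K10 K1P] := gaussG_bounded 0 one_cone.
have L_le N : nrm (riemann_gauss 1 0 N) <= 3 * K1.
  rewrite /riemann_gauss nrmM nrmV nrm_nat.
  have i0 : 0 <= N.+1%:R^-1 :> R by rewrite invr_ge0.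
  apply: le_trans (ler_wpM2l i0 (zsum_node_le N K1P)) _.
  by rewrite mulrC mulfK // pnatr_eq0.
pose F M k := fourier_amp w b M.*2 k - poisson_term k * riemann_gauss 1 0 M.*2.
have FK M m : (N1 <= M)%N -> (`|m| <= M)%N -> nrm (F M m) <= (KD + KP * (3 * K1)) * bd R m.
  move=> NM mM; apply: le_trans (nrmB _ _) _; rewrite mulrDl; apply: lerD.
    exact: KDP.
  have -> : KP * (3 * K1) * bd R m = KP * bd R m * (3 * K1) by ring.
  rewrite nrmM; apply: ler_pM; [exact: nrm_ge0 | exact: nrm_ge0 | exact: KPP |].
  exact: L_le.
have K0 : 0 <= KD + KP * (3 * K1) by rewrite addr_ge0 // !mulr_ge0.
have T := tannery K0 FK fourier_amp_lim.
(* Orthogonality keeps only the nodes whose index is a multiple of the grid size, that is, the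
   integers. *)
have ampsum M : psum (fun k => fourier_amp w b M.*2 k) M
    = zsum (fun m => gaussG w b m%:~R).
  have zk k : zdom (fun n => wave R M.*2 k n * gaussG w b (n%:~R / M.*2.+1%:R)) (KG * M.*2.+1%:R ^+ 2).
    by apply: zdom_unit_mul; [exact: nrm_wave | exact: zdom_node].
  have [K' zK' eK'] := zdom_sum M zk.
  rewrite /fourier_amp psumZ eK' -(zsumZ _ zK').
  set f := (fun n => _ * _).
  have fE n : f n = if (M.*2.+1 %| `|n|)%N then gaussG w b (n%:~R / M.*2.+1%:R) else 0.
    rewrite /f; have -> : psum (fun k => wave R M.*2 k n * gaussG w b (n%:~R / M.*2.+1%:R)) M
       = psum (fun k => wave R M.*2 k n) M * gaussG w b (n%:~R / M.*2.+1%:R).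
      by rewrite /psum mulr_suml.
    rewrite psum_wave; case: ifP => _; last by rewrite mul0r mulr0.
    by rewrite mulKf // pnatr_eq0.
  have zf := zdomZ (M.*2.+1%:R^-1) zK'.
  have zm := @zsum_multiples R f _ M.*2.+1 isT zf.
  have fm m : f (M.*2.+1%:Z * m) = gaussG w b m%:~R.
    rewrite fE abszM absz_nat dvdn_mulr // intrM mulrC mulKf //.
  have t1 : tends (psum (fun m => gaussG w b m%:~R)) (zsum f).
    have <- : (fun m => f (M.*2.+1%:Z * m)) = (fun m => gaussG w b m%:~R).
      by apply/funext => m; rewrite fm.
    by apply: zm => m; rewrite fE => /negbTE ->.
  by rewrite [RHS](tends_lim t1).
(* Since the Riemann sums are bounded, the partial sum of the Poisson terms may be replaced by the
   full one. *)
have U : tends (fun M => zsum poisson_term * riemann_gauss 1 0 M.*2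
    - psum poisson_term M * riemann_gauss 1 0 M.*2) 0.
  move=> e e0; have K1p : 0 < 3 * K1 + 1 by lra.
  have [N0 N0P] := zsum_tends KPP (divr_gt0 e0 K1p).
  exists N0 => N NN; rewrite subr0 -mulrBl nrmM nrm_distC.
  have := N0P N NN; rewrite ltr_pdivlMr // => h.
  apply: le_lt_trans h; apply: ler_wpM2l; first exact: nrm_ge0.
  by apply: le_trans (L_le _) _; rewrite lerDl.
have V := tendsD T (tendsZ (-1) U); rewrite mulr0 addr0 in V.
apply: eq_tends V => M; rewrite /F psumD psumN ampsum.
have -> : psum (fun k => poisson_term k * riemann_gauss 1 0 M.*2) M
   = psum poisson_term M * riemann_gauss 1 0 M.*2 by rewrite /psum mulr_suml.
by ring.
Qed.

End PoissonLimit.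

(** At [w = 1], [z = 0] both sides of [gauss_sum_poisson] contain the same series [S], so
    [S * (1 - riemann_gauss 1 0 M.*2)] tends to 0 and [S] is divided out. *)
Lemma riemann_gauss_lim : tends (fun M => riemann_gauss (1 : C) 0 M.*2) 1.
Proof.
have h1 : `|complex.Im (1 : C)| < complex.Re (1 : C) by rewrite /= normr0.
have T := @gauss_sum_poisson 1 0 h1.
have [KP KP0 KPP] := @zdom_poisson_term 1 0 h1.
have E : (fun m : int => gaussG (1 : C) (1 * 0) m%:~R) = poisson_term 1 0.
  apply/funext => m; rewrite /gaussG /gaussE /poisson_term !mul1r !mulr0 add0r addr0 divr1.
  by rewrite -intr_complex mulNr.
rewrite E in T; set S := zsum _ in T.
(* All terms have nonnegative real part, and the central one is 1. *)
have S0 : S != 0.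
  apply/eqP => S0.
  have [N0 /(_ N0 (leqnn _))] := zsum_tends KPP ltr01.
  rewrite -/S S0 subr0; apply/negP; rewrite -leNgt.
  apply: le_trans _ (normr_Re_le _); apply: le_trans _ (ler_norm _).
  have P m : 0 <= complex.Re (poisson_term 1 0 m).
    rewrite /poisson_term mulr0 add0r divr1 Re_expC mulr_ge0 ?expR_ge0 //.
    have -> : complex.Im (- (piC R * m%:~R ^+ 2)) = 0.
      by rewrite intr_complex Im_opp expr2 -realM Im_mul /= mulr0 mul0r addr0 oppr0.
    by rewrite cos0.
  have P0 : complex.Re (poisson_term 1 0 0) = 1.
    by rewrite /poisson_term mulr0 mul0r expr2 mulr0 mulr0 subr0 expC0.
  elim: N0 => [|n IH]; first by rewrite psum0 P0.
  by rewrite psumS !Re_add; have := P n.+1%:Z; have := P (- n.+1%:Z); lra.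
have := tendsD (tendsZ (- S^-1) T) (@tends_cst R 1); rewrite mulr0 add0r.
by apply: eq_tends => M; rewrite mulrBr !mulNr mulVf // mulKf // opprK addrC addrA subrr add0r.
Qed.

Lemma jacobi_gauss (w z : C) : `|complex.Im w| < complex.Re w ->
  zsum (fun m => gaussG w (w * z) m%:~R) = zsum (poisson_term w z).
Proof.
move=> hw; have T := @gauss_sum_poisson w z hw.
have T2 := tendsD T (tendsZ (zsum (poisson_term w z)) riemann_gauss_lim).
rewrite mulr1 add0r in T2.
apply: (tends_unique (tends_cst _)); apply: eq_tends T2 => M.
by rewrite subrK.
Qed.

End Jacobi.

(** * Derivatives of theta functions *)

Section ExpSeries.
Variable R : realType.
Local Notation C := (Cplx R).
Local Notation cst_ x := ((x : R)%:C)%C.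
Local Notation Y m := (1 + `|m|%:R : R).

Lemma bdE (m : int) : bd R m = ((Y m)^-1) ^+ 2.
Proof. by []. Qed.

Lemma Y_ge1 (m : int) : 1 <= Y m.
Proof. by rewrite lerDl. Qed.

Lemma expX_gauss_le (k : R) (j : nat) : 0 < k -> exists2 K, 0 <= K &
  forall m : int, Y m ^+ j * expR (- (k * Y m ^+ 2)) <= K * bd R m.
Proof.
move=> k0; pose n := j.+2.
exists ((n.+1)`!%:R / k ^+ n.+1).
  by rewrite divr_ge0 // exprn_ge0 // ltW.
move=> m; rewrite bdE; have := Y_ge1 m; move: (Y m) => y y1.
have y0 : 0 < y by lra.
have x0 : 0 < k * y ^+ 2 by rewrite mulr_gt0 // exprn_gt0.
have h := @expR_ge1Dxn R (k * y ^+ 2) n (ltW x0).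
have f0 : 0 < (n.+1)`!%:R :> R by rewrite ltr0n fact_gt0.
have h1 : (k * y ^+ 2) ^+ n.+1 / (n.+1)`!%:R <= expR (k * y ^+ 2).
  by apply: le_trans h; rewrite lerDr.
rewrite ler_pdivrMr // in h1.
have p := expR_gt0 (- (k * y ^+ 2)).
have e : expR (k * y ^+ 2) * expR (- (k * y ^+ 2)) = 1 by rewrite -expRD subrr expR0.
have h2 : (k * y ^+ 2) ^+ n.+1 * expR (- (k * y ^+ 2)) <= (n.+1)`!%:R.
  by have := ler_wpM2r (ltW p) h1; rewrite [_ * _`!%:R * _]mulrAC e mul1r.
have kn : 0 < k ^+ n.+1 by rewrite exprn_gt0.
have y2 : 0 < y ^+ 2 by rewrite exprn_gt0.
have -> : (n.+1)`!%:R / k ^+ n.+1 * y^-1 ^+ 2 = (n.+1)`!%:R / (k ^+ n.+1 * y ^+ 2).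
  by rewrite exprVn -mulrA -invfM.
have kp : 0 < k ^+ n.+1 * y ^+ 2 by exact: mulr_gt0.
rewrite ler_pdivlMr //; apply: (le_trans _ h2).
rewrite exprMn -exprM mulrC mulrA; apply: ler_wpM2r; first exact: ltW.
rewrite -mulrA; apply: ler_wpM2l; first exact: ltW.
by rewrite -exprD ler_weXn2l // /n; lia.
Qed.

(** The rate is [2 * k] so that half of it survives multiplication by [expC (l m * h)], for [l m] of
    quadratic growth and small [h]. *)
Definition gdom (c : int -> C) (k : R) (j : nat) (K : R) : Prop :=
  forall m, nrm (c m) <= K * (Y m ^+ j * expR (- (2 * k * Y m ^+ 2))).

Lemma gdom_ge0 c k j K : gdom c k j K -> 0 <= K.
Proof.
move=> /(_ 0); rewrite absz0 addr0 expr1n mul1r => h.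
have := le_trans (nrm_ge0 _) h; rewrite pmulr_lge0 // expR_gt0.
by [].
Qed.

Lemma gdom_zdom c k j K : 0 < k -> gdom c k j K -> exists K', zdom c K'.
Proof.
move=> k0 cK; have [K' K'0 K'P] := expX_gauss_le j k0.
have K0 := gdom_ge0 cK.
exists (K * K') => m; apply: le_trans (cK m) _; rewrite -[K * K' * _]mulrA.
apply: ler_wpM2l => //; apply: le_trans (K'P m).
apply: ler_wpM2l; first by rewrite exprn_ge0.
rewrite ler_expR lerN2; apply: ler_wpM2r; first exact: sqr_ge0.
by lra.
Qed.

Lemma gdomM c k j K (l : int -> C) (i : nat) (B : R) : gdom c k j K -> 0 <= B ->
  (forall m, nrm (l m) <= B * Y m ^+ i) ->
  gdom (fun m => l m * c m) k (j + i) (B * K).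
Proof.
move=> cK B0 lB m; rewrite nrmM.
apply: le_trans (ler_pM (nrm_ge0 _) (nrm_ge0 _) (lB m) (cK m)) _.
by rewrite exprD le_eqVlt; apply/orP; left; apply/eqP; ring.
Qed.

(** Termwise differentiation with a quadratic remainder, from [nrm_expC_sub_le] in each term. For
    [nrm h <= k / B] the exponential growth in [m] is at most [expR (k * Y m ^+ 2)]. *)
Lemma zsum_exp_remainder (c l : int -> C) (k : R) (j : nat) (K B : R) :
  0 < k -> 0 < B -> gdom c k j K -> (forall m, nrm (l m) <= B * Y m ^+ 2) ->
  exists d M : R, [/\ 0 < d, 0 <= M & forall h : C, nrm h <= d ->
    nrm (zsum (fun m => c m * expC (l m * h)) - zsum c
         - h * zsum (fun m => l m * c m)) <= M * nrm h ^+ 2].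
Proof.
move=> k0 B0 cK lB; have K0 := gdom_ge0 cK.
have [K4 K40 K4P] := expX_gauss_le (j + 4) k0.
have [Kc zc] := gdom_zdom k0 cK.
have [Kl zl] := gdom_zdom k0 (gdomM cK (ltW B0) lB).
exists (k / B), (3 * (K * (4 * B ^+ 2) * K4)); split.
- exact: divr_gt0.
- by rewrite !mulr_ge0 ?exprn_ge0 // ltW.
move=> h hd; pose r m := c m * (expC (l m * h) - 1 - l m * h).
have zr : zdom r (K * (4 * B ^+ 2) * K4 * nrm h ^+ 2).
  move=> m; rewrite /r nrmM.
  have x1 : nrm (l m * h) <= B * Y m ^+ 2 * nrm h.
    by rewrite nrmM ler_wpM2r ?nrm_ge0.
  have x2 : nrm (l m * h) <= k * Y m ^+ 2.
    apply: le_trans x1 _; rewrite mulrAC ler_wpM2r ?sqr_ge0 //.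
    by move: hd; rewrite ler_pdivlMr // mulrC.
  have e1 : expR (nrm (l m * h)) <= expR (k * Y m ^+ 2) by rewrite ler_expR.
  have e2 : nrm (l m * h) ^+ 2 <= (B * Y m ^+ 2 * nrm h) ^+ 2.
    by apply: lerXn2r; rewrite ?nnegrE ?nrm_ge0 // (le_trans _ x1) ?nrm_ge0.
  have e3 := nrm_expC_sub_le (l m * h).
  have e4 : nrm (expC (l m * h) - 1 - l m * h)
      <= 4 * (B * Y m ^+ 2 * nrm h) ^+ 2 * expR (k * Y m ^+ 2).
    apply: le_trans e3 _; apply: ler_pM; rewrite ?expR_ge0 ?mulr_ge0 ?nrm_ge0 //.
    exact: ler_wpM2l.
  apply: le_trans (ler_pM (nrm_ge0 _) (nrm_ge0 _) (cK m) e4) _.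
  have -> : K * (Y m ^+ j * expR (- (2 * k * Y m ^+ 2))) *
      (4 * (B * Y m ^+ 2 * nrm h) ^+ 2 * expR (k * Y m ^+ 2)) =
    K * (4 * B ^+ 2) * nrm h ^+ 2 *
      (Y m ^+ j * Y m ^+ 4 * (expR (- (2 * k * Y m ^+ 2)) * expR (k * Y m ^+ 2))).
    by set a := expR (- _); set b := expR (k * _); set yj := Y m ^+ j; ring.
  rewrite -expRD.
  have -> : - (2 * k * Y m ^+ 2) + k * Y m ^+ 2 = - (k * Y m ^+ 2) by ring.
  rewrite -exprD; have -> : K * (4 * B ^+ 2) * K4 * nrm h ^+ 2 * bd R m =
    K * (4 * B ^+ 2) * nrm h ^+ 2 * (K4 * bd R m) by ring.
  by apply: ler_wpM2l (K4P m); rewrite !mulr_ge0 ?nrm_ge0 // ltW.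
have zlh : zdom (fun m => h * (l m * c m)) (nrm h * Kl) := zdomZ h zl.
have E : zsum (fun m => c m * expC (l m * h)) =
    zsum c + h * zsum (fun m => l m * c m) + zsum r.
  rewrite -(zsumZ h zl) -(zsumD zc zlh) -(zsumD (zdomD zc zlh) zr).
  by apply: eq_zsum => m; rewrite /r; ring.
rewrite E; have -> : zsum c + h * zsum (fun m => l m * c m) + zsum r - zsum c
   - h * zsum (fun m => l m * c m) = zsum r by ring.
by apply: le_trans (nrm_zsum_le zr) _; rewrite -!mulrA.
Qed.

Lemma is_derive_remainder (f : C -> C) (x l : C) (d M : R) : 0 < d -> 0 <= M ->
  (forall h, nrm h <= d -> nrm (f (x + h) - f x - h * l) <= M * nrm h ^+ 2) ->
  is_derive x 1 f l.
Proof.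
move=> d0 M0 fP.
have cv : h^-1 *: ((f \o shift x) (h *: 1) - f x) @[h --> (0 : C)^'] --> l.
  apply/cvgrPdist_lt => e e0.
  have eE : e = cst_ (complex.Re e).
    by move: e0; case: (e : C) => a b; rewrite ltcE /= => /andP[/eqP -> _].
  move: e0; rewrite eE -[0]/(cst_ 0) ltcR; move: (complex.Re e) => {eE}e e0.
  pose dd := Num.min d (e / (M + 1)).
  have dd0 : 0 < dd by rewrite lt_min d0 divr_gt0 //; lra.
  apply/nbhs_ballP; exists (cst_ dd) => /=; first by rewrite -[0]/(cst_ 0) ltcR.
  move=> h; rewrite /ball /= sub0r normrN normr_nrm ltcR => hd h0.
  have hne : h != 0 := h0.
  have hd1 : nrm h <= d by apply: ltW; apply: lt_le_trans hd _; rewrite ge_min lexx.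
  have hd2 : nrm h < e / (M + 1) by apply: lt_le_trans hd _; rewrite ge_min lexx orbT.
  rewrite distrC normr_nrm ltcR.
  have -> : h^-1 *: (f (h *: 1 + x) - f x) - l = h^-1 * (f (x + h) - f x - h * l).
    rewrite [h *: 1]mulr1 addrC -[_ *: _]/(h^-1 * _) [RHS]mulrBr mulKf //.
    by rewrite addrC [h + x]addrC.
  rewrite nrmM nrmV ltr_pdivrMl ?nrm_gt0 //.
  apply: le_lt_trans (fP h hd1) _; 
  have -> : M * nrm h ^+ 2 = nrm h * (M * nrm h) by ring.
  rewrite ltr_pM2l ?nrm_gt0 //.
  move: hd2; rewrite ltr_pdivlMr; last by lra.
  by have := nrm_ge0 h; nra.
split; first by apply/cvg_ex; exists l.
by apply: cvg_lim cv; exact: norm_hausdorff.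
Qed.

End ExpSeries.

Section ThetaMoments.
Variable R : realType.
Local Notation C := (Cplx R).
Local Notation cst_ x := ((x : R)%:C)%C.
Local Notation Y m := (1 + `|m|%:R : R).

Lemma thetaE (p q t : C) : theta p q t = zsum (theta_term p q t).
Proof. by []. Qed.

(** This family is closed under differentiation: [q] raises [j] by 1 and [t] raises it by 2, up to
    constants. *)
Definition theta_moment (j : nat) (p q t : C) : C :=
  zsum (fun m => (m%:~R + p) ^+ j * theta_term p q t m).

Lemma theta_moment0 p q t : theta_moment 0 p q t = theta p q t.
Proof. by rewrite thetaE; apply: eq_zsum => m; rewrite expr0 mul1r. Qed.

Lemma nrm_node_le (p : C) (m : int) : nrm (m%:~R + p) <= (1 + nrm p) * Y m.
Proof.
apply: le_trans (nrmD _ _) _; rewrite nrm_int -intr_norm -abszE.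
have := nrm_ge0 p; have : 0 <= `|m|%:R :> R by []; nra.
Qed.

Lemma theta_term_gdom (p q t : C) : 0 < complex.Re t ->
  exists k K : R, 0 < k /\ gdom (theta_term p q t) k 0 K.
Proof.
move=> t0; pose c := complex.Re t; pose P := 1 + nrm p.
pose k := pi * c / 4 : R.
have pi0 : 0 < pi :> R := pi_gt0 R.
have k0 : 0 < k by rewrite /k divr_gt0 // mulr_gt0.
have P1 : 1 <= P by rewrite lerDl nrm_ge0.
(* Re (- pi (m+p)^2 t + 2 pi i (m+p) q) <= - pi c m^2 + L (1 + |m|) *)
pose L := pi * (2 * nrm p * nrm t + nrm p ^+ 2 * nrm t) + 2 * pi * P * nrm q.
(* With [y = 1 + |m|], the term [- 4 k (y - 1) ^ 2] adds [8 k = 2 pi c] to the linear coefficient.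
   The square of [4 k y - U], divided by [8 k], then leaves the rate [2 * k]. *)
pose U := L + 2 * pi * c.
exists k, (expR (U ^+ 2 / (8 * k) )); split => //= m.
rewrite expr0 mul1r -expRD /theta_term nrm_expC ler_expR Re_add.
have y1 := Y_ge1 R m.
have h1 : complex.Re (2 * piC R * 'i * (m%:~R + p) * q) <= 2 * pi * P * nrm q * Y m.
  apply: le_trans (ler_norm _) _; apply: le_trans (normr_Re_le _) _.
  rewrite !nrmM nrm_i mulr1 nrm_nat nrm_pi.
  have := ler_wpM2r (nrm_ge0 q) (nrm_node_le p m); rewrite -/P => h.
  have h' := ler_wpM2l (ltW (mulr_gt0 (ltr0n _ 2) pi0) : 0 <= 2 * pi) h.
  by move: h'; rewrite !mulrA; lra.
have h2 : complex.Re (- piC R * (m%:~R + p) ^+ 2 * t) <=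
    - (pi * c * `|m|%:R ^+ 2) + pi * (2 * nrm p * nrm t + nrm p ^+ 2 * nrm t) * Y m.
  have -> : - piC R * (m%:~R + p) ^+ 2 * t = - (piC R * ((m%:~R ^+ 2) * t))
     + - (piC R * (2 * m%:~R * p * t + p ^+ 2 * t)) by ring.
  rewrite Re_add; apply: lerD.
    rewrite intr_complex expr2 -realM Re_opp !Re_realM lerN2 -/c.
    by rewrite -expr2 -[m%:~R ^+ 2]real_normK ?num_real // -intr_norm -abszE mulrAC mulrA mulrAC.
  rewrite Re_opp Re_realM -mulrN -[X in _ <= X]mulrA; apply: ler_wpM2l; first exact: ltW.
  apply: le_trans (ler_norm _) _; rewrite normrN; apply: le_trans (normr_Re_le _) _.
  apply: le_trans (nrmD _ _) _; rewrite !nrmM nrm_nat nrm_int -intr_norm -abszE -expr2.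
  have a1 : 0 <= nrm p * nrm t by rewrite mulr_ge0 ?nrm_ge0.
  have a2 : 0 <= nrm p ^+ 2 * nrm t by rewrite mulr_ge0 ?nrm_ge0 ?sqr_ge0.
  have a3 : 0 <= `|m|%:R :> R by [].
  by nra.
apply: le_trans (lerD h2 h1) _.
have [y yE] : exists y, y = Y m by exists (Y m).
have mE : `|m|%:R = y - 1 by rewrite yE addrC addKr.
rewrite -yE in y1 *; rewrite mE.
have pc : pi * c = 4 * k by rewrite /k; field.
have -> : - (pi * c * (y - 1) ^+ 2) + pi * (2 * nrm p * nrm t + nrm p ^+ 2 * nrm t) * y
    + 2 * pi * P * nrm q * y = - (4 * k) * y ^+ 2 + U * y - 4 * k.
  by rewrite /U /L -pc; ring.
have s : 0 <= (4 * k * y - U) ^+ 2 / (8 * k) by rewrite divr_ge0 ?sqr_ge0 //; lra.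
have e : (4 * k * y - U) ^+ 2 / (8 * k) = 2 * k * y ^+ 2 - U * y + U ^+ 2 / (8 * k).
  by field; lra.
by move: s; rewrite e; move: (U ^+ 2 / _) => V; lra.
Qed.

Lemma moment_gdom (j : nat) (p q t : C) : 0 < complex.Re t ->
  exists k K : R, 0 < k /\
  gdom (fun m => (m%:~R + p) ^+ j * theta_term p q t m) k j K.
Proof.
move=> t0; have [k [K [k0 tK]]] := theta_term_gdom p q t0.
exists k, ((1 + nrm p) ^+ j * K); split => //.
apply: (gdomM tK); first by rewrite exprn_ge0 // addr_ge0 ?nrm_ge0.
move=> m; rewrite nrmX -exprMn; apply: lerXn2r (nrm_node_le p m);
  rewrite nnegrE ?nrm_ge0 // mulr_ge0 ?addr_ge0 ?nrm_ge0 //.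
Qed.

(** The exponent of a theta term is affine in [q] and in [t], so a shift by [h] multiplies the term
    by [expC (l m * h)]; this treats both variables at once. *)
Lemma theta_moment_exp_derive (j : nat) (p q t : C) (l : int -> C) (B : R) (f : C -> C) (x : C) :
  0 < complex.Re t -> 0 < B -> (forall m, nrm (l m) <= B * Y m ^+ 2) ->
  (forall h, f (x + h) = zsum (fun m => (m%:~R + p) ^+ j * theta_term p q t m * expC (l m * h))) ->
  is_derive x 1 f (zsum (fun m => l m * ((m%:~R + p) ^+ j * theta_term p q t m))).
Proof.
move=> t0 B0 lB fE; have [k [K [k0 cK]]] := moment_gdom j p q t0.
have [d [M [d0 M0 rem]]] := zsum_exp_remainder k0 B0 cK lB.
have fx : f x = zsum (fun m => (m%:~R + p) ^+ j * theta_term p q t m).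
  by rewrite -[x]addr0 fE; apply: eq_zsum => m; rewrite mulr0 expC0 mulr1.
by apply: (is_derive_remainder d0 M0) => h hd; rewrite fE fx; exact: rem.
Qed.

Lemma is_derive_moment_q (j : nat) (p q t : C) : 0 < complex.Re t ->
  is_derive q 1 (fun q => theta_moment j p q t)
    (2 * piC R * 'i * theta_moment j.+1 p q t).
Proof.
move=> t0; pose l (m : int) : C := 2 * piC R * 'i * (m%:~R + p).
have B0 : 0 < 2 * pi * (1 + nrm p) by rewrite !mulr_gt0 ?pi_gt0 // ltr_pwDl ?nrm_ge0.
have lB m : nrm (l m) <= 2 * pi * (1 + nrm p) * Y m ^+ 2.
  rewrite /l !nrmM nrm_i nrm_nat nrm_pi mulr1 -[X in _ <= X]mulrA; apply: ler_wpM2l; first by rewrite mulr_ge0 ?pi_ge0.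
  apply: le_trans (nrm_node_le p m) _; rewrite ler_wpM2l ?addr_ge0 ?nrm_ge0 //.
  by rewrite expr2 ler_peMl // Y_ge1.
have [k [K [k0 cK]]] := moment_gdom j.+1 p q t0.
have [K' zK] := gdom_zdom k0 cK.
have -> : 2 * piC R * 'i * theta_moment j.+1 p q t =
    zsum (fun m => l m * ((m%:~R + p) ^+ j * theta_term p q t m)).
  rewrite /theta_moment -(zsumZ _ zK); apply: eq_zsum => m.
  by rewrite /l exprS; ring.
apply: (theta_moment_exp_derive t0 B0 lB) => h.
apply: eq_zsum => m; rewrite -mulrA; congr (_ * _).
by rewrite /theta_term -expCD; congr expC; rewrite /l; ring.
Qed.

Lemma is_derive_moment_t (j : nat) (p q t : C) : 0 < complex.Re t ->
  is_derive t 1 (fun t => theta_moment j p q t)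
    (- piC R * theta_moment j.+2 p q t).
Proof.
move=> t0; pose l (m : int) : C := - piC R * (m%:~R + p) ^+ 2.
have B0 : 0 < pi * (1 + nrm p) ^+ 2.
  by rewrite mulr_gt0 ?pi_gt0 // exprn_gt0 // ltr_pwDl ?nrm_ge0.
have lB m : nrm (l m) <= pi * (1 + nrm p) ^+ 2 * Y m ^+ 2.
  rewrite /l nrmM nrmN nrm_pi nrmX -[X in _ <= X]mulrA; apply: ler_wpM2l; first exact: pi_ge0.
  rewrite -exprMn.
  by apply: lerXn2r (nrm_node_le p m);
    rewrite nnegrE ?nrm_ge0 // mulr_ge0 ?addr_ge0 ?nrm_ge0.
have [k [K [k0 cK]]] := moment_gdom j.+2 p q t0.
have [K' zK] := gdom_zdom k0 cK.
have -> : - piC R * theta_moment j.+2 p q t =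
    zsum (fun m => l m * ((m%:~R + p) ^+ j * theta_term p q t m)).
  rewrite /theta_moment -(zsumZ _ zK); apply: eq_zsum => m.
  by rewrite /l !exprS expr0; ring.
apply: (theta_moment_exp_derive t0 B0 lB) => h.
apply: eq_zsum => m; rewrite -mulrA; congr (_ * _).
by rewrite /theta_term -expCD; congr expC; rewrite /l; ring.
Qed.

Lemma dtheta_moment (p q t : C) : 0 < complex.Re t ->
  dtheta p q t = 2 * piC R * 'i * theta_moment 1 p q t.
Proof.
move=> t0; rewrite /dtheta derive1E.
have -> : (fun b => theta p b t) = (fun b => theta_moment 0 p b t).
  by apply/funext => b; rewrite theta_moment0.
by have D := is_derive_moment_q 0 p q t0; rewrite derive_val.
Qed.

End ThetaMoments.

Section DeriveRules.
Variable K : numFieldType.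
Implicit Types (f g : K -> K) (x df dg : K).

Lemma is_derive_comp1 f g x df dg : is_derive x 1 f df -> is_derive (f x) 1 g dg ->
  is_derive x 1 (fun y => g (f y)) (dg * df).
Proof.
move=> [fd fE] [gd gE].
have fD : differentiable f x by apply/derivable1_diffP.
have gD : differentiable g (f x) by apply/derivable1_diffP.
have gfD := differentiable_comp fD gD.
split; first by apply/derivable1_diffP; exact: gfD.
have -> : 'D_1 (fun y => g (f y)) x = 'd g (f x) ('d f x 1).
  by rewrite (deriveE _ gfD) diff_comp.
rewrite -(deriveE (1 : K) fD) fE -(deriveE df gD) (derive_dir1 df gD) gE.
by rewrite [RHS]mulrC.
Qed.

Lemma is_derive_mul f g x df dg : is_derive x 1 f df -> is_derive x 1 g dg ->
  is_derive x 1 (fun y => f y * g y) (df * g x + f x * dg).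
Proof.
move=> hf hg; have [d e] := is_deriveM hf hg; split; first exact: d.
by rewrite [LHS]e addrC mulrC.
Qed.

Lemma is_derive_id1 x : is_derive x 1 (fun y : K => y) 1.
Proof. exact: is_derive_id. Qed.

Lemma is_derive_cst1 (c x : K) : is_derive x 1 (fun _ : K => c) 0.
Proof. exact: is_derive_cst. Qed.

Lemma is_derive_add f g x df dg : is_derive x 1 f df -> is_derive x 1 g dg ->
  is_derive x 1 (fun y => f y + g y) (df + dg).
Proof. exact: is_deriveD. Qed.

Lemma is_derive_opp f x df : is_derive x 1 f df -> is_derive x 1 (fun y => - f y) (- df).
Proof. exact: is_deriveN. Qed.

Lemma is_derive_scale (c : K) f x df : is_derive x 1 f df ->
  is_derive x 1 (fun y => c * f y) (c * df).
Proof.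
move=> hf; have := is_derive_mul (is_derive_cst1 c x) hf.
by rewrite mul0r add0r.
Qed.

Lemma is_derive_recip f x df : f x != 0 -> is_derive x 1 f df ->
  is_derive x 1 (fun y => (f y)^-1) (- (f x) ^- 2 * df).
Proof.
move=> f0 [d e]; split; first exact: derivableV.
by rewrite [LHS](deriveV f0 d) e.
Qed.

Lemma is_derive_cast f x df dg : is_derive x 1 f df -> df = dg -> is_derive x 1 f dg.
Proof. by move=> h <-. Qed.

Lemma derive1_is_derive f x df : is_derive x 1 f df -> derive1 f x = df.
Proof. by move=> h; rewrite derive1E derive_val. Qed.

End DeriveRules.

(** * Inversion of theta functions and of their derivatives in the characteristic *)

Section ThetaInversion.
Variable R : realType.
Local Notation C := (Cplx R).
Local Notation cst_ x := ((x : R)%:C)%C.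

Lemma is_derive_expC (x : C) : is_derive x 1 (@expC R) (expC x).
Proof.
apply: (@is_derive_remainder R (@expC R) x (expC x) 1 (nrm (expC x) * (4 * expR 1))) => //.
  by rewrite mulr_ge0 ?nrm_ge0 // mulr_ge0 ?expR_ge0.
move=> h h1; rewrite expCD.
have -> : expC x * expC h - expC x - h * expC x = expC x * (expC h - 1 - h) by ring.
rewrite nrmM -mulrA; apply: ler_wpM2l; first exact: nrm_ge0.
apply: le_trans (nrm_expC_sub_le h) _; rewrite -mulrA [X in _ <= X]mulrAC -mulrA.
apply: ler_wpM2l => //; apply: ler_wpM2l; first by rewrite exprn_ge0 ?nrm_ge0.
by rewrite ler_expR.
Qed.

Lemma theta_term_zdom (p q t : C) : 0 < complex.Re t ->
  exists K, zdom (theta_term p q t) K.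
Proof.
by move=> t0; have [k [K [k0 h]]] := theta_term_gdom p q t0; exact: gdom_zdom k0 h.
Qed.

(** Moves the first characteristic into the argument. Inversion turns [q] into a first
    characteristic, and [dtheta_inv] has to differentiate in it. *)
Lemma theta_quasi (p q t : C) : 0 < complex.Re t ->
  theta p q t = expC (- piC R * p ^+ 2 * t + 2 * piC R * 'i * p * q)
                * theta 0 (q + 'i * p * t) t.
Proof.
move=> t0; have [K zK] := theta_term_zdom 0 (q + 'i * p * t) t0.
rewrite !thetaE -(zsumZ _ zK); apply: eq_zsum => m.
rewrite /theta_term -expCD addr0; congr expC.
have i2 : 'i * 'i = -1 :> C by rewrite -expr2 sqrCi.
have -> : 2 * piC R * 'i * m%:~R * (q + 'i * p * t) =
  2 * piC R * 'i * m%:~R * q + 2 * piC R * m%:~R * p * t * ('i * 'i) by ring.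
by rewrite i2; ring.
Qed.

Lemma theta_addr1 (p q t : C) : 0 < complex.Re t -> theta (p + 1) q t = theta p q t.
Proof.
move=> t0; have [K zK] := theta_term_zdom p q t0.
rewrite !thetaE -(zsum_shift zK); apply: eq_zsum => m.
by rewrite /theta_term intrD [p + 1]addrC addrA.
Qed.

Lemma dtheta_addr1 (p q t : C) : 0 < complex.Re t -> dtheta (p + 1) q t = dtheta p q t.
Proof.
move=> t0; rewrite /dtheta; congr (derive1 _ q).
by apply/funext => b; exact: theta_addr1.
Qed.

(** A positive real part of [w ^ 2] means [|Im w| < |Re w|]; the sign of the root is then chosen. *)
Lemma exists_cone_sqrt (mu : C) : 0 < complex.Re mu ->
  exists w : C, w ^+ 2 = mu /\ `|complex.Im w| < complex.Re w.
Proof.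
move=> mu0; have s2 : sqrtC mu ^+ 2 = mu by rewrite sqrtCK.
have sq : complex.Im (sqrtC mu) ^+ 2 < complex.Re (sqrtC mu) ^+ 2.
  by move: mu0; rewrite -{1}s2 expr2 Re_mul -!expr2 subr_gt0.
have ab : `|complex.Im (sqrtC mu)| < `|complex.Re (sqrtC mu)|.
  by rewrite -(@ltr_pXn2r _ 2) ?nnegrE // !real_normK ?num_real.
move: s2 ab; move: (sqrtC mu) => w s2 ab.
have [w0|w0] := leP 0 (complex.Re w).
  by exists w; split => //; rewrite (ger0_norm w0) in ab.
exists (- w); split; first by rewrite sqrrN.
by rewrite Im_opp Re_opp normrN -(ltr0_norm w0).
Qed.

Lemma Re_inv_gt0 (t : C) : 0 < complex.Re t -> 0 < complex.Re t^-1.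
Proof.
case: t => a b /= a0; rewrite divr_gt0 // ltr_pwDl ?exprn_gt0 ?sqr_ge0 //.
Qed.

Lemma cone_inv (w : C) : `|complex.Im w| < complex.Re w ->
  `|complex.Im w^-1| < complex.Re w^-1.
Proof.
move=> hw; have w0 : 0 < complex.Re w := le_lt_trans (normr_ge0 _) hw.
move: hw w0; case: w => a b /= hw a0.
have d0 : 0 < a ^+ 2 + b ^+ 2 by rewrite ltr_pwDl ?exprn_gt0 ?sqr_ge0.
by rewrite ?mulNr ?normrN normrM normfV (gtr0_norm d0) ltr_pM2r ?invr_gt0.
Qed.

Lemma theta_inv (w p q : C) : `|complex.Im w| < complex.Re w ->
  theta p q (w ^+ 2)^-1 = w * expC (2 * piC R * 'i * p * q) * theta (- q) p (w ^+ 2).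
Proof.
move=> hw; have hw' := cone_inv hw; have w0 := cone_neq0 hw.
have i2 : 'i * 'i = -1 :> C by rewrite -expr2 sqrCi.
(* Chosen so that completing the square in the exponent of [theta_term] produces the Gaussian of
   parameter [w^-1] with offset [w^-1 * z]. *)
pose z := p - 'i * q * w ^+ 2.
have [K K0 KP] := gaussG_bounded (w^-1 * z) (cone_sqr_gt0 hw').
have zG : zdom (fun m => gaussG w^-1 (w^-1 * z) m%:~R) (K * 1%:R ^+ 2).
  by have := zdom_node 0 KP; congr (zdom _ _); apply/funext => m; rewrite divr1.
have [K2 zT] := theta_term_zdom (- q) p (cone_sqr_gt0 hw).
have ww : w * w^-1 = 1 by rewrite divff.
have E1 m : theta_term p q (w ^+ 2)^-1 m =
    expC (- piC R * q ^+ 2 * w ^+ 2) * w * gaussG w^-1 (w^-1 * z) m%:~R.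
  rewrite /gaussG mulrA -[_ * w * w^-1]mulrA ww mulr1 /gaussE -expCD /theta_term.
  congr expC; rewrite -intr_complex -exprVn /z.
  have -> : (w^-1 * m%:~R + w^-1 * (p - 'i * q * w ^+ 2)) ^+ 2 =
     (m%:~R + p) ^+ 2 * w^-1 ^+ 2 - 2 * 'i * (m%:~R + p) * q * (w * w^-1) ^+ 2
     + ('i * 'i) * q ^+ 2 * w ^+ 2 * (w * w^-1) ^+ 2 by ring.
  by rewrite i2 ww; ring.
have E2 k : poisson_term w^-1 z k =
    expC (2 * piC R * 'i * p * q + piC R * q ^+ 2 * w ^+ 2) * theta_term (- q) p (w ^+ 2) k.
  rewrite /poisson_term /theta_term -expCD; congr expC; rewrite invrK /z.
  have -> : 2 * piC R * 'i * k%:~R * (p - 'i * q * w ^+ 2) =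
    2 * piC R * 'i * k%:~R * p - 2 * piC R * k%:~R * q * w ^+ 2 * ('i * 'i) by ring.
  by rewrite i2; ring.
rewrite !thetaE (eq_zsum E1) (zsumZ _ zG) (jacobi_gauss z hw') (eq_zsum E2).
rewrite (zsumZ _ zT) mulrA; congr (_ * _); rewrite mulrAC -expCD mulrC; congr (_ * expC _).
by ring.
Qed.

(** Both sides are rewritten through [T], the theta function with first characteristic 0, and
    differentiated. The terms in [T] itself agree, and the derivative of the argument
    [p - 'i * mu * q] supplies the factor [- 'i * mu]. *)
Lemma dtheta_inv (w p q : C) : `|complex.Im w| < complex.Re w ->
  dtheta p q (w ^+ 2)^-1 = w * expC (2 * piC R * 'i * p * q) * (- 'i * w ^+ 2)
    * dtheta (- q) p (w ^+ 2).
Proof.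
move=> hw; have m0 := cone_sqr_gt0 hw; set mu := w ^+ 2 in m0 *.
pose T x := theta 0 x mu.
have dT (x : C) : is_derive x 1 T (dtheta 0 x mu).
  have -> : T = (fun q => theta_moment 0 0 q mu).
    by apply/funext => b; rewrite theta_moment0.
  by rewrite dtheta_moment //; exact: is_derive_moment_q.
have aff (a b x : C) : is_derive x 1 (fun y => a + b * y) b.
  apply: is_derive_cast (is_derive_add (is_derive_cst1 a x) (is_derive_scale b (is_derive_id1 x))) _.
  by rewrite add0r mulr1.
have L : is_derive q 1 (fun y => w * (expC (- piC R * mu * (y * y)) * T (p + (- 'i * mu) * y)))
   (w * (expC (- piC R * mu * (q * q)) * (- piC R * mu * (2 * q)) * T (p + (- 'i * mu) * q)
     + expC (- piC R * mu * (q * q)) * (dtheta 0 (p + (- 'i * mu) * q) mu * (- 'i * mu)))).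
  apply: is_derive_scale; apply: is_derive_mul.
    apply: (is_derive_comp1 (f := fun y => - piC R * mu * (y * y))); last exact: is_derive_expC.
    apply: is_derive_cast (is_derive_scale _ (is_derive_mul (is_derive_id1 q) (is_derive_id1 q))) _.
    by ring.
  exact: (is_derive_comp1 (f := fun y => p + (- 'i * mu) * y) (aff _ _ _) (dT _)).
have Rr : is_derive p 1 (fun y => expC (- piC R * q ^+ 2 * mu + (- (2 * piC R * 'i * q)) * y)
     * T ((- 'i * mu * q) + 1 * y))
   (expC (- piC R * q ^+ 2 * mu + (- (2 * piC R * 'i * q)) * p) * (- (2 * piC R * 'i * q))
      * T ((- 'i * mu * q) + 1 * p)
    + expC (- piC R * q ^+ 2 * mu + (- (2 * piC R * 'i * q)) * p) *
      (dtheta 0 ((- 'i * mu * q) + 1 * p) mu * 1)).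
  apply: is_derive_mul.
    exact: (is_derive_comp1 (f := fun y => - piC R * q ^+ 2 * mu + (- (2 * piC R * 'i * q)) * y)
      (aff _ _ _) (is_derive_expC _)).
  exact: (is_derive_comp1 (f := fun y => (- 'i * mu * q) + 1 * y) (aff _ _ _) (dT _)).
have eL : (fun b => theta p b mu^-1) =
    (fun y => w * (expC (- piC R * mu * (y * y)) * T (p + (- 'i * mu) * y))).
  apply/funext => y; rewrite theta_inv // -/mu theta_quasi // /T.
  rewrite mulrA -(mulrA w (expC _) (expC _)) -expCD -[w * expC _ * _]mulrA; congr (_ * _).
  congr (expC _ * theta 0 _ mu); first by ring.
  by ring.
have eR : (fun b => theta (- q) b mu) =
    (fun y => expC (- piC R * q ^+ 2 * mu + (- (2 * piC R * 'i * q)) * y)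
     * T ((- 'i * mu * q) + 1 * y)).
  apply/funext => y; rewrite theta_quasi // /T; congr (expC _ * theta 0 _ mu); by ring.
rewrite {1}/dtheta eL (derive1_is_derive L) /dtheta eR (derive1_is_derive Rr) -/(dtheta _ _ _).
have -> : (- 'i * mu * q) + 1 * p = p + (- 'i * mu) * q by ring.
have -> : expC (- piC R * mu * (q * q)) =
    expC (2 * piC R * 'i * p * q) * expC (- piC R * q ^+ 2 * mu + (- (2 * piC R * 'i * q)) * p).
  by rewrite -expCD; congr expC; ring.
have i2 : 'i * 'i = -1 :> C by rewrite -expr2 sqrCi.
set e1 := expC (2 * piC R * 'i * p * q); set e2 := expC (- piC R * q ^+ 2 * mu + _).
set T1 := T _; set D1 := dtheta 0 _ mu.
have -> : w * e1 * (- 'i * mu) * (e2 * - (2 * piC R * 'i * q) * T1 + e2 * (D1 * 1)) =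
   w * e1 * e2 * (2 * piC R * q * mu * ('i * 'i) * T1 - 'i * mu * D1) by ring.
by rewrite i2; ring.
Qed.

End ThetaInversion.

(** * Jets under inversion of the variable *)

Section HoloRules.
Variable K : numFieldType.
Implicit Types (f g : K -> K) (x : K).

(* Over Cplx R this is the notion [holo_near]. *)
Definition twice_diff_near f x : Prop :=
  \forall z \near x, differentiable f z /\ forall v, differentiable ('D_v f) z.

Lemma twice_diff_cst (c x : K) : twice_diff_near (fun=> c) x.
Proof.
apply: filterE => z; split; first exact: differentiable_cst.
move=> v; rewrite (_ : 'D_v _ = fun=> 0); first exact: differentiable_cst.
by apply/funext => y; rewrite derive_cst.
Qed.

Lemma twice_diff_mul f g x : twice_diff_near f x -> twice_diff_near g x ->
  twice_diff_near (fun t => f t * g t) x.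
Proof. exact: holo_mul_near. Qed.

Lemma twice_diff_near_eq f g x : (\forall t \near x, f t = g t) ->
  twice_diff_near f x -> twice_diff_near g x.
Proof.
move=> fg hf; have h2 : nbhs x [set z : K | (\forall t \near z, f t = g t) /\
    (differentiable f z /\ forall v, differentiable ('D_v f) z)].
  by apply: filterI; [exact: (nbhs_interior fg) | exact: hf].
apply: filterS h2 => z [fgz [df dDf]].
split; first exact: differentiable_near_eq fgz df.
move=> v; apply: differentiable_near_eq (dDf v).
by apply: filterS (nbhs_interior fgz) => y fgy; exact: near_eq_derive.
Qed.

Lemma twice_diff_recip f x : f x != 0 -> twice_diff_near f x ->
  twice_diff_near (fun t => (f t)^-1) x.
Proof.
move=> f0 hf.
have cf : {for x, continuous f}.
  by apply: differentiable_continuous; case: (nbhs_singleton hf).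
have f0' : \forall t \near x, f t != 0 by exact: (cvgr_neq0 (f x) cf f0).
have hff : nbhs x [set z : K | (differentiable f z /\ forall v, differentiable ('D_v f) z)
   /\ f z != 0] by apply: filterI.
apply: filterS (nbhs_interior hff) => z nz.
have [[df dDf] fz0] := nbhs_singleton nz.
split; first exact: differentiableV.
move=> v.
apply: (@differentiable_near_eq _ _ _ (fun z => - (f z * f z)^-1 * 'D_v f z)).
  apply: filterS nz => y [[dfy _] fy0].
  have dv : derivable f y v by exact: diff_derivable.
  rewrite (@deriveV K _ f y v fy0 dv).
  by rewrite -[f y * f y]expr2.
apply: differentiableM => //; apply: differentiableN; apply: differentiableV.
  exact: differentiableM.
by rewrite mulf_neq0.
Qed.

Lemma twice_diff_jet f x : twice_diff_near f x ->
  (\forall z \near x, is_derive (z : K) 1 f (derive1 f z)) /\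
  is_derive x 1 (derive1 f) (derive1 (derive1 f) x).
Proof.
move=> hf; have dD (g : K -> K) z : differentiable g z -> is_derive z 1 g (derive1 g z).
  move=> dg; rewrite derive1E; split => //; exact: diff_derivable.
split; first by apply: filterS hf => z [df _]; exact: dD.
apply: dD; have [_ /(_ 1)] := nbhs_singleton hf.
by rewrite (_ : 'D_1 f = derive1 f) //; apply/funext => y; rewrite derive1E.
Qed.

End HoloRules.

Section JetInversion.
Variable K : numFieldType.
Implicit Types (f g G : K -> K) (x mu : K).

(** In the variable [s = t^-1], differentiation in [t] is [- s ^ 2 d/ds]; it is applied to [G] and
    then to [- s ^ 2 E]. *)
Lemma jet_inv (G g : K -> K) (mu : K) (E : K -> K) (H' : K) : point = 0 :> K -> mu != 0 ->
  (\forall t \near mu, g t = G t^-1) ->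
  (\forall s \near mu^-1, is_derive (s : K) 1 G (E s)) ->
  is_derive mu^-1 1 (fun s => - (s * s) * E s) H' ->
  [/\ g mu = G mu^-1, derive1 g mu = - (mu^-1 * mu^-1) * E mu^-1 &
      derive1 (derive1 g) mu = - (mu^-1 * mu^-1) * H'].
Proof.
move=> K0 mu0 gG GE EH.
have d1 : \forall t \near mu, derive1 g t = - (t^-1 * t^-1) * E t^-1.
  have id0 : \forall t \near mu, (t : K) != 0.
    by apply: (@cvgr_neq0 K K K (nbhs mu) _ id mu) => //; exact: cvg_id.
  have GE' := near_inv mu0 GE.
  have n : nbhs mu [set t : K | (\near t, g t = G t^-1) /\ (is_derive t^-1 1 G (E t^-1) /\ t != 0)].
    by apply: filterI; [exact: (nbhs_interior gG) | apply: filterI].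
  apply: filterS n => t [gt [GEt t0]].
  rewrite derive1E (near_eq_derive _ gt) -derive1E.
  rewrite (derive1_is_derive (is_derive1_inv_comp t0 GEt)).
  by rewrite -[_ *: _]/(_ * _) -invfM -expr2.
split; first exact: (nbhs_singleton gG).
  exact: (nbhs_singleton d1).
rewrite derive1E (near_eq_derive _ d1) -derive1E.
rewrite (derive1_is_derive (is_derive1_inv_comp mu0 EH)).
by rewrite -[_ *: _]/(_ * _) -invfM -expr2.
Qed.

Lemma jet_inv_weight2 f g mu : point = 0 :> K -> mu != 0 ->
  twice_diff_near f mu^-1 ->
  (\forall t \near mu, g t = t^-1 * t^-1 * f t^-1) ->
  let s := mu^-1 in
  [/\ g mu = s ^+ 2 * f s,
      derive1 g mu = - (2 * s ^+ 3 * f s + s ^+ 4 * derive1 f s) &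
      derive1 (derive1 g) mu =
        6 * s ^+ 4 * f s + 6 * s ^+ 5 * derive1 f s + s ^+ 6 * derive1 (derive1 f) s].
Proof.
move=> K0 mu0 hf gf s; have [h1 h2] := twice_diff_jet hf.
pose G x := x * x * f x; pose E x := 2 * x * f x + x * x * derive1 f x.
have GE : \forall x \near s, is_derive (x : K) 1 G (E x).
  apply: filterS h1 => x fx.
  apply: is_derive_cast (is_derive_mul (is_derive_mul (is_derive_id1 x) (is_derive_id1 x)) fx) _.
  by rewrite /E; ring.
have f1 := nbhs_singleton h1.
have i := is_derive_id1 s.
have EH : is_derive s 1 (fun x => - (x * x) * E x)
   (- (6 * s ^+ 2 * f s + 6 * s ^+ 3 * derive1 f s + s ^+ 4 * derive1 (derive1 f) s)).
  apply: is_derive_cast (is_derive_mul (is_derive_opp (is_derive_mul i i))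
     (is_derive_add (is_derive_mul (is_derive_mul (is_derive_cst1 2 s) i) f1)
       (is_derive_mul (is_derive_mul i i) h2))) _.
  by rewrite -/s; ring.
have [e0 e1 e2] := jet_inv K0 mu0 gf GE EH.
by split; [rewrite e0 /G expr2 | rewrite e1 /E -/s; ring | rewrite e2 -/s; ring].
Qed.

(** The double inverse keeps [g] in the form [G t^-1] that [jet_inv] expects. *)
Lemma jet_inv_weightN2 f g mu : point = 0 :> K -> mu != 0 ->
  twice_diff_near f mu^-1 ->
  (\forall t \near mu, g t = - (t^-1^-1 * t^-1^-1) * f t^-1) ->
  let s := mu^-1 in
  [/\ g mu = - (s ^- 2 * f s),
      derive1 g mu = - (2 * s^-1 * f s) + derive1 f s &
      derive1 (derive1 g) mu =
        - (2 * f s) + 2 * s * derive1 f s - s ^+ 2 * derive1 (derive1 f) s].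
Proof.
move=> K0 mu0 hf gf s; have [h1 h2] := twice_diff_jet hf.
have s0 : s != 0 by rewrite invr_eq0.
pose G x := - (x^-1 * x^-1) * f x.
pose E x := 2 * (x^-1 * x^-1 * x^-1) * f x - x^-1 * x^-1 * derive1 f x.
have dV (x : K) : x != 0 -> is_derive x 1 (fun y => y^-1) (- (x^-1 * x^-1)).
  move=> x0; apply: is_derive_cast (is_derive_recip (f := fun y => y) x0 (is_derive_id1 x)) _.
  by rewrite mulr1 expr2 invfM.
have id0 : \forall x \near s, (x : K) != 0.
  by apply: (@cvgr_neq0 K K K (nbhs s) _ id s) => //; exact: cvg_id.
have GE : \forall x \near s, is_derive (x : K) 1 G (E x).
  have n : nbhs s [set x : K | is_derive x 1 f (derive1 f x) /\ x != 0] by apply: filterI.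
  apply: filterS n => x [fx x0].
  apply: is_derive_cast (is_derive_mul (is_derive_opp (is_derive_mul (dV x x0) (dV x x0))) fx) _.
  by rewrite /E; ring.
have f1 := nbhs_singleton h1.
have i := is_derive_id1 s; have v := dV s s0.
have EH : is_derive s 1 (fun x => - (x * x) * E x)
   (2 * s ^- 2 * f s - 2 * s^-1 * derive1 f s + derive1 (derive1 f) s).
  have vvv := is_derive_mul (is_derive_mul v v) v.
  apply: is_derive_cast (is_derive_mul (is_derive_opp (is_derive_mul i i))
     (is_derive_add (is_derive_mul (is_derive_mul (is_derive_cst1 2 s) vvv) f1)
       (is_derive_opp (is_derive_mul (is_derive_mul v v) h2)))) _.
  by rewrite /E; field.
have [e0 e1 e2] := jet_inv K0 mu0 gf GE EH.
split; first by rewrite e0 /G -/s mulNr -invfM -expr2.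
  by rewrite e1 /E -/s; field.
by rewrite e2 -/s; field.
Qed.

End JetInversion.

(** * Inversion of the instanton family *)

Section InstantonInversion.
Variable R : realType.
Local Notation C := (Cplx R).
Implicit Types (p q t : C).

Lemma theta2_inv (w : C) : `|complex.Im w| < complex.Re w ->
  theta2 (w ^+ 2)^-1 = w * theta4 (w ^+ 2).
Proof.
move=> hw; rewrite /theta2 /theta4 (theta_inv _ _ hw) oppr0.
by rewrite mulr0 expC0 mulr1.
Qed.

Lemma theta3_inv (w : C) : `|complex.Im w| < complex.Re w ->
  theta3 (w ^+ 2)^-1 = w * theta3 (w ^+ 2).
Proof.
move=> hw; rewrite /theta3 (theta_inv _ _ hw) oppr0.
by rewrite mulr0 expC0 mulr1.
Qed.

Lemma half_sub1 : - (2^-1) + 1 = 2^-1 :> C.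
Proof. by field. Qed.

(** Inversion yields the first characteristic [- 2^-1], which the period 1 brings back to [2^-1]. *)
Lemma theta4_inv (w : C) : `|complex.Im w| < complex.Re w ->
  theta4 (w ^+ 2)^-1 = w * theta2 (w ^+ 2).
Proof.
move=> hw; rewrite /theta2 /theta4 (theta_inv _ _ hw).
rewrite -(theta_addr1 _ _ (cone_sqr_gt0 hw)) half_sub1.
by rewrite mulr0 mul0r expC0 mulr1.
Qed.

Lemma dtheta_half_inv (w p q : C) : `|complex.Im w| < complex.Re w ->
  dtheta p (q + 2^-1) (w ^+ 2)^-1 =
  w * expC (2 * piC R * 'i * p * (q + 2^-1)) * (- 'i * w ^+ 2)
    * dtheta (- q + 2^-1) p (w ^+ 2).
Proof.
move=> hw; rewrite (dtheta_inv p (q + 2^-1) hw).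
rewrite -(dtheta_addr1 (- (q + 2^-1)) p (cone_sqr_gt0 hw)).
have -> : - (q + 2^-1) + 1 = - q + 2^-1 by rewrite opprD -addrA half_sub1.
exact: erefl.
Qed.

(** The factor [w] and the exponential are common to [theta] and [dtheta] and cancel. The surviving
    [- 'i * w ^+ 2] is inverted and squared, whence the minus sign. *)
Lemma F_inst_inv (Lambda p q t : C) : 0 < complex.Re t ->
  F_inst Lambda p q t^-1 = - t ^- 2 * F_inst Lambda (- q) p t.
Proof.
move=> t0; have [w [wt hw]] := exists_cone_sqrt t0; rewrite -wt.
have w0 := cone_neq0 hw.
rewrite /F_inst (theta_inv p q hw) (dtheta_inv p q hw).
move: (expC_neq0 (2 * piC R * 'i * p * q)); move: (expC _) => e e0.
move: (theta _ _ _) (dtheta _ _ _) (2 / _) => T D L.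
have c0 : w * e != 0 by rewrite mulf_neq0.
have -> : w * e * (- 'i * w ^+ 2) * D = w * e * ((- 'i * w ^+ 2) * D) by rewrite !mulrA.
have E : ((- 'i * w ^+ 2)^-1) ^+ 2 = - w ^+ 2 ^- 2 :> C.
  by rewrite exprVn exprMn sqrrN sqrCi mulN1r invrN.
rewrite scale_ratio //.
have -> : T / (- 'i * w ^+ 2 * D) = (T / D) * (- 'i * w ^+ 2)^-1 by rewrite invfM mulrA mulrAC.
rewrite exprMn E.
by move: ((T / D) ^+ 2) (w ^+ 2 ^- 2) => x y; ring.
Qed.

(** The half shift of [q] produces [expC (piC R * 'i * p)], which cancels the normalisation of
    [w1_inst]; [w3_inst] has none. *)
Lemma w1_inst_inv p q t : 0 < complex.Re t ->
  w1_inst p q t^-1 = t ^+ 2 * w3_inst (- q) p t.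
Proof.
move=> t0; have [w [wt hw]] := exists_cone_sqrt t0; rewrite -wt.
have w0 := cone_neq0 hw.
rewrite /w1_inst /w3_inst (theta3_inv hw) (theta4_inv hw) (theta_inv p q hw).
rewrite (dtheta_half_inv p q hw).
have -> : expC (2 * piC R * 'i * p * (q + 2^-1)) =
    expC (piC R * 'i * p) * expC (2 * piC R * 'i * p * q).
  by rewrite -expCD; congr expC; field.
move: (expC_neq0 (2 * piC R * 'i * p * q)); move: (expC (2 * _ * _ * _ * _)) => e e0.
move: (expC_neq0 (piC R * 'i * p)); move: (expC _) => f f0.
move: (theta2 _) (theta3 _) (theta _ _ _) (dtheta _ _ _) => T2 T3 T D.
have c0 : f * (w * e) != 0 by rewrite !mulf_neq0.
have -> : w * (f * e) * (- 'i * w ^+ 2) * D = f * (w * e) * ((- 'i * w ^+ 2) * D) by ring.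
have -> : f * (w * e * T) = f * (w * e) * T by ring.
rewrite scale_ratio //.
have i2 : 'i * 'i = -1 :> C by rewrite -expr2 sqrCi.
move: (T^-1) => T'.
have -> : - ('i / 2) * (w * T3) * (w * T2) * (- 'i * w ^+ 2 * D * T')
  = 'i * 'i * (1 / 2) * T2 * T3 * (w ^+ 2 ^+ 2 * (D * T')) by ring.
by rewrite i2; ring.
Qed.

(** The product of the two half shifts gives [expC (piC R * 'i * 2^-1) = 'i]. The exponential in [p]
    cancels, and the one in [q] becomes the normalisation for [- q]. *)
Lemma w2_inst_inv p q t : 0 < complex.Re t ->
  w2_inst p q t^-1 = t ^+ 2 * w2_inst (- q) p t.
Proof.
move=> t0; have [w [wt hw]] := exists_cone_sqrt t0; rewrite -wt.
have w0 := cone_neq0 hw.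
rewrite /w2_inst (theta2_inv hw) (theta4_inv hw) (theta_inv p q hw).
rewrite (dtheta_half_inv (p + 2^-1) q hw).
have eI : expC (piC R * 'i * 2^-1) = 'i.
  have -> : piC R * 'i * 2^-1 = 'i * ((pi / 2 : R)%:C)%C.
    rewrite realM (_ : ((2^-1 : R)%:C)%C = 2^-1 :> C); last by rewrite natr_complex -fmorphV.
    by rewrite mulrAC mulrC.
  by rewrite Re_expC_imag cos_pihalf sin_pihalf imC.
have -> : expC (2 * piC R * 'i * (p + 2^-1) * (q + 2^-1)) =
    expC (piC R * 'i * 2^-1) * expC (piC R * 'i * p) * expC (piC R * 'i * q)
    * expC (2 * piC R * 'i * p * q).
  by rewrite -!expCD; congr expC; field.
rewrite eI.
have -> : expC (piC R * 'i * - q) = (expC (piC R * 'i * q))^-1.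
  by rewrite -expCN mulrN.
move: (expC_neq0 (2 * piC R * 'i * p * q)); move: (expC (2 * _ * _ * _ * _)) => e e0.
move: (expC_neq0 (piC R * 'i * p)); move: (expC (_ * p)) => f f0.
move: (expC_neq0 (piC R * 'i * q)); move: (expC _) => g g0.
move: (theta2 _) (theta4 _) (theta _ _ _) (dtheta _ _ _) => T2 T4 T D.
have c0 : f * (w * e) != 0 by rewrite !mulf_neq0.
have -> : w * ('i * f * g * e) * (- 'i * w ^+ 2) * D =
  f * (w * e) * ('i * g * (- 'i * w ^+ 2) * D) by ring.
have -> : f * (w * e * T) = f * (w * e) * T by ring.
rewrite scale_ratio // invfM invrK.
have i2 : 'i * 'i = -1 :> C by rewrite -expr2 sqrCi.
move: (T^-1) => T'.
have -> : 'i / 2 * (w * T4) * (w * T2) * ('i * g * (- 'i * w ^+ 2) * D * T')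
  = - ('i * 'i) * ('i / 2) * T2 * T4 * (w ^+ 2 ^+ 2 * g * (D * T')) by ring.
by rewrite i2; ring.
Qed.

(** The half shift of [p] creates [expC (piC R * 'i * q)], the normalisation in
    [w1_inst (- q) p]. *)
Lemma w3_inst_inv p q t : 0 < complex.Re t ->
  w3_inst p q t^-1 = - t ^+ 2 * w1_inst (- q) p t.
Proof.
move=> t0; have [w [wt hw]] := exists_cone_sqrt t0; rewrite -wt.
have w0 := cone_neq0 hw.
rewrite /w1_inst /w3_inst (theta3_inv hw) (theta2_inv hw) (theta_inv p q hw).
rewrite (dtheta_inv (p + 2^-1) q hw).
have -> : expC (2 * piC R * 'i * (p + 2^-1) * q) =
    expC (piC R * 'i * q) * expC (2 * piC R * 'i * p * q).
  by rewrite -expCD; congr expC; field.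
have -> : expC (piC R * 'i * - q) = (expC (piC R * 'i * q))^-1.
  by rewrite -expCN mulrN.
move: (expC_neq0 (2 * piC R * 'i * p * q)); move: (expC (2 * _ * _ * _ * _)) => e e0.
move: (expC_neq0 (piC R * 'i * q)); move: (expC _) => g g0.
move: (theta3 _) (theta4 _) (theta _ _ _) (dtheta _ _ _) => T3 T4 T D.
have c0 : w * e != 0 by rewrite !mulf_neq0.
have -> : w * (g * e) * (- 'i * w ^+ 2) * D = w * e * (g * (- 'i * w ^+ 2) * D) by ring.
rewrite scale_ratio // invfM invrK; move: (T^-1) => T'.
by field.
Qed.

End InstantonInversion.

(** * Transformation of the coefficients *)

Lemma derive1_opp (K : numFieldType) (f : K -> K) : point = 0 :> K ->
  derive1 (fun t => - f t) = (fun t => - derive1 f t).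
Proof.
move=> K0; apply/funext => t; rewrite !derive1E.
apply: (@derive_linear_involution K K K -%R f t 1) => //; last exact: opprK.
exact: opp_continuous.
Qed.

(** [sdw2] with the jets as independent variables, so that its transformation is an identity of
    rational functions. *)
Definition sdw2_jet (F : fieldType) (a b c f a1 b1 c1 f1 a2 b2 c2 f2 : F) : F :=
  - (f / 3) * (a ^+ 2 + b ^+ 2 + c ^+ 2)
  + (f / 6) * ((a ^+ 2 * b ^+ 2 - c1 ^+ 2) / c ^+ 2
             + (a ^+ 2 * c ^+ 2 - b1 ^+ 2) / b ^+ 2
             + (b ^+ 2 * c ^+ 2 - a1 ^+ 2) / a ^+ 2)
  - (f / 3) * (a1 * b1 / (a * b) + a1 * c1 / (a * c) + b1 * c1 / (b * c))
  + (f / 3) * (a2 / a + b2 / b + c2 / c)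
  - f1 ^+ 2 / (2 * f) + f2.

(** The letters [a], [b], [c], [f] stand for jets at [s = mu^-1], and [x], [y], [z], [g] for those
    at [m = mu], with axes 1 and 3 exchanged. *)
Lemma sdw2_jet_inv (F : numFieldType) (s m a b c f a1 b1 c1 f1 a2 b2 c2 f2
    x y z g x1 y1 z1 g1 x2 y2 z2 g2 : F) :
  m = s^-1 -> s != 0 -> a != 0 -> b != 0 -> c != 0 -> f != 0 ->
  [/\ x = - (s ^+ 2 * c), x1 = 2 * s ^+ 3 * c + s ^+ 4 * c1 &
      x2 = - (6 * s ^+ 4 * c + 6 * s ^+ 5 * c1 + s ^+ 6 * c2)] ->
  [/\ y = s ^+ 2 * b, y1 = - (2 * s ^+ 3 * b + s ^+ 4 * b1) &
      y2 = 6 * s ^+ 4 * b + 6 * s ^+ 5 * b1 + s ^+ 6 * b2] ->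
  [/\ z = s ^+ 2 * a, z1 = - (2 * s ^+ 3 * a + s ^+ 4 * a1) &
      z2 = 6 * s ^+ 4 * a + 6 * s ^+ 5 * a1 + s ^+ 6 * a2] ->
  [/\ g = - (s ^- 2 * f), g1 = - (2 * s^-1 * f) + f1 &
      g2 = - (2 * f) + 2 * s * f1 - s ^+ 2 * f2] ->
  sdw2_jet a b c f a1 b1 c1 f1 a2 b2 c2 f2 =
    - m ^+ 2 * sdw2_jet x y z g x1 y1 z1 g1 x2 y2 z2 g2.
Proof.
move=> -> s0 a0 b0 c0 f0 [-> -> ->] [-> -> ->] [-> -> ->] [-> -> ->].
by rewrite /sdw2_jet; field; rewrite s0 a0 b0 c0 f0.
Qed.

Lemma weight2_canl (F : fieldType) (t x y : F) :
  t != 0 -> x = t ^+ 2 * y -> y = t^-1 * t^-1 * x.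
Proof. by move=> t0 ->; field. Qed.

Lemma weight2_oppl (F : fieldType) (t x y : F) :
  t != 0 -> x = - t ^+ 2 * y -> - y = t^-1 * t^-1 * x.
Proof. by move=> t0 ->; field. Qed.

Lemma weightN2_canl (F : fieldType) (t x y : F) :
  t != 0 -> x = - t ^- 2 * y -> y = - (t^-1^-1 * t^-1^-1) * x.
Proof. by move=> t0 ->; rewrite !invrK -exprVn; field. Qed.

(** Each coefficient contains one factor [f'] and one factor [c'] or its inverse, so the two minus
    signs cancel. *)
Lemma metric_coef_inv (F : fieldType) (t a b c f a' b' c' f' : F) : t != 0 ->
  f' = - t ^- 2 * f -> a' = t ^+ 2 * c -> b' = t ^+ 2 * b -> c' = - t ^+ 2 * a ->
  [/\ f * (a * b * c) = t ^- 4 * (f' * (a' * b' * c')),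
      f * (b * c / a) = f' * (a' * b' / c'),
      f * (c * a / b) = f' * (c' * a' / b') &
      f * (a * b / c) = f' * (b' * c' / a')].
Proof.
move=> t0 -> -> -> ->.
(* The inverses of [a], [b], [c] are split off and generalised, so that [field] has only [t] to
   invert. *)
rewrite (invfM (t ^+ 2) b) (invfM (t ^+ 2) c) (invfM (- t ^+ 2) a) invrN -!exprVn.
by move: (a^-1) (b^-1) (c^-1) => x y z; split; field.
Qed.

(** The local heat coefficient is transported unchanged; the factor [- mu ^+ 2] comes from the
    volume density. *)
Lemma sdw4_inv (R : realType) (a b c f a' b' c' f' : Cplx R -> Cplx R) (mu : Cplx R) :
  mu != 0 ->
  (\forall t \near mu, [/\ f' t^-1 = - t ^- 2 * f t, a' t^-1 = t ^+ 2 * c t,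
     b' t^-1 = t ^+ 2 * b t & c' t^-1 = - t ^+ 2 * a t]) ->
  sdw4 a' b' c' f' mu^-1 = - mu ^+ 2 * sdw4 a b c f mu.
Proof.
move=> mu0 n; have n0 : \forall t \near mu, (t : Cplx R) != 0.
  by apply: (@cvgr_neq0 _ (Cplx R) (Cplx R) (nbhs mu) _ id mu) => //; exact: cvg_id.
have gg : \forall t \near mu,
    [/\ f t * (a t * b t * c t) = t ^- 4 * (f' t^-1 * (a' t^-1 * b' t^-1 * c' t^-1)),
       f t * (b t * c t / a t) = f' t^-1 * (a' t^-1 * b' t^-1 / c' t^-1),
       f t * (c t * a t / b t) = f' t^-1 * (c' t^-1 * a' t^-1 / b' t^-1) &
       f t * (a t * b t / c t) = f' t^-1 * (b' t^-1 * c' t^-1 / a' t^-1)].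
  by apply: (filterS2 _ _ n0 n) => t t0 [hf ha hb hc]; exact: metric_coef_inv.
rewrite /sdw4; have -> := @local_heat_coef4_flip R (fun t => f' t * (a' t * b' t * c' t))
  (fun t => f' t * (b' t * c' t / a' t)) (fun t => f' t * (c' t * a' t / b' t))
  (fun t => f' t * (a' t * b' t / c' t)) _ _ _ _ mu mu0 gg.
have [hf ha hb hc] := nbhs_singleton n.
move: (local_heat_coef4 _ _ _ _ _) => L; rewrite hf ha hb hc.
by move: (f mu) (a mu) (b mu) (c mu) (piC R) => y0 y1 y2 y3 x; field.
Qed.

Lemma sdw2_inv (R : realType) (a b c f a' b' c' f' : Cplx R -> Cplx R) (mu : Cplx R) :
  mu != 0 ->
  [/\ a' mu^-1 != 0, b' mu^-1 != 0, c' mu^-1 != 0 & f' mu^-1 != 0] ->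
  [/\ twice_diff_near a' mu^-1, twice_diff_near b' mu^-1,
      twice_diff_near c' mu^-1 & twice_diff_near f' mu^-1] ->
  (\forall t \near mu, [/\ f' t^-1 = - t ^- 2 * f t, a' t^-1 = t ^+ 2 * c t,
     b' t^-1 = t ^+ 2 * b t & c' t^-1 = - t ^+ 2 * a t]) ->
  sdw2 a' b' c' f' mu^-1 = - mu ^+ 2 * sdw2 a b c f mu.
Proof.
move=> mu0 [a0 b0 c0 f0] [da db dc df] n; have C0 := point_Cplx R.
have n0 : \forall t \near mu, (t : Cplx R) != 0.
  by apply: (@cvgr_neq0 _ (Cplx R) (Cplx R) (nbhs mu) _ id mu) => //; exact: cvg_id.
(* The sign is put on [a], so that [jet_inv_weight2] serves all three functions; it is taken off the
   jet afterwards. *)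
have na : \forall t \near mu, - a t = t^-1 * t^-1 * c' t^-1.
  by apply: (filterS2 _ _ n0 n) => t t0 [_ _ _ e]; exact: weight2_oppl e.
have nb : \forall t \near mu, b t = t^-1 * t^-1 * b' t^-1.
  by apply: (filterS2 _ _ n0 n) => t t0 [_ _ e _]; exact: weight2_canl e.
have nc : \forall t \near mu, c t = t^-1 * t^-1 * a' t^-1.
  by apply: (filterS2 _ _ n0 n) => t t0 [_ e _ _]; exact: weight2_canl e.
have nf : \forall t \near mu, f t = - (t^-1^-1 * t^-1^-1) * f' t^-1.
  by apply: (filterS2 _ _ n0 n) => t t0 [e _ _ _]; exact: weightN2_canl e.
have [A0 A1 A2] := jet_inv_weight2 C0 mu0 dc na.
rewrite !(derive1_opp _ C0) in A1 A2.
have {}A0 := canRL (@opprK (Cplx R)) A0; have {}A1 := canRL (@opprK (Cplx R)) A1.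
have {}A2 := canRL (@opprK (Cplx R)) A2; rewrite opprK in A1.
have s0 : mu^-1 != 0 by rewrite invr_eq0.
exact: (sdw2_jet_inv (esym (invrK mu)) s0 a0 b0 c0 f0 (And3 A0 A1 A2)
  (jet_inv_weight2 C0 mu0 db nb) (jet_inv_weight2 C0 mu0 da nc)
  (jet_inv_weightN2 C0 mu0 df nf)).
Qed.

Section CoefficientInversion.
Variable R : realType.
Local Notation C := (Cplx R).
Implicit Types (p q t mu Lambda : C).

Lemma near_Re_gt0 mu : 0 < complex.Re mu -> \forall t \near mu, 0 < complex.Re (t : C).
Proof.
move=> m0; apply/nbhs_ballP; exists (((complex.Re mu : R)%:C)%C : C).
  by rewrite /= -[0]/(((0 : R)%:C)%C) ltcR.
move=> t; rewrite /ball /= normr_nrm ltcR => h.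
have := le_lt_trans (normr_Re_le (mu - t)) h.
by rewrite Re_add Re_opp ltr_norml => /andP[_]; lra.
Qed.

Lemma Re_gt0_neq0 mu : 0 < complex.Re mu -> mu != 0.
Proof. by move=> m0; apply/eqP => e; move: m0; rewrite e /= ltxx. Qed.

Lemma twice_diff_theta_moment j p q t : 0 < complex.Re t ->
  twice_diff_near (fun t => theta_moment j p q t) t.
Proof.
move=> t0; have n := near_Re_gt0 t0.
have dm i (x : C) : 0 < complex.Re x -> differentiable (fun t => theta_moment i p q t) x.
  move=> x0; have D := is_derive_moment_t i p q x0.
  by apply/derivable1_diffP; exact: (@ex_derive _ _ _ _ _ _ _ D).
apply: filterS (nbhs_interior n) => z nz; have z0 := nbhs_singleton nz.
split; first exact: dm.
move=> v; apply: (@differentiable_near_eq _ _ _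
    (fun x => (v * - piC R) * theta_moment j.+2 p q x)).
  apply: filterS nz => x x0; rewrite (derive_dir1 v (dm j x x0)).
  have D := is_derive_moment_t j p q x0; rewrite derive_val.
  by rewrite -[_ *: _]/(_ * _) mulrA.
by apply: differentiableM; [exact: differentiable_cst | exact: dm].
Qed.

Lemma twice_diff_theta p q t : 0 < complex.Re t ->
  twice_diff_near (fun t => theta p q t) t.
Proof.
move=> t0; apply: twice_diff_near_eq (twice_diff_theta_moment 0 p q t0).
by apply: filterE => x; rewrite theta_moment0.
Qed.

Lemma twice_diff_dtheta p q t : 0 < complex.Re t ->
  twice_diff_near (fun t => dtheta p q t) t.
Proof.
move=> t0; apply: (twice_diff_near_eq (f := fun t => 2 * piC R * 'i * theta_moment 1 p q t)).
  by apply: filterS (near_Re_gt0 t0) => x x0; rewrite dtheta_moment.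
exact: twice_diff_mul (twice_diff_cst _ _) (twice_diff_theta_moment 1 p q t0).
Qed.

Lemma twice_diff_w1 p q t : 0 < complex.Re t -> theta p q t != 0 ->
  twice_diff_near (w1_inst p q) t.
Proof.
move=> t0 th0; rewrite /w1_inst /theta3 /theta4.
apply: twice_diff_mul; first apply: twice_diff_mul; first apply: twice_diff_mul.
- exact: twice_diff_cst.
- exact: twice_diff_theta.
- exact: twice_diff_theta.
apply: twice_diff_mul; first exact: twice_diff_dtheta.
apply: twice_diff_recip; first by rewrite mulf_neq0 // expC_neq0.
by apply: twice_diff_mul; [exact: twice_diff_cst | exact: twice_diff_theta].
Qed.

Lemma twice_diff_w2 p q t : 0 < complex.Re t -> theta p q t != 0 ->
  twice_diff_near (w2_inst p q) t.
Proof.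
move=> t0 th0; rewrite /w2_inst /theta2 /theta4.
apply: twice_diff_mul; first apply: twice_diff_mul; first apply: twice_diff_mul.
- exact: twice_diff_cst.
- exact: twice_diff_theta.
- exact: twice_diff_theta.
apply: twice_diff_mul; first exact: twice_diff_dtheta.
apply: twice_diff_recip; first by rewrite mulf_neq0 // expC_neq0.
by apply: twice_diff_mul; [exact: twice_diff_cst | exact: twice_diff_theta].
Qed.

Lemma twice_diff_w3 p q t : 0 < complex.Re t -> theta p q t != 0 ->
  twice_diff_near (w3_inst p q) t.
Proof.
move=> t0 th0; rewrite /w3_inst /theta2 /theta3.
apply: twice_diff_mul; first apply: twice_diff_mul; first apply: twice_diff_mul.
- exact: twice_diff_cst.
- exact: twice_diff_theta.
- exact: twice_diff_theta.
apply: twice_diff_mul; first exact: twice_diff_dtheta.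
by apply: twice_diff_recip => //; exact: twice_diff_theta.
Qed.

Lemma twice_diff_F Lambda p q t : 0 < complex.Re t -> dtheta p q t != 0 ->
  twice_diff_near (F_inst Lambda p q) t.
Proof.
move=> t0 d0; have h : twice_diff_near (fun t => theta p q t * (dtheta p q t)^-1) t.
  apply: twice_diff_mul; first exact: twice_diff_theta.
  by apply: twice_diff_recip => //; exact: twice_diff_dtheta.
apply: twice_diff_mul; first exact: twice_diff_cst.
exact: (twice_diff_mul h h).
Qed.

Lemma sdw0_inst_inv Lambda p q mu : 0 < complex.Re mu ->
  sdw0_inst Lambda p q mu^-1 = - mu ^+ 2 * sdw0_inst Lambda (- q) p mu.
Proof.
move=> m0; have mu0 := Re_gt0_neq0 m0.
rewrite /sdw0_inst /sdw0 w1_inst_inv // w2_inst_inv // w3_inst_inv // F_inst_inv //.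
move: (F_inst _ _ _ _) (w1_inst _ _ _) (w2_inst _ _ _) (w3_inst _ _ _) => f a b c.
by field.
Qed.

Lemma near_inst_inv Lambda p q mu : 0 < complex.Re mu ->
  \forall t \near mu,
    [/\ F_inst Lambda p q t^-1 = - t ^- 2 * F_inst Lambda (- q) p t,
        w1_inst p q t^-1 = t ^+ 2 * w3_inst (- q) p t,
        w2_inst p q t^-1 = t ^+ 2 * w2_inst (- q) p t &
        w3_inst p q t^-1 = - t ^+ 2 * w1_inst (- q) p t].
Proof.
move=> m0; apply: filterS (near_Re_gt0 m0) => t t0; split.
- exact: F_inst_inv.
- exact: w1_inst_inv.
- exact: w2_inst_inv.
- exact: w3_inst_inv.
Qed.

Lemma sdw2_inst_inv Lambda p q mu : Lambda != 0 -> 0 < complex.Re mu ->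
  theta p q mu^-1 != 0 -> dtheta p q mu^-1 != 0 ->
  w1_inst p q mu^-1 != 0 -> w2_inst p q mu^-1 != 0 -> w3_inst p q mu^-1 != 0 ->
  sdw2_inst Lambda p q mu^-1 = - mu ^+ 2 * sdw2_inst Lambda (- q) p mu.
Proof.
move=> L0 m0 th0 dth0 a0 b0 c0; have mu0 := Re_gt0_neq0 m0.
have s0 := Re_inv_gt0 m0; have C0 := point_Cplx R.
have f0 : F_inst Lambda p q mu^-1 != 0.
  have p0 : piC R != 0.
    by apply/eqP => e; have := nrm_pi R; rewrite e nrm0 => h; have := pi_gt0 R; rewrite -h ltxx.
  rewrite /F_inst mulf_neq0 ?expf_neq0 // mulf_neq0 ?invr_eq0 ?mulf_neq0 ?pnatr_eq0 //.
apply: (@sdw2_inv R (w1_inst (- q) p) (w2_inst (- q) p) (w3_inst (- q) p)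
  (F_inst Lambda (- q) p) (w1_inst p q) (w2_inst p q) (w3_inst p q) (F_inst Lambda p q) mu mu0).
- by split.
- split; [exact: twice_diff_w1 | exact: twice_diff_w2 | exact: twice_diff_w3 |].
  exact: twice_diff_F.
exact: near_inst_inv.
Qed.

Lemma sdw4_inst_inv Lambda p q mu : 0 < complex.Re mu ->
  sdw4_inst Lambda p q mu^-1 = - mu ^+ 2 * sdw4_inst Lambda (- q) p mu.
Proof.
move=> m0; apply: sdw4_inv; first exact: Re_gt0_neq0.
exact: near_inst_inv.
Qed.

End CoefficientInversion.

Theorem theorem6p2 (R : realType) (Lambda p q mu : Cplx R)
    (Lambda_neq0 : Lambda != 0) (mu_gt0 : 0 < complex.Re mu)
    (theta_neq0 : theta p q mu^-1 != 0)
    (dtheta_neq0 : dtheta p q mu^-1 != 0) :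
  sdw0_inst Lambda p q mu^-1 = - mu ^+ 2 * sdw0_inst Lambda (- q) p mu /\
  (w1_inst p q mu^-1 != 0 -> w2_inst p q mu^-1 != 0 ->
   w3_inst p q mu^-1 != 0 ->
   sdw2_inst Lambda p q mu^-1 = - mu ^+ 2 * sdw2_inst Lambda (- q) p mu /\
   sdw4_inst Lambda p q mu^-1 = - mu ^+ 2 * sdw4_inst Lambda (- q) p mu).
Proof.
split; first exact: sdw0_inst_inv.
move=> a0 b0 c0; split; [exact: sdw2_inst_inv | exact: sdw4_inst_inv].
Qed.
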